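(* Let $N,n,m,r$ be non-negative integers with $N\ge n$, $r\le n$ and $N-r+1\ge m$. Let $G(q)=\sum_T q^{\operatorname{maj}(T)}$, the sum running over all standard Young tableaux $T$ of skew shape $(N,N-1,\dots,N-n+1)/(m^r)$. (a) If $N-n$ is even, put $s=(N-n)/2$. Then $G(q)$ equals $$(-1)^{\binom{s}{2}+\frac12 r(N-n)}(1+q)^{\binom n2-\binom{s}{2}-mr}(1-q)^{-\binom{s}{2}-r(N-n)}\, q^{\frac12 mr(r+m-2n)+\frac12 r(N-n)\left(\frac12(N-3n)-m+1\right)+\binom{n+1}{3}+(N-n)\left(\binom n2+\binom{s}{2}\right)}$$ $$\times\frac{\left[\binom{N+1}{2}-\binom{N-n+1}{2}-mr\right]_q!}{\left([r+s-1]_{q^2}!\right)^{s}\left([\tfrac{N+n-2}{2}]_{q^2}!\right)^{s}}\cdot\frac{\prod_{i=1}^{(N+n)/2}[i-1]_{q^2}!}{\prod_{i=1}^{n}[N-n+2i-1]_q!} \prod_{i=1}^{r}\frac{[s+i-1]_{q^2}!\,[n+m-r+2i-1]_q!\,(q^{n+m-r+2i};q^2)_{s}}{[m+i-1]_{q^2}!\,[N-m-r+2i-1]_q!}$$ $$\times\sum_{0\le\ell_1<\ell_2<\dots<\ell_s\le r+s-1} q^{\sum_{i=1}^{s}(N+n-2(2i-1))\ell_i}\prod_{1\le i<j\le s}[\ell_j-\ell_i]_{q^2}^2 \prod_{i=1}^{s}\left(\binom{s-1+r}{\ell_i}_{q^2}(q^{2-N-n};q^2)_{\ell_i}\,(q^{n+m-r-2i+1};q^2)_{r+i-\ell_i-1}\,\frac{(q^{N-m-r-2i+2};q^2)_{r+i-\ell_i-1}}{(q^{N+m-r-2i+2};q^2)_{r+i-\ell_i-1}}\right).$$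 (b) If $N-n$ is odd, put $t=(N-n+1)/2$. Then $G(q)$ equals $$(-1)^{\binom{t}{2}+\frac12 r(N-n+1)}(1+q)^{\binom n2-\binom{t}{2}-mr}(1-q)^{-\binom{t}{2}-r(N-n)}\, q^{\frac12 mr(r+m-2n+2)+\frac12 r(N-n+1)\left(\frac12(N-3n+1)-m\right)+\binom{n+1}{3}+(N-n)\binom n2+(N-n+1)\binom{t}{2}}$$ $$\times\frac{\left[\binom{N+1}{2}-\binom{N-n+1}{2}-mr\right]_q!}{\left([r+\tfrac{N-n-1}{2}]_{q^2}!\right)^{t}\left([\tfrac{N+n-1}{2}]_{q^2}!\right)^{t}}\cdot\frac{\prod_{i=1}^{(N+n+1)/2}[i-1]_{q^2}!}{\prod_{i=1}^{n}[N-n+2i-1]_q!} \prod_{i=1}^{r}\frac{[t+i-1]_{q^2}!\,[n+m-r+2i-1]_q!\,(q^{n+m-r+2i+1};q^2)_{(N-n-1)/2}}{[m+i-1]_{q^2}!\,[N-m-r+2i-1]_q!}$$ $$\times\sum_{0\le\ell_1<\ell_2<\dots<\ell_t\le r+\frac{N-n-1}{2}} q^{\sum_{i=1}^{t}(N+n+1-2(2i-1))\ell_i}\prod_{1\le i<j\le t}[\ell_j-\ell_i]_{q^2}^2 \prod_{i=1}^{t}\left(\binom{\frac{N-n-1}{2}+r}{\ell_i}_{q^2}(q^{1-N-n};q^2)_{\ell_i}\,(q^{n+m-r-2i+2};q^2)_{r+i-\ell_i-1}\,\frac{(q^{N-m-r-2i+2};q^2)_{r+i-\ell_i-1}}{(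q^{N+m-r-2i+2};q^2)_{r+i-\ell_i-1}}\right).$$
   Context: Partitions are written as $n$-tuples of weakly decreasing non-negative integers. For $\lambda=(\lambda_1,\dots,\lambda_n)$, $\mu=(\mu_1,\dots,\mu_n)$ with $\lambda_i\ge\mu_i$ for all $i$, a standard Young tableau of skew shape $\lambda/\mu$ is a filling of the cells $(i,j)$, $1\le i\le n$, $\mu_i<j\le\lambda_i$, with the numbers $1,2,\dots,\sum_i(\lambda_i-\mu_i)$, each used once, such that entries increase along each row (left to right) and along each column (top to bottom). The major index $\operatorname{maj}(T)$ is the sum of all $i$ such that $i+1$ lies in a lower row of $T$ than $i$. $(m^r)$ denotes the partition $(m,\dots,m,0,\dots,0)$ with $r$ entries equal to $m$ (padded with zeros to length $n$). Notation: $[\alpha]_q=\frac{1-q^\alpha}{1-q}$, $[k]_q!=[k]_q[k-1]_q\cdots[1]_q$, $[0]_q!=1$; $[\alpha]_{q^2}$, $[k]_{q^2}!$ are the same with $q$ replaced by $q^2$. $(\alpha;q)_k=(1-\alpha)(1-\alpha q)\cdots(1-\alpha q^{k-1})$ for $k\ge1$, $(\alpha;q)_0=1$. The Gaussian binomial is $\binom{a}{k}_{q^2}=\frac{(q^2;q^2)_a}{(q^2;q^2)_k(q^2;q^2)_{a-k}}$ for $0\le k\le a$. *)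

(* Defs.v *)
From HB Require Import structures.
From mathcomp Require Import all_boot all_order all_algebra.
Set Implicit Arguments. Unset Strict Implicit. Unset Printing Implicit Defensive.
Import Order.TTheory GRing.Theory Num.Theory.

(* Partitions are sequences of nat (padded with 0 via nth 0).
   Rows are indexed by 'I_R (0-based, top to bottom), columns by 'I_C
   (0-based, left to right).  Cell (i,j) (0-based) belongs to lam/mu iff
   mu_i <= j < lam_i.  A filling is a finite function into 'I_(R*C).+1,
   taking value 0 outside the shape. *)

Section SkewSYT.
Variables (R C : nat) (lam mu : seq nat).

Definition incell (c : 'I_R * 'I_C) : bool :=
  (nth 0 mu c.1 <= c.2) && (c.2 < nth 0 lam c.1).

Definition ncells : nat := #|[pred c | incell c]|.

Definition is_SYT (T : {ffun 'I_R * 'I_C -> 'I_(R * C).+1}) : bool :=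
  [&& [forall c, ~~ incell c ==> (T c == 0 :> nat)],
      [forall c, incell c ==> (0 < T c <= ncells)],
      [forall k : 'I_(R * C).+1,
         (0 < k <= ncells) ==> [exists c, incell c && (T c == k)]],
      [forall c, forall c', [&& incell c, incell c' & T c == T c'] ==> (c == c')],
      [forall c, forall c',
         [&& incell c, incell c', c.1 == c'.1 & (c.2 < c'.2)%N] ==> (T c < T c')]
    & [forall c, forall c',
         [&& incell c, incell c', c.2 == c'.2 & (c.1 < c'.1)%N] ==> (T c < T c')]].

Definition maj (T : {ffun 'I_R * 'I_C -> 'I_(R * C).+1}) : nat :=
  \sum_(c | incell c)
     \sum_(c' | [&& incell c', (T c' == (T c).+1 :> nat) & (c.1 < c'.1)%N])
        (T c : nat).

End SkewSYT.

Local Open Scope ring_scope.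

Definition F := {fraction {poly rat}}.
Definition q : F := FracField.tofrac ('X : {poly rat}).

Definition Gmaj (R C : nat) (lam mu : seq nat) : F :=
  \sum_(T : {ffun 'I_R * 'I_C -> 'I_(R * C).+1} | is_SYT lam mu T)
     q ^+ maj lam mu T.

Definition lamN (N n : nat) : seq nat := [seq (N - i)%N | i <- iota 0 n].
Definition muMR (m r : nat) : seq nat := nseq r m.
Definition G (N n m r : nat) : F := Gmaj n N (lamN N n) (muMR m r).

Definition qint (x : F) (a : nat) : F := (1 - x ^+ a) / (1 - x).
Definition qfact (x : F) (k : nat) : F := \prod_(1 <= j < k.+1) qint x j.
Definition qpoch (a x : F) (k : nat) : F := \prod_(0 <= j < k) (1 - a * x ^+ j).
Definition gauss (x : F) (a k : nat) : F :=
  qpoch x x a / (qpoch x x k * qpoch x x (a - k)).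

Definition Z (k : nat) : int := k%:Z.

Definition ell (s M : nat) (l : s.-tuple 'I_M) (i : nat) : nat :=
  nth 0%N [seq val x | x <- l] i.-1.

Definition RHSa (N n m r : nat) : F :=
  let s := ((N - n)./2)%N in
  (-1) ^+ ('C(s, 2) + (r * (N - n))./2)%N
  * (1 + q) ^ (Z 'C(n, 2) - Z 'C(s, 2) - Z (m * r))
  * (1 - q) ^ (- Z 'C(s, 2) - Z r * (Z N - Z n))
  * q ^ (divz (Z m * Z r * (Z r + Z m - 2 * Z n)) 2
         + (divz (Z r * (Z N - Z n)) 2) * (divz (Z N - 3 * Z n) 2 - Z m + 1)
         + Z 'C(n.+1, 3) + (Z N - Z n) * (Z 'C(n, 2) + Z 'C(s, 2)))
  * (qfact q ('C(N.+1, 2) - ('C(N - n + 1, 2) + m * r))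
     / ((qfact (q ^+ 2) (r + s - 1)) ^+ s * (qfact (q ^+ 2) ((N + n - 2)./2)) ^+ s))
  * ((\prod_(1 <= i < ((N + n)./2).+1) qfact (q ^+ 2) (i - 1))
     / (\prod_(1 <= i < n.+1) qfact q (N + 2 * i - (n + 1))))
  * (\prod_(1 <= i < r.+1)
       ((qfact (q ^+ 2) (s + i - 1) * qfact q (n + m + 2 * i - (r + 1))
         * qpoch (q ^+ (n + m + 2 * i - r)) (q ^+ 2) s)
        / (qfact (q ^+ 2) (m + i - 1) * qfact q (N + 2 * i - (m + r + 1)))))
  * \sum_(l : s.-tuple 'I_(r + s) | sorted ltn [seq val x | x <- l])
      (q ^ (\sum_(1 <= i < s.+1)
              (Z N + Z n - 2 * (2 * Z i - 1)) * Z (ell l i))%R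
       * (\prod_(1 <= i < s.+1) \prod_(i.+1 <= j < s.+1)
            (qint (q ^+ 2) (ell l j - ell l i)) ^+ 2)
       * \prod_(1 <= i < s.+1)
           (gauss (q ^+ 2) (s - 1 + r) (ell l i)
            * qpoch (q ^ (2 - Z N - Z n)) (q ^+ 2) (ell l i)
            * qpoch (q ^ (Z n + Z m - Z r - 2 * Z i + 1)) (q ^+ 2)
                    (r + i - (ell l i + 1))
            * (qpoch (q ^ (Z N - Z m - Z r - 2 * Z i + 2)) (q ^+ 2)
                     (r + i - (ell l i + 1))
               / qpoch (q ^ (Z N + Z m - Z r - 2 * Z i + 2)) (q ^+ 2)
                     (r + i - (ell l i + 1))))).

Definition RHSb (N n m r : nat) : F :=
  let t := ((N - n + 1)./2)%N in
  let u := ((N - n - 1)./2)%N in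
  (-1) ^+ ('C(t, 2) + (r * (N - n + 1))./2)%N
  * (1 + q) ^ (Z 'C(n, 2) - Z 'C(t, 2) - Z (m * r))
  * (1 - q) ^ (- Z 'C(t, 2) - Z r * (Z N - Z n))
  * q ^ (divz (Z m * Z r * (Z r + Z m - 2 * Z n + 2)) 2
         + (divz (Z r * (Z N - Z n + 1)) 2) * (divz (Z N - 3 * Z n + 1) 2 - Z m)
         + Z 'C(n.+1, 3) + (Z N - Z n) * Z 'C(n, 2)
         + (Z N - Z n + 1) * Z 'C(t, 2))
  * (qfact q ('C(N.+1, 2) - ('C(N - n + 1, 2) + m * r))
     / ((qfact (q ^+ 2) (r + u)) ^+ t * (qfact (q ^+ 2) ((N + n - 1)./2)) ^+ t))
  * ((\prod_(1 <= i < ((N + n + 1)./2).+1) qfact (q ^+ 2) (i - 1))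
     / (\prod_(1 <= i < n.+1) qfact q (N + 2 * i - (n + 1))))
  * (\prod_(1 <= i < r.+1)
       ((qfact (q ^+ 2) (t + i - 1) * qfact q (n + m + 2 * i - (r + 1))
         * qpoch (q ^+ (n + m + 2 * i + 1 - r)) (q ^+ 2) u)
        / (qfact (q ^+ 2) (m + i - 1) * qfact q (N + 2 * i - (m + r + 1)))))
  * \sum_(l : t.-tuple 'I_(r + u + 1) | sorted ltn [seq val x | x <- l])
      (q ^ (\sum_(1 <= i < t.+1)
              (Z N + Z n + 1 - 2 * (2 * Z i - 1)) * Z (ell l i))%R
       * (\prod_(1 <= i < t.+1) \prod_(i.+1 <= j < t.+1)
            (qint (q ^+ 2) (ell l j - ell l i)) ^+ 2)
       * \prod_(1 <= i < t.+1)
           (gauss (q ^+ 2) (u + r) (ell l i)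
            * qpoch (q ^ (1 - Z N - Z n)) (q ^+ 2) (ell l i)
            * qpoch (q ^ (Z n + Z m - Z r - 2 * Z i + 2)) (q ^+ 2)
                    (r + i - (ell l i + 1))
            * (qpoch (q ^ (Z N - Z m - Z r - 2 * Z i + 2)) (q ^+ 2)
                     (r + i - (ell l i + 1))
               / qpoch (q ^ (Z N + Z m - Z r - 2 * Z i + 2)) (q ^+ 2)
                     (r + i - (ell l i + 1))))).

(* Main.v *)
Require Import Defs.
From HB Require Import structures.
From mathcomp Require Import all_boot all_order all_algebra perm.
From mathcomp Require Import zify ring.
Set Implicit Arguments. Unset Strict Implicit. Unset Printing Implicit Defensive.
Import Order.TTheory GRing.Theory Num.Theory.

(* Write (x)_k for the q-shifted factorials.  Classifying tableaux by the row of
   their largest entry gives the same recursion as the one satisfied by Aitken's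
   determinant, so G(q) = (q;q)_M det(1/(q;q)_(lam_i - i - mu_j + j)), M the number
   of cells.  For the staircase, suitable row operations (an alternating sum of
   products (q;q^2)_a / (q^2;q^2)_t, evaluated in closed form) make all columns
   except the r first ones triangular; what remains is a determinant of order r + s
   with r columns of products of linear factors in p^l, p = q^-2, and s columns of
   q-binomial type.  Divided differences at the nodes p^l kill the former, the
   latter become terminating 3phi2 series, and after a 3phi2 transformation the
   Cauchy-Binet formula writes the remaining s x s determinant as a sum over
   l_1 < ... < l_s whose minors all factor.  Some denominators met on the way vanish
   for special m; since both sides are Laurent polynomials in z = q^m once
   everything else is fixed, it is enough to treat z = q^M for large M. *)

(** * Removing the largest entry of a tableau *)

(** Whether the two largest entries form a descent depends on both their rows, so removing the
    largest entry gives no recursion for G alone. A row index i is therefore carried along: tableaux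
    are weighted as if one more entry followed in row i, and in the determinant the rows above row i
    are multiplied by powers of q. The resulting sums telescope. The alternating sum has its closed
    form only if it runs to the last nonzero entry of a column, which may lie up to s rows below the
    matrix. Bordering by s unit columns makes this room and is the origin of the order r + s. The s
    functionals applied next are divided differences multiplied by polynomials of degree s - 1,
    chosen so that in the series columns they merely shift two parameters c and D. After the
    transformation the shifts survive only in the product of the two parameters, which is common to
    all functionals, and in linear factors in p^l; this is what turns the matrix into a product. The
    final sum is free of poles in z because an increasing sequence satisfies l_i <= r + i (i counted
    from 0), so that every quotient of shifted factorials in D and E is a product. *)

Section Tableaux.
Variables R C : nat.
Implicit Types (lam mu : seq nat) (c : 'I_R * 'I_C) (T : {ffun 'I_R * 'I_C -> 'I_(R * C).+1}).

Local Notation size_of lam mu := (ncells R C lam mu).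

Lemma ncells_le lam mu : size_of lam mu <= R * C.
Proof. by rewrite (leq_trans (max_card _)) // card_prod !card_ord. Qed.

Lemma is_SYTP lam mu T :
  reflect ([/\ forall c, ~~ incell lam mu c -> T c = 0 :> nat,
               forall c, incell lam mu c -> 0 < T c <= size_of lam mu
             & forall k, 0 < k <= size_of lam mu -> exists2 c, incell lam mu c & T c = k :> nat] /\
           [/\ forall c c', incell lam mu c -> incell lam mu c' -> T c = T c' :> nat -> c = c',
               forall c c', incell lam mu c -> incell lam mu c' -> c.1 = c'.1 -> c.2 < c'.2 -> T c < T c'
             & forall c c', incell lam mu c -> incell lam mu c' -> c.2 = c'.2 -> c.1 < c'.1 -> T c < T c'])
          (is_SYT lam mu T).
Proof.
apply: (iffP and5P).
  case=> /forallP H1 /forallP H2 /forallP H3 /forallP H4 /andP[/forallP H5 /forallP H6].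
  split; split.
  - by move=> c /(implyP (H1 c)) /eqP.
  - by move=> c /(implyP (H2 c)).
  - move=> k kP; have kb : k < (R * C).+1.
      by rewrite ltnS (leq_trans _ (ncells_le lam mu)) //; case/andP: kP.
    have /existsP[c /andP[Hc /eqP E]] := implyP (H3 (Ordinal kb)) kP.
    by exists c => //; rewrite E.
  - move=> c c' Hc Hc' E; have /forallP/(_ c')/implyP := H4 c.
    by rewrite Hc Hc' /=; move=> /(_ (introT eqP (val_inj E))) /eqP.
  - move=> c c' Hc Hc' E lt; have /forallP/(_ c')/implyP := H5 c.
    by rewrite Hc Hc' E eqxx lt; apply.
  - move=> c c' Hc Hc' E lt; have /forallP/(_ c')/implyP := H6 c.
    by rewrite Hc Hc' E eqxx lt; apply.
case=> [[H1 H2 H3] [H4 H5 H6]]; split; last (apply/andP; split).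
- by apply/forallP => c; apply/implyP => /H1 ->.
- by apply/forallP => c; apply/implyP => /H2.
- apply/forallP => k; apply/implyP => /H3[c Hc E]; apply/existsP; exists c.
  by rewrite Hc -val_eqE /= E eqxx.
- apply/forallP => c; apply/forallP => c'; apply/implyP => /and3P[Hc Hc' /eqP E].
  by apply/eqP; apply: H4 => //; rewrite E.
- apply/forallP => c; apply/forallP => c'; apply/implyP => /and4P[Hc Hc' /eqP E].
  exact: H5.
- apply/forallP => c; apply/forallP => c'; apply/implyP => /and4P[Hc Hc' /eqP E].
  exact: H6.
Qed.

Definition skew_valid lam mu :=
  [/\ forall i, i.+1 < R -> nth 0 lam i.+1 <= nth 0 lam i,
      forall i, i.+1 < R -> nth 0 mu i.+1 <= nth 0 mu i,
      forall i, i < R -> nth 0 mu i <= nth 0 lam i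
    & forall i, i < R -> nth 0 lam i <= C].

Definition corner lam mu i :=
  (nth 0 mu i < nth 0 lam i) && ((i.+1 < R) ==> (nth 0 lam i.+1 < nth 0 lam i)).

Definition dec_row lam i := set_nth 0 lam i (nth 0 lam i).-1.

Lemma nth_dec_row lam i k :
  nth 0 (dec_row lam i) k = if k == i then (nth 0 lam i).-1 else nth 0 lam k.
Proof. by rewrite nth_set_nth /=. Qed.

Lemma skew_valid_dec lam mu i :
  skew_valid lam mu -> corner lam mu i -> skew_valid (dec_row lam i) mu.
Proof.
case=> H1 H2 H3 H4 /andP[c1 /implyP c2]; split=> // k Hk; rewrite !nth_dec_row.
- case: eqVneq => [E1|N1]; case: eqVneq => [E2|N2]; first by lia.
  + by move: (H1 k Hk); rewrite E1; lia.
  + by have := c2; rewrite -E2 => /(_ Hk); lia.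
  + exact: H1.
- by case: eqVneq => [->|_]; [lia | exact: H3].
- by case: eqVneq => [E|_]; [have := H4 i; rewrite -E => /(_ Hk); lia | exact: H4].
Qed.

Lemma nth_noninc (s : seq nat) i j :
  (forall i, i.+1 < R -> nth 0 s i.+1 <= nth 0 s i) -> i <= j -> j < R -> nth 0 s j <= nth 0 s i.
Proof.
move=> H; elim: j => [|j IH]; first by rewrite leqn0 => /eqP->.
rewrite leq_eqVlt => /orP[/eqP-> //|ij] jR.
by apply: leq_trans (H j jR) (IH _ _) => //; lia.
Qed.

Section Corner.
Variables (lam mu : seq nat) (c0 : 'I_R * 'I_C).
Hypothesis lmV : skew_valid lam mu.
Hypothesis c0col : c0.2 = (nth 0 lam c0.1).-1 :> nat.
Hypothesis c0corner : corner lam mu c0.1.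

Let lam' := dec_row lam c0.1.

Lemma incell_c0 : incell lam mu c0.
Proof. by rewrite /incell c0col; case/andP: c0corner => ? _; lia. Qed.

Lemma incell_dec c : incell lam' mu c = incell lam mu c && (c != c0).
Proof.
rewrite /incell nth_dec_row; case/andP: c0corner => c1 _.
have -> : (c == c0) = (c.1 == c0.1 :> nat) && (c.2 == c0.2 :> nat).
  by rewrite -[_ == _ :> nat]/(c.1 == c0.1) -[c.2 == _ :> nat]/(c.2 == c0.2); case: c c0 => a b [].
rewrite c0col; case: (eqVneq (c.1 : nat) c0.1) => [E|_]; last by rewrite andbT.
by rewrite E; case: (eqVneq (nat_of_ord c.2)) => [->|]; lia.
Qed.

Lemma ncells_dec : size_of lam mu = (size_of lam' mu).+1.
Proof.
rewrite /ncells (cardD1 c0) inE incell_c0 add1n; congr _.+1.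
by apply: eq_card => c; rewrite !inE incell_dec andbC.
Qed.

(** Fillings of all subshapes share one type and are 0 outside the shape, so removing a cell means
    resetting its value. *)
Definition tab_rem T : {ffun 'I_R * 'I_C -> 'I_(R * C).+1} :=
  [ffun c => if c == c0 then ord0 else T c].
Definition tab_add T : {ffun 'I_R * 'I_C -> 'I_(R * C).+1} :=
  [ffun c => if c == c0 then inord (size_of lam mu) else T c].

Lemma tab_addE T c :
  tab_add T c = (if c == c0 then size_of lam mu else T c) :> nat.
Proof. by rewrite ffunE; case: eqP => // _; rewrite inordK // ltnS ncells_le. Qed.

Lemma is_SYT_rem T :
  is_SYT lam mu T -> T c0 = size_of lam mu :> nat -> is_SYT lam' mu (tab_rem T).
Proof.
case/is_SYTP=> [[H1 H2 H3] [H4 H5 H6]] TM; have E := ncells_dec.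
apply/is_SYTP; split; split.
- move=> c; rewrite incell_dec ffunE negb_and negbK; case: eqP => //= _; rewrite orbF.
  exact: H1.
- move=> c; rewrite incell_dec ffunE => /andP[Hc /[dup] ne /negPf->].
  have /andP[-> /=] := H2 c Hc; rewrite E leq_eqVlt => /orP[/eqP T2|//].
  by case/eqP: ne; apply: H4 => //; [exact: incell_c0 | rewrite TM E].
- move=> k Hk; have [|c Hc Tc] := H3 k; first by lia.
  have ne : c != c0 by apply/eqP => c_c0; move: Tc Hk; rewrite c_c0 TM; lia.
  by exists c; rewrite ?incell_dec ?Hc // ffunE (negPf ne).
- move=> c c'; rewrite !incell_dec !ffunE => /andP[Hc /negPf->] /andP[Hc' /negPf->].
  exact: H4.
- move=> c c'; rewrite !incell_dec !ffunE => /andP[Hc /negPf->] /andP[Hc' /negPf->].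
  exact: H5.
- move=> c c'; rewrite !incell_dec !ffunE => /andP[Hc /negPf->] /andP[Hc' /negPf->].
  exact: H6.
Qed.

Lemma is_SYT_add T : is_SYT lam' mu T -> is_SYT lam mu (tab_add T).
Proof.
case/is_SYTP=> [[H1 H2 H3] [H4 H5 H6]]; have E := ncells_dec.
have inW c : incell lam mu c -> c != c0 -> incell lam' mu c by rewrite incell_dec => -> ->.
have Tlt c : incell lam mu c -> c != c0 -> T c < size_of lam mu.
  by move=> Hc ne; have := H2 c (inW c Hc ne); rewrite E; lia.
apply/is_SYTP; split; split.
- move=> c Hc; rewrite tab_addE; case: eqP => [c_c0|_]; first by rewrite c_c0 incell_c0 in Hc.
  by apply: H1; rewrite incell_dec (negPf Hc).
- move=> c Hc; rewrite tab_addE; case: eqVneq => [_|ne]; first by rewrite E ltnSn.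
  by have := H2 c (inW c Hc ne); rewrite E; lia.
- move=> k /andP[k0]; rewrite leq_eqVlt => /orP[/eqP->|kM].
    by exists c0; [exact: incell_c0 | rewrite tab_addE eqxx].
  have [|c] := H3 k; first by rewrite E in kM; lia.
  by rewrite incell_dec => /andP[Hc ne] Tc; exists c => //; rewrite tab_addE (negPf ne).
- move=> c c' Hc Hc'; rewrite !tab_addE.
  case: (eqVneq c) => [->|ne]; case: (eqVneq c') => [->|ne'] //.
  + by have := Tlt c' Hc' ne'; lia.
  + by have := Tlt c Hc ne; lia.
  + by apply: H4; apply: inW.
- move=> c c' Hc Hc' e lt; rewrite !tab_addE.
  case: (eqVneq c) => [c_c0|ne].
    by move: Hc'; rewrite /incell -e c_c0; move: lt; rewrite c_c0 c0col; lia.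
  case: (eqVneq c') => [c_c0'|ne']; first exact: Tlt.
  by apply: H5 => //; apply: inW.
- move=> c c' Hc Hc' e lt; rewrite !tab_addE.
  case: (eqVneq c) => [c_c0|ne].
    case: lmV => V1 _ _ _; case/andP: c0corner => _; have := ltn_ord c'.1.
    rewrite c_c0 in lt e; move=> b; have -> /= : c0.1.+1 < R by lia.
    have := nth_noninc V1 (lt : c0.1.+1 <= c'.1) (ltn_ord _).
    by move: Hc'; rewrite /incell -e c0col; lia.
  case: (eqVneq c') => [c_c0'|ne']; first exact: Tlt.
  by apply: H6 => //; apply: inW.
Qed.

Lemma tab_remK T :
  T c0 = size_of lam mu :> nat -> tab_add (tab_rem T) = T.
Proof.
move=> TM; apply/ffunP => c; apply: val_inj => /=; rewrite tab_addE ffunE /=.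
by case: eqVneq => [->|].
Qed.

Lemma tab_addK T : is_SYT lam' mu T -> tab_rem (tab_add T) = T.
Proof.
case/is_SYTP=> [[H1 _ _] _]; apply/ffunP => c; apply: val_inj => /=.
rewrite ffunE; case: eqVneq => [->|ne]; first by rewrite /= H1 // incell_dec eqxx andbF.
by rewrite tab_addE (negPf ne).
Qed.

(** Only the pair made of the two largest entries is new: the former maximum contributes its value
    exactly when it lies strictly above the new cell. This dependence on the row is what [maj_sum]
    has to remember. *)
Lemma maj_add T : is_SYT lam' mu T ->
  maj lam mu (tab_add T) = maj lam' mu T +
    (if [exists c, [&& incell lam' mu c, T c == size_of lam' mu :> nat & c.1 < c0.1]]
     then size_of lam' mu else 0).
Proof.
move=> ST; case/is_SYTP: (ST) => [[H1 H2 H3] [H4 H5 H6]]; have E := ncells_dec.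
have inE' c : incell lam mu c = (c == c0) || incell lam' mu c.
  by rewrite incell_dec; case: eqP => [->|_]; rewrite ?incell_c0 ?andbT.
have nc0 : incell lam' mu c0 = false by rewrite incell_dec eqxx andbF.
have neq c : incell lam' mu c -> (c == c0) = false.
  by move=> Hc; apply/eqP => c_c0; rewrite c_c0 nc0 in Hc.
rewrite /maj (bigID (pred1 c0)) /= [X in X + _]big1 ?add0n; last first.
  move=> c /andP[_ /eqP->]; rewrite big1 // => c' /and3P[Hc' /eqP T' _].
  move: T'; rewrite !tab_addE eqxx; case: eqVneq => [_|ne]; first by lia.
  have Hc2 : incell lam' mu c' by move: Hc'; rewrite inE' (negPf ne).
  by have := H2 c' Hc2; lia.
have -> : \sum_(c | incell lam mu c && (c != c0))
     \sum_(c' | [&& incell lam mu c', tab_add T c' == (tab_add T c).+1 :> nat & c.1 < c'.1]) (tab_add T c : nat)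
   = \sum_(c | incell lam' mu c) (\sum_(c' | [&& incell lam' mu c', T c' == (T c).+1 :> nat & c.1 < c'.1]) (T c : nat)
       + if (T c == size_of lam' mu :> nat) && (c.1 < c0.1) then T c : nat else 0).
  apply: eq_big => [c|c /andP[Hc ne]]; first by rewrite incell_dec.
  have Hc2 : incell lam' mu c by rewrite incell_dec Hc ne.
  rewrite (bigID (pred1 c0)) /= addnC; congr (_ + _).
    apply: eq_big => [c'|c' _]; last by rewrite tab_addE (negPf ne).
    rewrite !tab_addE (negPf ne) inE'; case: (eqVneq c' c0) => [->|_] /=.
      by rewrite nc0 andbF.
    by rewrite andbT.
  rewrite (eq_bigl (fun c' => (c' == c0) && ((T c == size_of lam' mu :> nat) && (c.1 < c0.1)))).
    by rewrite big_mkcondr /= big_pred1_eq tab_addE (negPf ne).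
  move=> c'; rewrite andbC; case: (eqVneq c' c0) => //= ->.
  by rewrite !tab_addE eqxx (negPf ne) E eqSS incell_c0 /= eq_sym.
rewrite big_split /=; congr (_ + _).
case: ifP => [/existsP[c /and3P[Hc Tc lt]]|/negbT/existsPn N]; last first.
  by rewrite big1 // => c Hc; have := N c; rewrite Hc /= => /negPf->.
rewrite (bigD1 c) //= Tc lt /= (eqP Tc) big1 ?addn0 // => c' /andP[Hc' ne].
case: ifP => // /andP[/eqP T' _]; case/eqP: ne; apply: H4 => //.
by rewrite T' (eqP Tc).
Qed.

End Corner.

(** A further cell to the right of [c] or just below it would need an entry above the maximum. That
    the position below belongs to the shape uses that the parts of [mu] decrease weakly. *)
Lemma max_corner lam mu T c : skew_valid lam mu -> is_SYT lam mu T -> incell lam mu c ->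
  T c = size_of lam mu :> nat -> (c.2 == (nth 0 lam c.1).-1 :> nat) && corner lam mu c.1.
Proof.
case=> V1 V2 V3 V4 /is_SYTP[[H1 H2 H3] [H4 H5 H6]] Hc TM.
move: (Hc) => /andP[b1 b2].
have col : c.2 = (nth 0 lam c.1).-1 :> nat.
  case: (ltnP c.2.+1 (nth 0 lam c.1)) => [lt|]; last by lia.
  have bd : c.2.+1 < C by rewrite (leq_trans lt) // V4.
  have Hc' : incell lam mu (c.1, Ordinal bd) by rewrite /incell /=; lia.
  have /= := H5 c (c.1, Ordinal bd) Hc Hc' erefl (ltnSn _).
  by have := H2 _ Hc'; lia.
rewrite col eqxx /corner /=; apply/andP; split; first by lia.
apply/implyP => bd; rewrite ltnNge; apply/negP => le.
have Hc' : incell lam mu (Ordinal bd, c.2).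
  by rewrite /incell /=; have := V2 c.1 bd; lia.
have /= := H6 c (Ordinal bd, c.2) Hc Hc' erefl (ltnSn _).
by have := H2 _ Hc'; lia.
Qed.

End Tableaux.

Local Open Scope ring_scope.

(** * q-shifted factorials and their reciprocals at integer arguments *)

Section QSeries.
Variables (K : fieldType) (q : K).

Definition br (e : int) : K := 1 - q ^ e.

Definition qff (n : nat) : K := \prod_(i < n) br i.+1.

(* 1/(q;q)_k, read as 0 for k < 0. *)
Definition invqf (k : int) : K := if k is Posz n then (qff n)^-1 else 0.

Lemma br0 : br 0 = 0. Proof. by rewrite /br expr0z subrr. Qed.

Lemma qffS n : qff n.+1 = qff n * br n.+1.
Proof. by rewrite /qff big_ord_recr. Qed.

Lemma qff0 : qff 0 = 1. Proof. by rewrite /qff big_ord0. Qed.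

Lemma invqf_neg k : k < 0 -> invqf k = 0.
Proof. by case: k. Qed.

Hypotheses (q_neq0 : q != 0) (q_nroot : forall k, q ^+ k.+1 != 1).

Lemma br_neq0 e : e != 0 -> br e != 0.
Proof.
case: e => [[|n]|n] // _; rewrite /br subr_eq0 eq_sym.
  exact: q_nroot.
by rewrite /exprz invr_eq1; apply: q_nroot.
Qed.

Lemma qff_neq0 n : qff n != 0.
Proof. by apply/prodf_neq0 => i _; apply: br_neq0. Qed.

(** The conventions make this hold for every integer: at k = 0 the factor vanishes together with
    [invqf (-1)], and for k < 0 both sides are 0. Hence the determinant recursion need not look at
    where entries vanish. *)
Lemma br_invqf k : br k * invqf k = invqf (k - 1).
Proof.
case: k => [[|n]|n].
- by rewrite br0 mul0r.
- have -> : n.+1%:Z - 1 = n by lia.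
  by rewrite /= qffS invfM mulrCA mulfV ?mulr1 // br_neq0.
- by rewrite mulr0 invqf_neg // NegzE; lia.
Qed.

End QSeries.

Section DetScale.
Variable K : fieldType.

Lemma det_scale n (x y : 'I_n -> K) (A : 'I_n -> 'I_n -> K) :
  \det (\matrix_(i, j) (x i * y j * A i j)) =
  (\prod_i x i) * (\prod_j y j) * \det (\matrix_(i, j) A i j).
Proof.
have -> : \matrix_(i, j) (x i * y j * A i j) =
  diag_mx (\row_i x i) *m (\matrix_(i, j) A i j) *m diag_mx (\row_j y j).
  by apply/matrixP => i j; rewrite mul_mx_diag mul_diag_mx !mxE mulrAC.
rewrite !det_mulmx !det_diag mulrAC.
by congr (_ * _ * _); apply: eq_bigr => i _; rewrite mxE.
Qed.

End DetScale.

(** * Aitken's determinant and the major index *)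

Section MajDet.
Variables (K : fieldType) (q : K).
Hypotheses (q_neq0 : q != 0) (q_nroot : forall k, q ^+ k.+1 != 1).
Local Notation br := (br q).
Local Notation qff := (qff q).
Local Notation invqf := (invqf q).

(* Aitken's determinant for i = 0.  The factor carried by the rows j < i is the
   counterpart of the extra weight in [maj_sum] below. *)
Definition aitken R (a b : nat -> int) (i : nat) : K :=
  \det (\matrix_(j < R, k < R)
    ((if (j < i)%N then q ^ (a j - b k) else 1) * invqf (a j - b k))).

(** The two determinants differ in row i only, where the difference of the entries is (1 - q^x) /
    (q;q)_x = 1 / (q;q)_(x-1). Linearity in that row gives the determinant of the shape with one
    cell fewer in row i. *)
Lemma aitken_step R a b (i : 'I_R) :
  aitken R a b i - aitken R a b i.+1 =
  aitken R (fun j => if j == i then a i - 1 else a j) b i.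
Proof.
have ne j : (lift i j == i :> nat) = false by have /negPf := neq_lift i j; rewrite eq_sym.
apply/eqP; rewrite subr_eq addrC; apply/eqP.
rewrite [LHS](determinant_multilinear (i0 := i)
  (B := \matrix_(j < R, k < R) ((if (j < i.+1)%N then q ^ (a j - b k) else 1) * invqf (a j - b k)))
  (C := \matrix_(j < R, k < R) ((if (j < i)%N then q ^ ((if j == i :> nat then a i - 1 else a j) - b k) else 1)
      * invqf ((if j == i :> nat then a i - 1 else a j) - b k))) (b := 1) (c := 1)) ?mul1r //.
- apply/rowP => k; rewrite !mxE ltnn ltnSn eqxx !mul1r addrAC -(br_invqf q_neq0 q_nroot) /br.
  by rewrite mulrBl mul1r addrC subrK.
- apply/matrixP => j k; rewrite !mxE ltnS leq_eqVlt.
  by rewrite (ne j).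
- apply/matrixP => j k; rewrite !mxE.
  by rewrite (ne j).
Qed.

Lemma aitken_full R a b :
  aitken R a b R = q ^ (\sum_(j < R) (a j - b j)) * aitken R a b 0.
Proof.
rewrite /aitken; transitivity (\det (\matrix_(j < R, k < R)
  (q ^ (a j) * q ^ (- b k) * (invqf (a j - b k))))).
  by congr (\det _); apply/matrixP => j k; rewrite !mxE ltn_ord expfzDr.
rewrite det_scale; congr (_ * _).
  rewrite -big_split /=; elim/big_ind2: _ => [|x x' y y' -> ->|j _]; rewrite ?expr0z //.
    by rewrite expfzDr.
  by rewrite expfzDr.
by congr (\det _); apply/matrixP => j k; rewrite !mxE mul1r.
Qed.

(** The rows from i on and the columns up to i form a zero block with R - i rows and i + 1 columns;
    a permutation avoiding it would inject R - i rows into R - i - 1 columns. *)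
Lemma aitken_zero R (a b : nat -> int) (i : 'I_R) :
  (forall j k : 'I_R, (i <= j)%N -> (k <= i)%N -> a j - b k < 0) ->
  aitken R a b i = 0.
Proof.
move=> H; rewrite /aitken /determinant big1 // => s _.
case: (pickP (fun j : 'I_R => (i <= j)%N && (s j <= i)%N)) => [j /andP[ij sj]|N].
  by rewrite (bigD1 j) //= mxE invqf_neg ?H // mulr0 mul0r mulr0.
exfalso; have sub : [set s j | j in [set j : 'I_R | (i <= j)%N]] \subset [set j : 'I_R | (i < j)%N].
  apply/subsetP => y /imsetP[j]; rewrite inE => ij ->; rewrite inE ltnNge.
  by have := N j; rewrite ij /= => ->.
have := subset_leq_card sub; rewrite card_imset; last exact: perm_inj.
rewrite (cardsD1 i [set j : 'I_R | (i <= j)%N]) inE leqnn add1n.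
apply/negP; rewrite -ltnNge ltnS; apply: subset_leq_card; apply/subsetP => j.
by rewrite !inE ltn_neqAle eq_sym.
Qed.

(** Meant for rows i and i + 1 of equal length in the shape: lowering a_i by one then repeats a row,
    and neither of the two carries a weight. *)
Lemma aitken_rep R (a b : nat -> int) (i : nat) :
  (i.+1 < R)%N -> a i.+1 = a i -> aitken R a b i = 0.
Proof.
move=> bd E; have bd' : (i < R)%N by lia.
apply: (determinant_alternate (i1 := Ordinal bd') (i2 := Ordinal bd)).
  by apply/eqP => /(congr1 val) /=; lia.
by move=> k; rewrite !mxE /= E ltnn ltnNge leqnSn.
Qed.

Section Sum.
Variables R C : nat.

Definition row_exp (s : seq nat) (j : nat) : int := (nth 0%N s j)%:Z - j%:Z.

(* The largest entry is imagined to be followed by one more entry in row i. *)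
Definition maj_sum i lam mu : K :=
  \sum_(T : {ffun 'I_R * 'I_C -> 'I_(R * C).+1} | is_SYT lam mu T)
    q ^+ maj lam mu T *
    (if [exists c, [&& incell lam mu c, T c == ncells R C lam mu :> nat & (c.1 < i)%N]]
     then q ^+ ncells R C lam mu else 1).

(** The largest entry sits in a corner, say in row j. The weight q^M accounts for a descent from it
    to the imagined entry in row i; in the tableau that remains, the removed entry itself plays the
    role of the imagined one, whence the index j on the right. *)
Lemma maj_sum_rec i lam mu : skew_valid R C lam mu -> (0 < ncells R C lam mu)%N ->
  maj_sum i lam mu =
  \sum_(j < R | corner R lam mu j)
    (if (j < i)%N then q ^+ ncells R C lam mu else 1) * maj_sum j (dec_row lam j) mu.
Proof.
move=> V M0; set M := ncells R C lam mu in M0 *.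
have -> : maj_sum i lam mu =
  \sum_(T : {ffun 'I_R * 'I_C -> 'I_(R * C).+1} | is_SYT lam mu T)
   \sum_(c | incell lam mu c && (T c == M :> nat))
     q ^+ maj lam mu T * (if (c.1 < i)%N then q ^+ M else 1).
  apply: eq_bigr => T /is_SYTP[[H1 H2 H3] [H4 H5 H6]].
  have [|c Hc Tc] := H3 M; first by rewrite M0 /=.
  have Tc' : T c == M :> nat by apply/eqP.
  rewrite (big_pred1 c) => [|c']; last first.
    apply/andP/eqP => [[Hc' /eqP E]|->]; last by rewrite Hc Tc'.
    by apply: H4 => //; rewrite E.
  congr (_ * _); case: existsP => [[c' /and3P[Hc' /eqP E lt]]|N].
    by rewrite (H4 c c' Hc Hc') ?lt // E.
  by case: ifP => // lt; case: N; exists c; rewrite Hc Tc' lt.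
rewrite (exchange_big_dep xpredT) //=.
have step (c : 'I_R * 'I_C) :
  \sum_(T : {ffun 'I_R * 'I_C -> 'I_(R * C).+1} | is_SYT lam mu T && (incell lam mu c && (T c == M :> nat)))
     q ^+ maj lam mu T * (if (c.1 < i)%N then q ^+ M else 1) =
  if (c.2 == (nth 0%N lam c.1).-1 :> nat) && corner R lam mu c.1
  then (if (c.1 < i)%N then q ^+ M else 1) * maj_sum c.1 (dec_row lam c.1) mu else 0.
  case: (boolP (_ && corner R lam mu c.1)) => [/andP[/eqP col cor]|/negPf N]; last first.
    rewrite big_pred0 // => T; apply/negP => /and3P[ST Hc /eqP TM].
    by move: (max_corner V ST Hc TM); rewrite N.
  rewrite -mulr_suml mulrC; congr (_ * _).
  rewrite (reindex_onto (tab_add lam mu c) (tab_rem c)) /=; last first.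
    by move=> T /and3P[ST _ /eqP]; apply: tab_remK.
  rewrite /maj_sum; apply: eq_big => [T|T].
    apply/idP/idP => [/andP[/and3P[ST Hc /eqP TM] /eqP E]|ST].
      by rewrite -E; apply: is_SYT_rem.
    rewrite (is_SYT_add V col cor ST) (incell_c0 col cor) tab_addE eqxx /=.
    by rewrite (tab_addK col cor ST) !eqxx.
  move=> /andP[/and3P[ST Hc /eqP TM] /eqP E].
  have ST' : is_SYT (dec_row lam c.1) mu T by rewrite -E; apply: is_SYT_rem.
  rewrite (maj_add col cor ST') exprD; congr (_ * _).
  by case: ifP.
rewrite (eq_bigr _ (fun c _ => step c)) -big_mkcond /=.
rewrite (eq_bigl (fun c : 'I_R * 'I_C => corner R lam mu c.1 && (c.2 == (nth 0%N lam c.1).-1 :> nat))); last first.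
  by move=> c; rewrite andbC.
rewrite -(pair_big_dep (fun j : 'I_R => corner R lam mu j) (fun (j : 'I_R) (k : 'I_C) => k == (nth 0%N lam j).-1 :> nat)
  (fun (j : 'I_R) (k : 'I_C) => (if (j < i)%N then q ^+ M else 1) * maj_sum j (dec_row lam j) mu)) /=.
apply: eq_bigr => j cor.
have bd : ((nth 0%N lam j).-1 < C)%N.
  by case: V => _ _ _ /(_ j (ltn_ord j)); case/andP: cor; lia.
by rewrite (big_pred1 (Ordinal bd)).
Qed.

Lemma sum_row_exp lam mu : skew_valid R C lam mu ->
  (ncells R C lam mu)%:Z = \sum_(j < R) (row_exp lam j - row_exp mu j).
Proof.
case=> V1 V2 V3 V4; rewrite /ncells -sum1_card.
have -> : \sum_(c in [pred c : 'I_R * 'I_C | incell lam mu c]) 1%N =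
  \sum_(j < R) (nth 0 lam j - nth 0 mu j)%N.
  rewrite (eq_bigl (fun c : 'I_R * 'I_C => true && incell lam mu c)) //.
  rewrite -(pair_big_dep xpredT (fun (j : 'I_R) (k : 'I_C) => incell lam mu (j, k)) (fun _ _ => 1%N)) /=.
  apply: eq_bigr => j _; rewrite /incell /=.
  transitivity (\sum_(nth 0 mu j <= k < nth 0 lam j) 1)%N; last by rewrite sum_nat_const_nat muln1.
  rewrite (big_nat_widen _ _ C) ?V4 // (big_nat_widenl _ 0) // big_mkord.
  by apply: eq_bigl => k; rewrite /= andbC.
rewrite (big_morph Posz PoszD (erefl (Posz 0))); apply: eq_bigr => j _.
by rewrite /row_exp; have := V3 j (ltn_ord j); lia.
Qed.

(** With A_j the determinant of index j and M cells, [maj_sum_rec] and [aitken_step] give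
    (q;q)_(M-1) times q^M (A_0 - A_i) + (A_i - A_R). Since A_R = q^M A_0 by [aitken_full], the
    bracket is (1 - q^M) A_i. *)
Lemma maj_sum_aitken i lam mu : skew_valid R C lam mu -> (i <= R)%N ->
  maj_sum i lam mu = qff (ncells R C lam mu) * aitken R (row_exp lam) (row_exp mu) i.
Proof.
have [M] := ubnP (ncells R C lam mu); elim: M i lam => // M IH i lam.
rewrite ltnS => le V iR; have [V1 V2 V3 V4] := V; have E := sum_row_exp V.
case: (posnP (ncells R C lam mu)) => [M0|M0].
  have no c : ~~ @incell R C lam mu c.
    by have := card0_eq M0 c; rewrite inE /= => ->.
  have lm j : (j < R)%N -> nth 0%N lam j = nth 0%N mu j.
    move=> jR; have nn : forall k : 'I_R, true -> 0 <= row_exp lam k - row_exp mu k.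
      by move=> k _; rewrite /row_exp; have := V3 k (ltn_ord k); lia.
    move: E; rewrite M0 => /esym/eqP; rewrite psumr_eq0 // => /allP /(_ (Ordinal jR)).
    by rewrite mem_index_enum => /(_ isT) /eqP; rewrite /row_exp /=; lia.
  rewrite M0 qff0 mul1r /maj_sum M0.
  have SY (T : {ffun 'I_R * 'I_C -> 'I_(R * C).+1}) : is_SYT lam mu T = (T == [ffun _ => ord0]) :> bool.
    apply/is_SYTP/eqP => [[[H1 _ _] _]|->].
      by apply/ffunP => c; apply: val_inj => /=; rewrite ffunE /= H1 ?no.
    rewrite M0; split; [split=> [c _|c|k] | split=> c c']; rewrite ?ffunE ?(negPf (no c)) //.
    by lia.
  rewrite (big_pred1 [ffun _ => ord0]) //.
  rewrite /maj big_pred0 => [|c]; last exact/negbTE/no.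
  rewrite expr0 mul1r if_same /aitken -det_tr det_trig.
    rewrite big1 // => j _; rewrite !mxE /row_exp lm // subrr expr0z if_same /= qff0 invr1 mulr1 //.
  apply/is_trig_mxP => j k jk; rewrite !mxE invqf_neg ?mulr0 // /row_exp lm //.
  by have := nth_noninc V2 (ltnW jk) (ltn_ord _); lia.
(* A row without removable cell contributes nothing, so the sum over corners extends to all rows and
   telescopes: if the row is empty there is a zero block, if the next row is as long there are two
   equal rows. *)
have Dz j : (j < R)%N -> ~~ corner R lam mu j ->
  aitken R (fun j' => if j' == j then row_exp lam j - 1 else row_exp lam j') (row_exp mu) j = 0.
  move=> jR; rewrite negb_and -leqNgt => /orP[le1|].
    apply: (aitken_zero (i := Ordinal jR)) => j' k /= jj' kj.
    have := nth_noninc V2 kj jR; have := nth_noninc V1 jj' (ltn_ord _).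
    by case: eqVneq => [_|ne]; rewrite /row_exp; lia.
  rewrite negb_imply => /andP[bd]; rewrite -leqNgt => le1.
  apply: aitken_rep => //; rewrite eqxx gtn_eqF // /row_exp.
  by have := V1 j bd; lia.
rewrite (maj_sum_rec i V M0).
pose w (j : nat) : K := if (j < i)%N then q ^+ ncells R C lam mu else 1.
have -> : \sum_(j < R | corner R lam mu j) w j * maj_sum j (dec_row lam j) mu =
  qff (ncells R C lam mu).-1 *
  \sum_(j < R) w j * (aitken R (row_exp lam) (row_exp mu) j - aitken R (row_exp lam) (row_exp mu) j.+1).
  rewrite big_distrr /= big_mkcond /=; apply: eq_bigr => j _.
  rewrite aitken_step; case: ifP => [cor|/negbT cor]; last by rewrite Dz ?mulr0.
  have bd : ((nth 0%N lam j).-1 < C)%N.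
    by have := V4 j (ltn_ord j); case/andP: cor; lia.
  pose c0 : 'I_R * 'I_C := (j, Ordinal bd).
  have E1 : ncells R C lam mu = (ncells R C (dec_row lam j) mu).+1 by apply: (@ncells_dec R C lam mu c0).
  rewrite IH //; [|by rewrite -ltnS -E1|exact: skew_valid_dec|exact: ltnW].
  rewrite E1 /= mulrCA; congr (_ * (_ * _)).
  congr (\det _); apply/matrixP => j' k; rewrite !mxE.
  have -> // : row_exp (dec_row lam j) j' = if j' == j :> nat then row_exp lam j - 1 else row_exp lam j'.
  rewrite /row_exp nth_dec_row; case: eqVneq => // ->.
  by case/andP: cor; lia.
have tele d u : (d <= u)%N -> \sum_(d <= j < u) (aitken R (row_exp lam) (row_exp mu) j - aitken R (row_exp lam) (row_exp mu) j.+1)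
  = aitken R (row_exp lam) (row_exp mu) d - aitken R (row_exp lam) (row_exp mu) u.
  move=> du; pose f j := - aitken R (row_exp lam) (row_exp mu) j.
  rewrite (eq_bigr (fun j => f j.+1 - f j)) => [|j _]; last by rewrite /f opprK addrC.
  by rewrite telescope_sumr // /f opprK addrC.
rewrite -(big_mkord xpredT (fun j => w j * (aitken R (row_exp lam) (row_exp mu) j - aitken R (row_exp lam) (row_exp mu) j.+1))) (big_cat_nat _ iR) //=.
rewrite (eq_big_nat _ _ (F2 := fun j => q ^+ ncells R C lam mu * (aitken R (row_exp lam) (row_exp mu) j - aitken R (row_exp lam) (row_exp mu) j.+1))); last first.
  by move=> j /andP[_ ji]; rewrite /w ji.
rewrite -big_distrr /= tele // [X in _ + X](eq_big_nat _ _ (F2 := fun j => (aitken R (row_exp lam) (row_exp mu) j - aitken R (row_exp lam) (row_exp mu) j.+1))); last first.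
  by move=> j /andP[ji _]; rewrite /w ltnNge ji mul1r.
rewrite tele // aitken_full -E -[in RHS](prednK M0) qffS prednK // /br -exprnP.
by ring.
Qed.

End Sum.

End MajDet.

(** * Determinants of products of linear factors *)

Section LinearAlgebra.
Variable K : fieldType.

Definition vdm s (Y : nat -> K) : K := \prod_(i < s) \prod_(j < s | (i < j)%N) (Y j - Y i).

(** The evaluation matrix is a Vandermonde matrix times the matrix of coefficients, so the quotient
    by the Vandermonde product does not depend on the nodes. *)
Lemma det_polys s (p : nat -> {poly K}) (Y : nat -> K) :
  (forall j, (j < s)%N -> (size (p j) <= s)%N) ->
  \det (\matrix_(i < s, j < s) (p j).[Y i]) = vdm s Y * \det (\matrix_(h < s, j < s) (p j)`_h).
Proof.
move=> sz; have -> : \matrix_(i < s, j < s) (p j).[Y i] =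
   (Vandermonde s (\row_(i < s) Y i))^T *m \matrix_(h < s, j < s) (p j)`_h.
  apply/matrixP => i j; rewrite !mxE (horner_coef_wide _ (sz _ (ltn_ord j))).
  by apply: eq_bigr => h _; rewrite !mxE mulrC.
rewrite det_mulmx det_tr det_Vandermonde; congr (_ * _).
by apply: eq_bigr => i _; apply: eq_bigr => j _; rewrite !mxE.
Qed.

Lemma vdmS s (Y : nat -> K) :
  vdm s.+1 Y = (\prod_(i < s) (Y i.+1 - Y 0%N)) * vdm s (fun i => Y i.+1).
Proof.
rewrite /vdm big_ord_recl; congr (_ * _).
  by rewrite big_mkcond big_ord_recl /= mul1r.
by apply: eq_bigr => i _; rewrite big_mkcond big_ord_recl /= mul1r -big_mkcond.
Qed.

Lemma vdm_neq0 s (Y : nat -> K) :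
  (forall i j, (i < j < s)%N -> Y j != Y i) -> vdm s Y != 0.
Proof.
move=> H; apply/prodf_neq0 => i _; apply/prodf_neq0 => j ij.
by rewrite subr_eq0 H // ij ltn_ord.
Qed.

Section LinearFactors.
(* Any sequence of pairwise distinct scalars will do. *)
Variable e : nat -> K.
Hypothesis e_inj : injective e.

(** By [det_polys] the nodes may be exchanged for convenient ones. With the first node at the root
    of c_1 + d_1 Y, the first row keeps only its first entry, and the remaining minor is of the same
    form with shifted indices. *)
Lemma det_linear_factors s (a b c d Y : nat -> K) :
  (forall k, (0 < k < s)%N -> d k != 0) ->
  \det (\matrix_(i < s, j < s) ((\prod_(j.+1 <= k < s) (a k + b k * Y i)) *
                               (\prod_(1 <= k < j.+1) (c k + d k * Y i)))) =
  vdm s Y * \prod_(1 <= i < s) \prod_(i <= k < s) (a k * d i - b k * c i).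
Proof.
elim: s a b c d Y => [|s IH] a b c d Y d0.
  by rewrite det_mx00 /vdm big_ord0 big_geq // mulr1.
case: (posnP s) => [->|s0].
  rewrite det_mx11 !mxE big_geq // big_geq // /vdm big_ord_recl big_ord0 mulr1.
  by rewrite big_mkcond big_ord_recl big_ord0 /= big_geq // !mulr1.
pose p j : {poly K} := (\prod_(j.+1 <= k < s.+1) ((a k)%:P + (b k)%:P * 'X)) *
                     (\prod_(1 <= k < j.+1) ((c k)%:P + (d k)%:P * 'X)).
have szl (u v : K) : (size (u%:P + v%:P * 'X)%R <= 2)%N.
  by rewrite addrC size_MXaddC; case: ifP => // _; rewrite ltnS size_polyC; case: eqP.
have szp m n (u v : nat -> K) : (size (\prod_(m <= k < n) ((u k)%:P + (v k)%:P * 'X))%R <= (n - m).+1)%N.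
  rewrite /index_iota; move: (n - m)%N => l; elim: l m => [|l IHl] m; first by rewrite big_nil size_poly1.
  rewrite /= big_cons (leq_trans (size_polyMleq _ _)) //.
  by rewrite -[l.+2]/(2 + l.+1).-1 -!subn1 leq_sub2r // leq_add.
have sz j : (j < s.+1)%N -> (size (p j) <= s.+1)%N.
  move=> js; rewrite (leq_trans (size_polyMleq _ _)) //.
  have := leq_add (szp j.+1 s.+1 a b) (szp 1%N j.+1 c d).
  by set z := (_ + _)%N; rewrite -/z; lia.
have ev j y : (p j).[y] = (\prod_(j.+1 <= k < s.+1) (a k + b k * y)) * (\prod_(1 <= k < j.+1) (c k + d k * y)).
  by rewrite hornerM !horner_prod; congr (_ * _); apply: eq_bigr => k _; rewrite !hornerE.
have E (Y' : nat -> K) : \det (\matrix_(i < s.+1, j < s.+1) ((\prod_(j.+1 <= k < s.+1) (a k + b k * Y' i)) *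
     (\prod_(1 <= k < j.+1) (c k + d k * Y' i)))) = vdm s.+1 Y' * \det (\matrix_(h < s.+1, j < s.+1) (p j)`_h).
  by rewrite -det_polys //; congr (\det _); apply/matrixP => i j; rewrite !mxE ev.
rewrite E; congr (_ * _).
have d1 : d 1%N != 0 by apply: d0.
pose y0 := - c 1%N / d 1%N.
(* Distinct nodes, so that their Vandermonde product can be cancelled, the first of them being the
   root [y0]. *)
pose Z i := y0 + (e i - e 0%N).
have Z0 : Z 0%N = y0 by rewrite /Z subrr addr0.
have Zn : vdm s.+1 Z != 0.
  apply: vdm_neq0 => i j /andP[ij _]; rewrite /Z (inj_eq (addrI _)) (inj_eq (addIr _)).
  by rewrite (inj_eq e_inj) gtn_eqF.
apply: (mulfI Zn); rewrite -E (expand_det_row _ ord0) big_ord_recl [X in _ + X]big1 ?addr0; last first.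
  move=> j _; rewrite !mxE [\prod_(1 <= k < _) _]big_ltn // Z0.
  have -> : c 1%N + d 1%N * y0 = 0 by rewrite /y0; field.
  by rewrite !(mul0r, mulr0).
rewrite mxE [\prod_(1 <= k < _) _]big_geq // mulr1 /cofactor /= expr0 mul1r.
have -> : row' ord0 (col' ord0 (\matrix_(i < s.+1, j < s.+1) ((\prod_(j.+1 <= k < s.+1) (a k + b k * Z i)) *
     (\prod_(1 <= k < j.+1) (c k + d k * Z i))))) =
  \matrix_(i < s, j < s) ((c 1%N + d 1%N * Z i.+1) * 1 *
     ((\prod_(j.+1 <= k < s) (a k.+1 + b k.+1 * Z i.+1)) *
     (\prod_(1 <= k < j.+1) (c k.+1 + d k.+1 * Z i.+1)))).
  apply/matrixP => i j; rewrite !mxE /= /bump /= !add1n !mulr1.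
  rewrite [\prod_(1 <= k < _) (c k + _)]big_ltn // (big_add1 _ _ 1) /=.
  by rewrite big_add1 /=; ring.
rewrite det_scale big1_eq mulr1 (IH (fun k => a k.+1) (fun k => b k.+1) (fun k => c k.+1) (fun k => d k.+1)
  (fun i => Z i.+1)) => [|k Hk]; last by apply: d0; lia.
rewrite vdmS [\prod_(1 <= i < s.+1) \prod_(i <= k < _) _]big_ltn // Z0.
set V := vdm _ _; set W := \prod_(1 <= i < s) _.
have -> : \prod_(2 <= i < s.+1) \prod_(i <= k < s.+1) (a k * d i - b k * c i) = W.
  by rewrite big_add1; apply: eq_bigr => i _; rewrite big_add1.
clearbody V W; rewrite !big_add1 /= !big_mkord.
rewrite [LHS]mulrA -big_split /= [RHS]mulrACA -big_split /=.
congr (_ * _); apply: eq_bigr => i _; rewrite /y0; field.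
exact: d1.
Qed.

End LinearFactors.

(** Multilinear expansion gives a sum over all maps f. A map that is not injective repeats a row in
    the second factor; an injective one is an increasing tuple composed with a permutation, whose
    sign completes the expansion of the first minor. *)
Lemma cauchy_binet s M (A : 'I_s -> 'I_M -> K) (B : 'I_M -> 'I_s -> K) :
  \det (\matrix_(i < s, k < s) \sum_l A i l * B l k) =
  \sum_(l : s.-tuple 'I_M | sorted ltn [seq val x | x <- l])
    \det (\matrix_(i < s, j < s) A i (tnth l j)) * \det (\matrix_(j < s, k < s) B (tnth l j) k).
Proof.
pose S (f : {ffun 'I_s -> 'I_M}) := (\prod_i A i (f i)) * \det (\matrix_(i, k) B (f i) k).
transitivity (\sum_f S f).
  rewrite /determinant; under eq_bigr => sg _.
    under eq_bigr do rewrite mxE.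
    rewrite bigA_distr_bigA big_distrr /=.
    over.
  rewrite exchange_big /=; apply: eq_bigr => f _.
  rewrite /S /determinant big_distrr /=; apply: eq_bigr => sg _.
  rewrite mulrCA; congr (_ * _); rewrite -big_split /=.
  by apply: eq_bigr => i _; rewrite !mxE.
rewrite (bigID (fun f : {ffun 'I_s -> 'I_M} => injectiveb f)) /= [X in _ + X]big1 ?addr0; last first.
  move=> f /injectivePn[i1 [i2 ne E]]; rewrite /S (determinant_alternate ne) ?mulr0 // => k.
  by rewrite !mxE E.
pose le (x y : 'I_M) := (x <= y)%N.
have le_tot : total le by move=> x y; apply: leq_total.
have le_tr : transitive le by move=> y x z; apply: leq_trans.
have le_anti : antisymmetric le by move=> x y H; apply: val_inj; apply: anti_leq.
pose g (f : {ffun 'I_s -> 'I_M}) : s.-tuple 'I_M := [tuple of sort le [tuple f i | i < s]].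
have sP (l : s.-tuple 'I_M) : sorted ltn [seq val x | x <- l] = uniq l && sorted le l.
  by rewrite ltn_sorted_uniq_leq map_inj_uniq ?sorted_map //; exact: val_inj.
have uniqf (f : {ffun 'I_s -> 'I_M}) : uniq [tuple f i | i < s] = injectiveb f.
  by rewrite /injectiveb /dinjectiveb /=; congr (uniq (map _ _)); apply: eq_enum.
rewrite (partition_big g (fun l : s.-tuple 'I_M => sorted ltn [seq val x | x <- l])); last first.
  by move=> f fi; rewrite sP /= sort_uniq uniqf fi sort_sorted.
apply: eq_bigr => l; rewrite sP => /andP[lu ls].
pose h (p : 'S_s) := [ffun i => tnth l (p i)].
have h_inj : injective h.
  move=> p1 p2 /ffunP E; apply/permP => i; have := E i; rewrite !ffunE.
  by move/(tuple_uniqP _ lu).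
have -> : \sum_(f : {ffun 'I_s -> 'I_M} | injectiveb f && (g f == l)) S f = \sum_(p : 'S_s) S (h p).
  have -> : \sum_(p : 'S_s) S (h p) = \sum_(p in [set: 'S_s]) S (h p).
    by apply: eq_bigl => p; rewrite inE.
  rewrite -(big_imset S (in2W h_inj)); apply: eq_bigl => f.
  apply/andP/imsetP => [[fi /eqP gf]|[p _ ->]].
    have /tuple_permP[p Ep] : perm_eq [tuple f i | i < s] l.
      by rewrite -gf /= perm_sym perm_sort.
    exists p; rewrite ?inE //; apply/ffunP => i; rewrite ffunE.
    have := congr1 (fun t : seq _ => nth (f i) t i) Ep.
    by rewrite -!tnth_nth !tnth_mktuple.
  have hp : perm_eq [tuple h p i | i < s] l.
    by apply/tuple_permP; exists p; congr tval; apply: eq_mktuple => i; rewrite ffunE.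
  rewrite -uniqf (perm_uniq hp) lu; split=> //; apply/eqP; apply: val_inj => /=.
  by rewrite -[RHS](sorted_sort le_tr ls); apply/(perm_sortP le_tot le_tr le_anti).
rewrite [in RHS]/determinant big_distrl /=; apply: eq_bigr => p _.
have -> : S (h p) = \prod_i A i (tnth l (p i)) * \det (row_perm p (\matrix_(j, k) B (tnth l j) k)).
  rewrite /S; congr (_ * _); first by apply: eq_bigr => i _; rewrite ffunE.
  by congr (\det _); apply/matrixP => i k; rewrite !mxE ffunE.
rewrite row_permE det_mulmx det_perm mulrA [_ * (-1) ^+ _]mulrC.
by congr (_ * _ * _); apply: eq_bigr => i _; rewrite mxE.
Qed.

(** Each expansion along the first unit column meets its entry in row r + k and column r, hence the
    sign (-1)^k. The identity is used from right to left, to border a determinant of order r + k. *)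
Lemma det_delta_cols r s k P (f : nat -> nat -> K) : P = (r + s + k)%N ->
  \det (\matrix_(i < P, j < P)
    (if (j < r)%N then f i j else if (j < r + s)%N then (i == r + k + (j - r) :> nat)%N%:R
     else f i (j - s)%N)) =
  (-1) ^+ (s * k) * \det (\matrix_(i < r + k, j < r + k) f i j).
Proof.
move=> ->; elim: s f => [|s IH] f.
  rewrite mul0n expr0 mul1r; move: (addn0 r) => E.
  case: _ / (esym E); congr (\det _); apply/matrixP => i j; rewrite !mxE.
  by rewrite subn0; case: ifP => // ->.
rewrite -addnA [(r + _)%N](_ : _ = (r + s + k).+1); last by lia.
have rb : (r < (r + s + k).+1)%N by lia.
have nb : (r + k < (r + s + k).+1)%N by lia.
rewrite (expand_det_col _ (Ordinal rb)) (bigD1 (Ordinal nb)) //= [X in _ + X]big1 ?addr0; last first.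
  move=> i ne; rewrite mxE /= ltnn; have -> : (r < r + s.+1)%N by lia.
  rewrite subnn addn0; have -> : (i == r + k :> nat)%N = false by apply: contraNF ne.
  by rewrite mul0r.
rewrite mxE /= ltnn ifT; last by lia.
rewrite subnn addn0 eqxx mul1r /cofactor /=.
have -> : (-1) ^+ (r + k + r) = (-1) ^+ k :> K.
  by rewrite -signr_odd -[in RHS]signr_odd !oddD; case: (odd r); case: (odd k).
rewrite mulSn exprD -mulrA; congr (_ * _).
rewrite -[\det (\matrix_(i < r + k, j < r + k) f i j)](_ : \det (\matrix_(i < r + k, j < r + k) f (bump (r + k) i) j) = _); last first.
  by congr (\det _); apply/matrixP => i j; rewrite !mxE /bump leqNgt ltn_ord.
rewrite -(IH (fun i j => f (bump (r + k) i) j)).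
congr (\det _); apply/matrixP => i j; rewrite !mxE /=.
rewrite /bump; case: (ltnP j r) => jr.
  by rewrite add0n jr.
have -> : (true + j < r)%N = false by lia.
have -> : (true + j < r + s.+1)%N = (j < r + s)%N by lia.
case: ifP => _; last by rewrite /= add1n subSS.
by congr (_%:R); congr nat_of_bool; apply/eqP/eqP; case: (leqP (r + k) i) => /=; lia.
Qed.

End LinearAlgebra.

(** * Basic hypergeometric sums *)

(* [ring] does not accept arbitrary exponents. *)
Ltac gen_pow := repeat match goal with |- context [@GRing.exp ?R ?a ?n] =>
  let z := fresh "pw" in set z := (@GRing.exp R a n); clearbody z end.
Ltac pring := gen_pow; ring.

Section Sums.
Variable K : fieldType.

(* The Pascal recursion makes [gbin x n k] vanish for k > n. *)
Fixpoint gbin (x : K) (n k : nat) : K :=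
  match n, k with
  | _, 0%N => 1
  | 0%N, _.+1 => 0
  | n'.+1, k'.+1 => gbin x n' k'.+1 + x ^+ (n' - k') * gbin x n' k'
  end.

Definition qpo (x a : K) (n : nat) : K := \prod_(i < n) (1 - a * x ^+ i).

Lemma qpo0 x a : qpo x a 0 = 1. Proof. by rewrite /qpo big_ord0. Qed.

Lemma qpoS x a n : qpo x a n.+1 = qpo x a n * (1 - a * x ^+ n).
Proof. by rewrite /qpo big_ord_recr. Qed.

Lemma qpo_add x a m n : qpo x a (m + n) = qpo x a m * qpo x (a * x ^+ m) n.
Proof.
rewrite /qpo big_split_ord /=; congr (_ * _).
by apply: eq_bigr => i _; rewrite exprD mulrA.
Qed.

Lemma gbin_small x n k : (n < k)%N -> gbin x n k = 0.
Proof.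
elim: n k => [|n IH] [|k] //= nk; rewrite !IH ?mulr0 ?addr0 //; exact: ltnW.
Qed.

Lemma gbin0 x n : gbin x n 0 = 1. Proof. by case: n. Qed.

(** Pascal's rule under a summation sign: the common induction step of [qbinomial] and [qcauchy]. *)
Lemma gbin_sumS x n (u : nat -> K) :
  \sum_(k < n.+2) gbin x n.+1 k * u k =
  \sum_(k < n.+1) gbin x n k * (u k + x ^+ (n - k) * u k.+1).
Proof.
rewrite big_ord_recl /= mul1r.
under eq_bigr => k _ do rewrite /bump /= add1n mulrDl.
rewrite big_split /= addrA.
have -> : u 0%N + \sum_(i < n.+1) gbin x n i.+1 * u i.+1 = \sum_(i < n.+1) gbin x n i * u i.
  rewrite big_ord_recr /= gbin_small // mul0r addr0 [RHS]big_ord_recl /= gbin0 mul1r.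
  by congr (_ + _); apply: eq_bigr => i _.
by rewrite -big_split /=; apply: eq_bigr => k _; rewrite mulrDr mulrCA mulrA.
Qed.

Lemma gbin_fact x n k : (k <= n)%N -> gbin x n k * (qff x k * qff x (n - k)) = qff x n.
Proof.
elim: n k => [|n IH] [|k] // kn; rewrite ?qff0 ?subn0 ?mul1r //= subSS.
rewrite mulrDl.
have -> : x ^+ (n - k) * gbin x n k * (qff x k.+1 * qff x (n - k)) =
   x ^+ (n - k) * br x k.+1 * qff x n.
  by rewrite -(IH k) // qffS; pring.
rewrite [qff x n.+1]qffS; move: kn; rewrite ltnS leq_eqVlt => /orP[/eqP->|kn].
  by rewrite gbin_small // subnn !mul0r add0r expr0 mul1r mulrC.
have E : (n - k)%N = (n - k.+1).+1 by lia.
have -> : gbin x n k.+1 * (qff x k.+1 * qff x (n - k)) = qff x n * br x (n - k)%N.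
  by rewrite E [qff x (n - k.+1).+1]qffS -(IH k.+1) //; pring.
rewrite [_ * qff x n]mulrC -mulrDr; congr (_ * _); rewrite /br -!exprnP.
have -> : n.+1 = (n - k + k.+1)%N by lia.
by rewrite exprD; pring.
Qed.

Lemma qbinomial x y n :
  \sum_(k < n.+1) gbin x n k * ((-1) ^+ k * x ^+ 'C(k, 2) * y ^+ k) = qpo x y n.
Proof.
elim: n => [|n IH]; first by rewrite big_ord_recl big_ord0 /= !expr0 !mul1r addr0 qpo0.
rewrite (gbin_sumS x n (fun k => (-1) ^+ k * x ^+ 'C(k, 2) * y ^+ k)) qpoS -IH big_distrl /=.
apply: eq_bigr => k _; rewrite -[RHS]mulrA; congr (_ * _).
have -> : x ^+ n = x ^+ (n - k) * x ^+ k by rewrite -exprD subnK // -ltnS.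
by rewrite binS bin1 exprD !exprS; pring.
Qed.

(** The q-Chu-Vandermonde sum in a form without denominators. *)
Lemma qcauchy x a b n :
  \sum_(k < n.+1) gbin x n k * (b ^+ k * qpo x a k * qpo x b (n - k)) = qpo x (a * b) n.
Proof.
elim: n => [|n IH]; first by rewrite big_ord_recl big_ord0 /= ?expr0 !qpo0 !mulr1 ?addr0.
rewrite (gbin_sumS x n (fun k => b ^+ k * qpo x a k * qpo x b (n.+1 - k))) qpoS -IH big_distrl /=.
apply: eq_bigr => k _; rewrite -[RHS]mulrA; congr (_ * _).
have kn : (k <= n)%N by rewrite -ltnS.
rewrite subSS subSn // !qpoS.
have -> : x ^+ n = x ^+ (n - k) * x ^+ k by rewrite -exprD subnK.
by rewrite exprS; pring.
Qed.

Section Generic.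
Variable x : K.
Hypothesis (x_nroot : forall k, x ^+ k.+1 != 1).

Lemma gbin_sym n k : (k <= n)%N -> gbin x n (n - k) = gbin x n k.
Proof.
move=> kn; have n0 : qff x k * qff x (n - k) != 0 by rewrite mulf_neq0 // qff_neq0.
apply: (mulIf n0); rewrite (gbin_fact x kn) -(gbin_fact x (leq_subr k n)) subKn //.
by pring.
Qed.

Lemma gbin_mul n l k : (k <= l)%N -> (l <= n)%N ->
  gbin x n l * gbin x l k = gbin x n k * gbin x (n - k) (l - k).
Proof.
move=> kl ln; have kn : (k <= n)%N := leq_trans kl ln.
have n0 : qff x k * qff x (l - k) * qff x (n - l) != 0 by rewrite !mulf_neq0 // qff_neq0.
apply: (mulIf n0).
transitivity (qff x n).
  rewrite -(gbin_fact x ln) -(gbin_fact x kl); pring.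
rewrite -(gbin_fact x kn) -(gbin_fact x (leq_sub2r k ln)).
have -> : (n - k - (l - k) = n - l)%N by lia.
by pring.
Qed.

Lemma qcauchy2 a b n :
  \sum_(k < n.+1) gbin x n k * (b ^+ (n - k) * qpo x b k * qpo x a (n - k)) = qpo x (a * b) n.
Proof.
rewrite -qcauchy (reindex_inj rev_ord_inj) /=; apply: eq_bigr => k _.
have kn : (k <= n)%N by rewrite -ltnS.
by rewrite subSS subKn // gbin_sym //; pring.
Qed.

End Generic.

End Sums.

Lemma binD2 k l : 'C(k + l, 2) = ('C(k, 2) + 'C(l, 2) + k * l)%N.
Proof.
elim: l => [|l IH]; first by rewrite addn0 bin0n muln0 !addn0.
by rewrite addnS !binS !bin1 IH; lia.
Qed.

Lemma bin2_double k : ('C(k, 2) + 'C(k, 2) = k * k.-1)%N.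
Proof.
elim: k => [|k IH] //; rewrite binS bin1 /= mulSn.
by case: k IH => [|k] //= IH; lia.
Qed.

(** * Reversal of q-shifted factorials and a terminating 3phi2 transformation *)

Section Transformation.
Variable K : fieldType.
Variable p : K.
Hypotheses (p_neq0 : p != 0) (p_nroot : forall k, p ^+ k.+1 != 1).

Lemma prod_pow2 (A : K) n : \prod_(i < n) (- A * p ^+ i) = (- A) ^+ n * p ^+ 'C(n, 2).
Proof.
elim: n => [|n IH]; first by rewrite big_ord0 bin0n !expr0 mulr1.
by rewrite big_ord_recr /= IH binS bin1 exprD exprS; pring.
Qed.

Lemma qpo_rev (A : K) n : A != 0 ->
  qpo p (p ^- n.-1 / A) n * ((- A) ^+ n * p ^+ 'C(n, 2)) = qpo p A n.
Proof.
move=> A0; rewrite -prod_pow2 /qpo [\prod_(i < n) (- A * _)](reindex_inj rev_ord_inj) -big_split /=.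
rewrite [RHS](reindex_inj rev_ord_inj); apply: eq_bigr => i _ /=.
have -> : n.-1 = (n - i.+1 + i)%N by have := ltn_ord i; lia.
have : p ^+ i != 0 by rewrite expf_neq0.
have : p ^+ (n - i.+1) != 0 by rewrite expf_neq0.
rewrite exprD; gen_pow => z0 z1; field.
by rewrite A0 z0 z1.
Qed.

Lemma qpo_inv (c : K) n : qpo p^-1 c n = qpo p (c * p ^- n.-1) n.
Proof.
rewrite /qpo (reindex_inj rev_ord_inj); apply: eq_bigr => i _ /=.
have -> : n.-1 = (n - i.+1 + i)%N by have := ltn_ord i; lia.
rewrite exprVn exprD; congr (1 - _).
have : p ^+ i != 0 by rewrite expf_neq0.
have : p ^+ (n - i.+1) != 0 by rewrite expf_neq0.
gen_pow => z0 z1; field.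
by rewrite z0 z1.
Qed.

Lemma pow_split (A : K) n k : (k <= n)%N ->
  (- A) ^+ n * p ^+ 'C(n, 2) =
  (- A) ^+ k * p ^+ 'C(k, 2) * ((- (A * p ^+ k)) ^+ (n - k) * p ^+ 'C(n - k, 2)).
Proof.
move=> kn; rewrite -{1 2}(subnKC kn) binD2 !exprD -mulNr exprMn -exprM.
by pring.
Qed.

(** After passing from base 1/p to base p, this is [qcauchy] for the parameters cD and p^(1-l)/D,
    whose product is c p^(1-l); the factors with the second parameter are then reversed. *)
Lemma qvan_expand (c D : K) l : D != 0 ->
  (- D) ^+ l * p ^+ 'C(l, 2) * qpo p^-1 c l =
  \sum_(k < l.+1) gbin p l k * ((-1) ^+ k * p ^+ 'C(k, 2) * p ^- (l.-1 * k) *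
     qpo p (c * D) k * qpo p (D * p ^+ k) (l - k)).
Proof.
move=> D0; rewrite qpo_inv.
have -> : c * p ^- l.-1 = (c * D) * (p ^- l.-1 / D).
  have : p ^+ l.-1 != 0 by rewrite expf_neq0.
  by gen_pow => z0; field; rewrite D0 z0.
rewrite -qcauchy // big_distrr /=; apply: eq_bigr => k _.
have kl : (k <= l)%N by rewrite -ltnS.
rewrite (pow_split _ kl).
have Dk0 : D * p ^+ k != 0 by rewrite mulf_neq0 // expf_neq0.
rewrite -(qpo_rev (l - k) Dk0).
case: (eqVneq (k : nat) l) => [E|ne].
  rewrite E subnn !qpo0 !expr0 exprMn exprVn -exprM [(- D) ^+ l]exprNn.
  have : p ^+ (l.-1 * l) != 0 by rewrite expf_neq0.
  have : D ^+ l != 0 by rewrite expf_neq0.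
  rewrite exprVn.
  by gen_pow => z1 z2; field; rewrite z1 z2.
have -> : p ^- (l - k).-1 / (D * p ^+ k) = p ^- l.-1 / D.
  have -> : l.-1 = ((l - k).-1 + k)%N by have := ltn_ord k; lia.
  have : p ^+ k != 0 by rewrite expf_neq0.
  have : p ^+ (l - k).-1 != 0 by rewrite expf_neq0.
  by rewrite exprD; gen_pow => z1 z2; field; rewrite D0 z1 z2.
rewrite !exprMn !exprVn -exprM [(- D) ^+ k]exprNn.
have : p ^+ (l.-1 * k) != 0 by rewrite expf_neq0.
have : D ^+ k != 0 by rewrite expf_neq0.
by gen_pow => z1 z2; field; rewrite z1 z2.
Qed.

Lemma qvan (b c : K) n : b != 0 -> c != 0 ->
  \sum_(t < n.+1) gbin p n t * ((-1) ^+ t * p ^+ 'C(t, 2) * (c / b) ^+ t *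
     qpo p b t * qpo p (c * p ^+ t) (n - t)) = qpo p (c / b) n.
Proof.
move=> b0 c0; have cb0 : c / b != 0 by rewrite mulf_neq0 // invr_eq0.
rewrite -(qpo_rev n cb0).
have -> : p ^- n.-1 / (c / b) = (p ^- n.-1 / c) * b.
  by rewrite invf_div mulrA mulrAC.
rewrite -(qcauchy2 p_nroot) big_distrl /=; apply: eq_bigr => t _.
have tn : (t <= n)%N by rewrite -ltnS.
rewrite (pow_split _ tn).
have ct0 : c * p ^+ t != 0 by rewrite mulf_neq0 // expf_neq0.
rewrite -(qpo_rev (n - t) ct0).
have E : qpo p (p ^- (n - t).-1 / (c * p ^+ t)) (n - t) = qpo p (p ^- n.-1 / c) (n - t).
  case: (eqVneq (t : nat) n) => [->|ne]; first by rewrite subnn !qpo0.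
  congr qpo.
  have -> : n.-1 = ((n - t).-1 + t)%N by have := ltn_ord t; lia.
  have : p ^+ t != 0 by rewrite expf_neq0.
  have : p ^+ (n - t).-1 != 0 by rewrite expf_neq0.
  by rewrite exprD; gen_pow => z1 z2; field; rewrite c0 z1 z2.
have -> : - (c / b * p ^+ t) = - (c * p ^+ t) / b by field.
rewrite E [(- (c * p ^+ t) / b) ^+ _]exprMn [(- (c / b)) ^+ t]exprNn exprVn.
have : b ^+ (n - t) != 0 by rewrite expf_neq0.
by gen_pow => z1; field; rewrite z1.
Qed.

(* A terminating 3phi2 transformation: expand (c;1/p)_l / (D;p)_l by q-Vandermonde,
   exchange the sums, and resum the inner one by q-Vandermonde again. *)
Lemma hyp_transform (c D Y E : K) n : D != 0 -> Y != 0 -> E != 0 ->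
  (forall i, (i < n)%N -> 1 - D * p ^+ i != 0) -> (forall i, (i < n)%N -> 1 - E * p ^+ i != 0) ->
  \sum_(l < n.+1) gbin p n l * (p ^+ (2 * 'C(l, 2)) * (D * E / Y) ^+ l *
     qpo p^-1 c l * qpo p Y l / (qpo p D l * qpo p E l)) =
  (\sum_(k < n.+1) gbin p n k * ((E / Y) ^+ k * qpo p (c * D) k * qpo p Y k / qpo p D k *
     qpo p (E / Y) (n - k))) / qpo p E n.
Proof.
move=> D0 Y0 E0 Dn En.
have qn0 A m : (forall i, (i < n)%N -> 1 - A * p ^+ i != 0) -> (m <= n)%N -> qpo p A m != 0.
  by move=> H mn; apply/prodf_neq0 => i _; apply: H; apply: leq_trans mn.
pose f l k := gbin p n l * gbin p l k * ((- (E / Y)) ^+ l * p ^+ 'C(l, 2) * (-1) ^+ k * p ^+ 'C(k, 2) *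
   p ^- (l.-1 * k) * qpo p (c * D) k * qpo p Y l / (qpo p D k * qpo p E l)).
transitivity (\sum_(0 <= l < n.+1) \sum_(0 <= k < n.+1) f l k).
  rewrite big_mkord; apply: eq_bigr => l _.
  have ln : (l <= n)%N by rewrite -ltnS.
  rewrite (big_cat_nat _ (n := l.+1)) //= [X in _ = _ + X]big1_seq ?addr0; last first.
    by move=> k; rewrite mem_index_iota => /andP[_ /andP[lk _]]; rewrite /f [gbin p l k]gbin_small // mulr0 mul0r.
  rewrite big_mkord.
  transitivity (gbin p n l * (- (E / Y)) ^+ l * p ^+ 'C(l, 2) * qpo p Y l / (qpo p D l * qpo p E l) *
     ((- D) ^+ l * p ^+ 'C(l, 2) * qpo p^-1 c l)).
    have -> : D * E / Y = (- D) * (- (E / Y)) by field.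
    by rewrite exprMn mul2n -addnn exprD; pring.
  rewrite (qvan_expand _ _ D0) big_distrr /=; apply: eq_bigr => k _.
  have kl : (k <= l)%N by rewrite -ltnS.
  have hD : qpo p D l = qpo p D k * qpo p (D * p ^+ k) (l - k) by rewrite -qpo_add subnKC.
  rewrite /f hD.
  have h1 := qn0 D k Dn (leq_trans kl ln); have h2 := qn0 E l En ln.
  have h3 : qpo p (D * p ^+ k) (l - k) != 0.
    have := qn0 D l Dn ln; rewrite hD mulf_eq0 negb_or.
    by case/andP.
  have : p ^+ (l.-1 * k) != 0 by rewrite expf_neq0.
  by move: h3; gen_pow => h3 z0; field; rewrite z0 h1 h2 h3.
rewrite exchange_big /= big_mkord big_distrl /=; apply: eq_bigr => k _.
have kn : (k <= n)%N by rewrite -ltnS.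
rewrite (big_cat_nat _ (n := k)) //=; last exact: leqW.
rewrite [X in X + _]big1_seq ?add0r; last first.
  by move=> l; rewrite mem_index_iota => /andP[_ /andP[_ lk]]; rewrite /f [gbin p l k]gbin_small // mulr0 mul0r.
rewrite -{1}[k : nat]add0n big_addn subSn // big_mkord.
have Yk0 : Y * p ^+ k != 0 by rewrite mulf_neq0 // expf_neq0.
have Ek0 : E * p ^+ k != 0 by rewrite mulf_neq0 // expf_neq0.
have EY : E / Y = (E * p ^+ k) / (Y * p ^+ k).
  have : p ^+ k != 0 by rewrite expf_neq0.
  by gen_pow => z0; field; rewrite Y0 z0.
rewrite [X in _ * qpo p X (n - k)]EY -(qvan (n - k) Yk0 Ek0) -EY.
rewrite !(big_distrr, big_distrl) /=; apply: eq_bigr => t _.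
have tn : (t <= n - k)%N by rewrite -ltnS.
have ln : (t + k <= n)%N by lia.
rewrite /f (gbin_mul p_nroot) ?leq_addl // addnK.
have hE : qpo p E n = qpo p E (t + k) * qpo p (E * p ^+ k * p ^+ t) (n - k - t).
  by rewrite -mulrA -exprD [(k + t)%N]addnC -qpo_add; congr qpo; lia.
have h1 := qn0 D k Dn kn; have h2 := qn0 E (t + k)%N En ln.
have h4 : qpo p (E * p ^+ k * p ^+ t) (n - k - t) != 0.
  by have := qn0 E n En (leqnn n); rewrite hE mulf_eq0 negb_or => /andP[].
have hp : p ^+ ((t + k).-1 * k) = p ^+ 'C(k, 2) * p ^+ 'C(k, 2) * p ^+ (k * t).
  rewrite -!exprD bin2_double; congr (_ ^+ _).
  have aux a b : ((b + a).-1 * a = a * a.-1 + a * b)%N by case: a => [|a]; rewrite ?muln0 // addnS; lia.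
  exact: aux.
have hY : qpo p Y (t + k) = qpo p Y k * qpo p (Y * p ^+ k) t by rewrite addnC qpo_add.
rewrite hE hp hY [(t + k)%N]addnC binD2 [(- (E / Y)) ^+ _]exprNn !exprD in h2 *.
have sq1 m : (-1) ^+ m * (-1) ^+ m = 1 :> K by rewrite -expr2 sqrr_sign.
have := expf_neq0 'C(k, 2) p_neq0; have := expf_neq0 (k * t) p_neq0.
move: h4 (sq1 k); gen_pow => h4 s1 h5 h6.
apply: (etrans _ (mul1r _)); rewrite -s1; field.
by rewrite h1 h2 h4 h5 h6.
Qed.

End Transformation.

(** * The alternating sum behind the row operations *)

Section OddSum.
Variables (K : fieldType) (q : K).
Hypotheses (q_neq0 : q != 0) (q_nroot : forall k, q ^+ k.+1 != 1).

Definition oddp (A : nat) : K := \prod_(i < A) (1 - q ^+ (i.*2.+1)).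

Lemma qff_double A : qff q A.*2 = oddp A * qff (q ^+ 2) A.
Proof.
elim: A => [|A IH]; first by rewrite /oddp big_ord0 !qff0 mulr1.
rewrite doubleS !qffS IH /oddp big_ord_recr /= /br -!exprnP -exprM mulnC muln2 doubleS.
by pring.
Qed.

Lemma sqr_exprz e : (q ^+ 2) ^ e = q ^ (2 * e).
Proof. by rewrite exprnP exprz_exp. Qed.

Lemma br_sqr e : br (q ^+ 2) e = br q (2 * e).
Proof. by rewrite /br sqr_exprz. Qed.

Lemma sqr_nroot k : (q ^+ 2) ^+ k.+1 != 1.
Proof. by rewrite -exprM mulnS; apply: q_nroot. Qed.

(** Induction on n after multiplying by 1 - q^n = (1 - q^(n-2t)) + q^(n-2t) (1 - q^(2t)). The first
    part lowers n by one; the second, with t replaced by t + 1, is the sum for A - 1 and n - 2. The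
    bound n < 2T puts all nonzero terms in range, and n <= 2A makes A - t a true difference in each
    of them. *)
Lemma oddp_sum A n T : (n <= A.*2)%N -> (n < T.*2)%N ->
  \sum_(t < T) (-1) ^+ t * q ^+ (t * t.-1) * oddp (A - t) / qff (q ^+ 2) t * invqf q (n%:Z - t.*2%:Z) =
  q ^+ 'C(n, 2) * qff q (A.*2 - n) / qff q n * invqf (q ^+ 2) (A%:Z - n%:Z).
Proof.
have q20 : q ^+ 2 != 0 by rewrite expf_neq0.
have [N] := ubnP n; elim: N n A T => // N IH n A T; rewrite ltnS => nN nA nT.
case: n => [|n] in nN nA nT *.
  case: T nT => [|T] // _; rewrite big_ord_recl big1 ?addr0 => [|t _]; last first.
    by rewrite invqf_neg ?mulr0 //= /bump; lia.
  rewrite /= !subn0 !qff0 !expr0 qff_double invr1 !mulr1 !mul1r mulfK //.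
  exact: qff_neq0 sqr_nroot _.
case: T nT => // T nT.
have bn0 : br q n.+1 != 0 by apply: br_neq0.
apply: (mulfI bn0); rewrite big_distrr /=.
pose g t := (-1) ^+ t * q ^+ (t * t.-1) * oddp (A - t) / qff (q ^+ 2) t.
transitivity (\sum_(t < T.+1) g t * invqf q (n%:Z - t.*2%:Z) +
  \sum_(t < T.+1) g t * br q t.*2 * q ^ (n.+1%:Z - t.*2%:Z) * invqf q (n.+1%:Z - t.*2%:Z)).
  rewrite -big_split /=; apply: eq_bigr => t _; rewrite -/(g t).
  have -> : n%:Z - t.*2%:Z = n.+1%:Z - t.*2%:Z - 1 by lia.
  rewrite -(br_invqf q_neq0 q_nroot) -[RHS]/(g t * _ + _).
  have -> : br q n.+1 = br q (n.+1%:Z - t.*2%:Z) + br q t.*2 * q ^ (n.+1%:Z - t.*2%:Z).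
    rewrite /br mulrBl mul1r -expfzDr // [t.*2%:Z + _]addrC subrK; ring.
  by ring.
have -> : \sum_(t < T.+1) g t * invqf q (n%:Z - t.*2%:Z) =
  q ^+ 'C(n, 2) * qff q (A.*2 - n) / qff q n * invqf (q ^+ 2) (A%:Z - n%:Z).
  by apply: IH => //; lia.
rewrite big_ord_recl [X in _ + (X + _)](_ : _ = 0) ?add0r; last by rewrite br0 mulr0 !mul0r.
have nroot2 := sqr_nroot.
have qf0 m : qff q m != 0 by apply: qff_neq0.
have E1 : qff q (A.*2 - n) = qff q (A.*2 - n.+1) * br q (A.*2%:Z - n%:Z).
  by rewrite -subnSK // qffS; congr (_ * br _ _); lia.
case: n => [|n] in nN nA nT bn0 E1 *.
  rewrite big1 ?addr0 => [|t _]; last by rewrite invqf_neg ?mulr0 // /bump /=; lia.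
  rewrite E1 qffS !qff0 !bin_small // !expr0 !mul1r.
  have -> : A%:Z - 1%:Z = A%:Z - 0 - 1 by lia.
  rewrite -(br_invqf q20 nroot2) invr1.
  have -> : br (q ^+ 2) (A%:Z - 0) = br q (A.*2%:Z - 0%:Z).
    by rewrite /br !subr0 -!exprnP -exprM mul2n.
  rewrite (_ : A%:Z - 0 = A) ?subr0 //; field.
  exact: bn0.
have -> : \sum_(t < T) g (lift ord0 t) * br q (lift ord0 t).*2 * q ^ (n.+2%:Z - (lift ord0 t).*2%:Z) *
    invqf q (n.+2%:Z - (lift ord0 t).*2%:Z) =
  - q ^+ n * \sum_(t < T) (-1) ^+ t * q ^+ (t * t.-1) * oddp (A.-1 - t) / qff (q ^+ 2) t * invqf q (n%:Z - t.*2%:Z).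
  rewrite big_distrr /=; apply: eq_bigr => t _; rewrite /g /bump /= add1n ?add0n.
  have -> : n.+2%:Z - t.+1.*2%:Z = n%:Z - t.*2%:Z by lia.
  have -> : br q t.+1.*2 = br (q ^+ 2) t.+1 by rewrite /br -!exprnP -exprM mul2n.
  have -> : (A - t.+1 = A.-1 - t)%N by lia.
  rewrite qffS exprS expfzDr //.
  have b0 : br (q ^+ 2) t.+1 != 0 by apply: br_neq0.
  have qt0 : qff (q ^+ 2) t != 0 by apply: qff_neq0.
  have -> : q ^+ (t.+1 * t) = q ^+ (t * t.-1) * q ^+ (t.*2).
    by rewrite -exprD; congr (_ ^+ _); case: (t : nat) => // k; rewrite /=; lia.
  have -> : q ^ (- (t.*2)%:Z) = (q ^+ t.*2)^-1 by rewrite -exprnN.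
  have qn0 : q ^+ t.*2 != 0 by rewrite expf_neq0.
  rewrite -exprnP; move: (invqf _ _) (oddp _) => iv op.
  by move: b0 qt0 qn0; gen_pow => b0 qt0 qn0; field; rewrite b0 qt0 qn0.
rewrite (IH n A.-1 T) //; [|by lia..].
have -> : (A.-1.*2 - n = A.*2 - n.+2)%N by lia.
have -> : A.-1%:Z - n%:Z = A%:Z - n.+1%:Z by lia.
have -> : A%:Z - n.+2%:Z = A%:Z - n.+1%:Z - 1 by lia.
rewrite -(br_invqf q20 nroot2) E1 !qffS.
have b1 : br q n.+1 != 0 by apply: br_neq0.
have -> : q ^+ 'C(n.+2, 2) = q ^+ n.+1 * q ^+ n * q ^+ 'C(n, 2).
  by rewrite -!exprD !(binS, bin1, bin0); congr (_ ^+ _); lia.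
have -> : q ^+ 'C(n.+1, 2) = q ^+ n * q ^+ 'C(n, 2).
  by rewrite -!exprD !(binS, bin1, bin0); congr (_ ^+ _); lia.
have key : q ^+ n.+1 * br (q ^+ 2) (A%:Z - n.+1%:Z) = br q (A.*2%:Z - n.+1%:Z) - br q n.+1.
  rewrite br_sqr /br mulrBr mulr1 exprnP -expfzDr //.
  have -> : n.+1%:Z + 2 * (A%:Z - n.+1%:Z) = A.*2%:Z - n.+1%:Z by lia.
  by ring.
transitivity (q ^+ n * q ^+ 'C(n, 2) * qff q (A.*2 - n.+2) / (qff q n * br q n.+1) *
   invqf (q ^+ 2) (A%:Z - n.+1%:Z) * (q ^+ n.+1 * br (q ^+ 2) (A%:Z - n.+1%:Z))); last first.
  by gen_pow; field; rewrite qf0 b1 bn0.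
by rewrite key; gen_pow; field; rewrite qf0 b1.
Qed.

End OddSum.

(** * The determinant of order r + s for generic parameters *)

Section Generic.
Variables (K : fieldType) (p : K).
Hypotheses (p_neq0 : p != 0) (p_nroot : forall k, p ^+ k.+1 != 1).
Local Notation fa := (qpo p).

(* Divided differences at the nodes p^0, ..., p^d, up to a common factor. *)
Definition vweight d l : K := (-1) ^+ l * p ^+ 'C(l, 2) * p ^- (d.-1 * l) * gbin p d l.

(** On the monomial of degree h < d, the q-binomial theorem produces (p^(h-d+1);p)_d, which contains
    the factor 1 - p^0. *)
Lemma vweight_sum0 d (P : {poly K}) : (size P <= d)%N ->
  \sum_(l < d.+1) vweight d l * P.[p ^+ l] = 0.
Proof.
move=> szP; under eq_bigr => l _ do rewrite (horner_coef_wide _ szP) big_distrr /=.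
rewrite exchange_big /= big1 // => h _.
transitivity (P`_h * \sum_(l < d.+1) gbin p d l * ((-1) ^+ l * p ^+ 'C(l, 2) * (p ^+ h / p ^+ d.-1) ^+ l)).
  rewrite big_distrr /=; apply: eq_bigr => l _.
  by rewrite /vweight exprMn exprVn -!exprM [(l * h)%N]mulnC; pring.
rewrite qbinomial /qpo.
have hd : (d.-1 - h < d)%N by have := ltn_ord h; lia.
rewrite (bigD1 (Ordinal hd)) //=.
have -> : p ^+ h / p ^+ d.-1 * p ^+ (d.-1 - h) = 1.
  rewrite mulrAC -exprD subnKC ?divff ?expf_neq0 //; by have := ltn_ord h; lia.
by rewrite subrr mul0r mulr0.
Qed.

Lemma size_polyM_le (P Q : {poly K}) m n :
  (size P <= m.+1)%N -> (size Q <= n.+1)%N -> (size (P * Q)%R <= (m + n).+1)%N.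
Proof.
move=> hP hQ; rewrite (leq_trans (size_polyMleq _ _)) //.
have -> : (m + n).+1 = (m.+1 + n.+1).-1 by rewrite addnS.
by rewrite -!subn1 leq_sub2r // leq_add.
Qed.

Lemma size_linear_prod (m n : nat) (a b : nat -> K) :
  (size (\prod_(m <= k < n) ((a k)%:P + (b k)%:P * 'X))%R <= (n - m).+1)%N.
Proof.
rewrite /index_iota; move: (n - m)%N => l; elim: l m => [|l IHl] m.
  by rewrite big_nil size_poly1.
rewrite /= big_cons -[l.+2]/(1 + l).+1; apply: size_polyM_le => //.
by rewrite addrC size_MXaddC; case: ifP => // _; rewrite ltnS size_polyC; case: eqP.
Qed.

Lemma horner_linear_prod (m n : nat) (a b : nat -> K) y :
  (\prod_(m <= k < n) ((a k)%:P + (b k)%:P * 'X)).[y] = \prod_(m <= k < n) (a k + b k * y).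
Proof. by rewrite horner_prod; apply: eq_bigr => k _; rewrite !hornerE. Qed.

Variables (c D E y : K) (u v : nat -> K) (r s : nat).
Local Notation L := (r + s)%N.
Local Notation d := (r + s).-1.

Definition row_wt l := fa E l * fa D l * qpo p^-1 (c * p ^- l) (d - l).
Definition u_col j Y := (\prod_(j.+1 <= k < r) (1 + - u k * Y)) * (\prod_(1 <= k < j.+1) (- v k + 1 * Y)).
Definition phi_col l k :=
  (-1) ^+ l * p ^+ 'C(l, 2) * (D * E * p ^+ (r + k) / (p * y)) ^+ l * fa (y * p ^- k) l.
(** Multipliers of degree s - 1. Together with a column polynomial [u_col] of degree r - 1 they stay
    below degree d, hence are annihilated by [vweight]; their roots are chosen so that they only
    shift c and D in the columns [phi_col]. *)
Definition t_row a Y := (\prod_(a.+1 <= k < s) (- (c * p ^- (s.-1 - k)) + 1 * Y)) *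
  (\prod_(1 <= k < a.+1) (1 + - (D * p ^- k) * Y)).
Definition w_row a l := vweight d l * t_row a (p ^+ l) / row_wt l.

Hypothesis row_wt_neq0 : forall l, (l < L)%N -> row_wt l != 0.

Lemma w_row_u a j : (a < s)%N -> (j < r)%N ->
  \sum_(l < L) w_row a l * (row_wt l * u_col j (p ^+ l)) = 0.
Proof.
move=> as_ jr; pose P : {poly K} :=
  ((\prod_(a.+1 <= k < s) ((- (c * p ^- (s.-1 - k)))%:P + 1%:P * 'X)) *
  (\prod_(1 <= k < a.+1) (1%:P + (- (D * p ^- k))%:P * 'X))) *
  ((\prod_(j.+1 <= k < r) (1%:P + (- u k)%:P * 'X)) * (\prod_(1 <= k < j.+1) ((- v k)%:P + 1%:P * 'X))).
transitivity (\sum_(l < L) vweight d l * P.[p ^+ l]).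
  apply: eq_bigr => l _; rewrite /P !hornerM.
  rewrite (horner_linear_prod _ _ (fun k => - (c * p ^- (s.-1 - k))) (fun _ => 1)).
  rewrite (horner_linear_prod _ _ (fun _ => 1) (fun k => - (D * p ^- k))).
  rewrite (horner_linear_prod _ _ (fun _ => 1) (fun k => - u k)).
  rewrite (horner_linear_prod _ _ (fun k => - v k) (fun _ => 1)).
  rewrite -/(t_row a (p ^+ l)) -/(u_col j (p ^+ l)) /w_row.
  by have R0 := row_wt_neq0 (ltn_ord l); field.
have EL : L = d.+1 by lia.
rewrite EL; apply: vweight_sum0.
have h1 := size_linear_prod a.+1 s (fun k => - (c * p ^- (s.-1 - k))) (fun _ => 1).
have h2 := size_linear_prod 1 a.+1 (fun _ => 1) (fun k => - (D * p ^- k)).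
have h3 := size_linear_prod j.+1 r (fun _ => 1) (fun k => - u k).
have h4 := size_linear_prod 1 j.+1 (fun k => - v k) (fun _ => 1).
by apply: leq_trans (size_polyM_le (size_polyM_le h1 h2) (size_polyM_le h3 h4)) _; lia.
Qed.
Hypotheses (D_neq0 : D != 0) (E_neq0 : E != 0) (y_neq0 : y != 0).
Hypothesis E_gen : forall i, (i < d)%N -> 1 - E * p ^+ i != 0.
Hypothesis D_gen : forall a i, (a < s)%N -> (i < d)%N -> 1 - D * p ^- a * p ^+ i != 0.
Hypothesis c_gen : forall i, (i < d)%N -> 1 - c * p ^- i != 0.

Local Notation G := (c * D * p ^- s.-1).
Local Notation up l := (p ^+ l).

(** Read as a quotient: up to a constant, these linear factors in p^l change 1/(A)_l into 1/(A
    p^-a)_l. [t_row_c] does the same for c in base 1/p. *)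
Lemma fa_down A a l :
  fa (A * p ^- a) a * fa A l =
  fa (A * p ^- a) l * \prod_(1 <= h < a.+1) (1 + - (A * p ^- h) * p ^+ l).
Proof.
have e : \prod_(1 <= h < a.+1) (1 + - (A * p ^- h) * p ^+ l) = fa (A * p ^- a * p ^+ l) a.
  rewrite big_add1 /= big_mkord /qpo (reindex_inj rev_ord_inj); apply: eq_bigr => i _ /=.
  rewrite mulNr; congr (1 - _).
  have ia := ltn_ord i.
  have -> : p ^+ a = p ^+ (a - i.+1).+1 * p ^+ i by rewrite -exprD; congr (_ ^+ _); lia.
  have : p ^+ (a - i.+1).+1 != 0 by rewrite expf_neq0.
  have : p ^+ i != 0 by rewrite expf_neq0.
  by gen_pow => h1 h2; field; rewrite h1 h2.
rewrite e -qpo_add addnC qpo_add; congr (_ * qpo _ _ _).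
by rewrite mulrVK ?unitfE ?expf_neq0.
Qed.

Lemma t_row_c a l : (a < s)%N ->
  (\prod_(a.+1 <= k < s) (- (c * p ^- (s.-1 - k)) + 1 * up l)) * qpo p^-1 c l =
  (up l) ^+ (s.-1 - a) * qpo p^-1 c (s.-1 - a) * qpo p^-1 (c * p ^- (s.-1 - a)) l.
Proof.
move=> as_; have e : \prod_(a.+1 <= k < s) (- (c * p ^- (s.-1 - k)) + 1 * up l) =
    up l ^+ (s.-1 - a) * qpo p^-1 (c * p ^- l) (s.-1 - a).
  have {1}-> : s = ((s.-1 - a) + a.+1)%N by lia.
  rewrite -{1}[a.+1]add0n big_addn addnK big_mkord /qpo.
  have -> : up l ^+ (s.-1 - a) = \prod_(i < s.-1 - a) up l by rewrite prodr_const card_ord.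
  rewrite -big_split /=.
  rewrite (reindex_inj rev_ord_inj); apply: eq_bigr => i _ /=.
  have -> : (s.-1 - (s.-1 - a - i.+1 + a.+1))%N = i by have := ltn_ord i; lia.
  have h1 : p ^+ l != 0 by rewrite expf_neq0.
  have h2 : p ^+ i != 0 by rewrite expf_neq0.
  by rewrite exprVn; move: h1 h2; gen_pow => h1 h2; field; rewrite h1 h2.
rewrite e -!mulrA; congr (_ * _); rewrite mulrC.
have -> : c * p ^- l = c * p^-1 ^+ l by rewrite exprVn.
have -> : c * p ^- (s.-1 - a) = c * p^-1 ^+ (s.-1 - a) by rewrite exprVn.
by rewrite -!qpo_add addnC.
Qed.

Lemma row_wt_c l : (l <= d)%N -> qpo p^-1 (c * p ^- l) (d - l) * qpo p^-1 c l = qpo p^-1 c d.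
Proof.
move=> ld; have -> : c * p ^- l = c * p^-1 ^+ l by rewrite exprVn.
by rewrite mulrC -qpo_add subnKC.
Qed.

Lemma qpoc_neq0 l : (l <= d)%N -> qpo p^-1 c l != 0.
Proof.
move=> ld; apply/prodf_neq0 => i _; rewrite exprVn; apply: c_gen.
exact: leq_trans (ltn_ord i) ld.
Qed.

Lemma faE_neq0 l : (l <= d)%N -> fa E l != 0.
Proof. by move=> ld; apply/prodf_neq0 => i _; apply: E_gen; apply: leq_trans ld. Qed.

Lemma faD_neq0 a l : (a < s)%N -> (l <= d)%N -> fa (D * p ^- a) l != 0.
Proof. by move=> as_ ld; apply/prodf_neq0 => i _; apply: D_gen => //; apply: leq_trans ld. Qed.

(** [t_row a] replaces c by c p^-(s-1-a) and D by D p^-a, which makes the sum the left side of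
    [hyp_transform]. On its right side c enters only through the product of these two, which is c D
    p^-(s-1) for every a. The rest of the dependence on a goes into a constant and linear factors in
    p^l free of k, as needed for Cauchy-Binet. *)
Lemma w_row_phi a k : (a < s)%N -> (k < s)%N ->
  \sum_(l < L) w_row a l * phi_col l k =
  qpo p^-1 c (s.-1 - a) / (qpo p^-1 c d * fa E d) *
  \sum_(l < L) (\prod_(1 <= h < a.+1) (1 + - (D * p ^- h) * up l)) *
     (gbin p d l * fa G l / fa D l *
      ((E / (y * p ^- k)) ^+ l * fa (y * p ^- k) l * fa (E / (y * p ^- k)) (d - l))).
Proof.
move=> as_ ks; have EL : L = d.+1 by lia.
have s0 : (0 < s)%N by lia.
have pn m : p ^+ m != 0 by rewrite expf_neq0.
have pvn m : p ^- m != 0 by rewrite invr_eq0.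
have Da0 : D * p ^- a != 0 by rewrite mulf_neq0.
have Yk0 : y * p ^- k != 0 by rewrite mulf_neq0.
have Ga : c * p ^- (s.-1 - a) * (D * p ^- a) = G.
  have -> : s.-1 = (s.-1 - a + a)%N by lia.
  rewrite addnK exprD; have := pn a; have := pn (s.-1 - a)%N.
  by gen_pow => h1 h2; field; rewrite h1 h2.
rewrite EL; transitivity (qpo p^-1 c (s.-1 - a) / qpo p^-1 c d * fa (D * p ^- a) a *
  \sum_(l < d.+1) gbin p d l * (p ^+ (2 * 'C(l, 2)) * (D * p ^- a * E / (y * p ^- k)) ^+ l *
     qpo p^-1 (c * p ^- (s.-1 - a)) l * fa (y * p ^- k) l / (fa (D * p ^- a) l * fa E l))).
  rewrite big_distrr /=; apply: eq_bigr => l _.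
  have ld : (l <= d)%N by rewrite -ltnS.
  have c1 := row_wt_c ld; have t1 := t_row_c l as_; have f1 := fa_down D a l.
  have n1 := qpoc_neq0 ld; have n2 := qpoc_neq0 (leqnn d).
  have n3 := faE_neq0 ld; have n4 := faD_neq0 as_ ld; have n5 : fa D l != 0.
    by have := faD_neq0 s0 ld; rewrite expr0 invr1 mulr1.
  rewrite /w_row /t_row /row_wt /vweight /phi_col.
  have n6 : qpo p^-1 (c * p ^- l) (d - l) != 0 by move: n2; rewrite -c1 mulf_eq0 negb_or => /andP[].
  move: c1 t1 f1.
  set Pc := \prod_(a.+1 <= _ < s) _; set PD := \prod_(1 <= _ < a.+1) _ => c1 t1 f1.
  have -> : p ^+ (2 * 'C(l, 2)) * (D * p ^- a * E / (y * p ^- k)) ^+ l =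
     p ^+ 'C(l, 2) * p ^+ 'C(l, 2) * ((D * E * p ^+ (r + k) / (p * y)) ^+ l * p ^- (d.-1 * l) * up l ^+ (s.-1 - a)).
    rewrite mul2n -addnn exprD; congr (_ * _).
    case: (posnP l) => [->|l0]; first by rewrite !expr0 muln0 expr0 invr1 expr1n !mulr1.
    have -> : p ^- (d.-1 * l) = (p ^- d.-1) ^+ l by rewrite exprVn -exprM.
    have -> : up l ^+ (s.-1 - a) = (p ^+ (s.-1 - a)) ^+ l by rewrite -!exprM mulnC.
    rewrite -!exprMn; congr (_ ^+ _).
    have d0 : (0 < d)%N by lia.
    have -> : d.-1 = (r + s - 2)%N by lia.
    have E1 : p ^+ (r + k) * p ^+ (s.-1 - a) * p ^+ a = p ^+ (r + s - 2) * p ^+ k * p.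
      by rewrite -!exprD -exprSr; congr (_ ^+ _); lia.
    have n7 := pn (r + s - 2)%N; have n8 := pn k; have n9 := pn a.
    apply: (mulIf n7); apply: (mulIf p_neq0); apply: (mulIf n9).
    transitivity (D * E / y * (p ^+ (r + s - 2) * p ^+ k * p)).
      by move: n7 n8 n9 E1; gen_pow => n7 n8 n9 E1; field; rewrite n8 n9 y_neq0.
    rewrite -E1; move: n7 n8 n9; gen_pow => n7 n8 n9; field.
    by rewrite n7 p_neq0 y_neq0.
  have [PcE PDE] : Pc = up l ^+ (s.-1 - a) * qpo p^-1 c (s.-1 - a) * qpo p^-1 (c * p ^- (s.-1 - a)) l / qpo p^-1 c l /\
    PD = fa (D * p ^- a) a * fa D l / fa (D * p ^- a) l.
    by rewrite -t1 f1 mulfK // mulrAC mulfV ?mul1r.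
  rewrite PcE PDE -c1.
  have sq : (-1) ^+ l * (-1) ^+ l = 1 :> K by rewrite -expr2 sqrr_sign.
  move: sq n1 n3 n4 n5 n6 (pn (d.-1 * l)%N).
  gen_pow => sq n1 n3 n4 n5 n6 n7.
  apply: (etrans _ (mul1r _)); rewrite -sq; field.
  by rewrite n1 n3 n4 n5 n6 n7.
rewrite hyp_transform //; last by move=> i id; apply: D_gen.
rewrite Ga [d.+1.-1]/=.
set X := _ / qpo p^-1 c d * _; set X' := _ / (qpo p^-1 c d * _).
rewrite mulrA mulrAC !big_distrr /=; apply: eq_bigr => l _.
have ld : (l <= d)%N by rewrite -ltnS.
have f1 := fa_down D a l.
have n1 := faE_neq0 (leqnn d); have n2 := faD_neq0 as_ ld; have n3 : fa D l != 0.
  by have := faD_neq0 s0 ld; rewrite expr0 invr1 mulr1.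
have n4 := qpoc_neq0 (leqnn d).
have -> : X / fa E d = X' * fa (D * p ^- a) a.
  by rewrite /X /X'; field; rewrite n1 n4.
have PDE : \prod_(1 <= h < a.+1) (1 + - (D * p ^- h) * up l) = fa (D * p ^- a) a * fa D l / fa (D * p ^- a) l.
  by rewrite f1 mulrAC mulfV ?mul1r.
rewrite PDE; clearbody X X'; move: n1 n2 n3 n4; gen_pow => n1 n2 n3 n4; field.
by rewrite n2 n3.
Qed.

Lemma expp_inj : injective (fun i : nat => p ^+ i).
Proof.
have aux i j : (i < j)%N -> p ^+ i != p ^+ j.
  move=> ij; rewrite -(subnKC (ltnW ij)) exprD -{1}[p ^+ i]mulr1 (inj_eq (mulfI (expf_neq0 i p_neq0))).
  by rewrite -(subnSK ij) eq_sym.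
move=> i j /= /eqP E0; apply/eqP; case: ltngtP => // ij; move: (aux _ _ ij); first by rewrite E0.
by rewrite eq_sym E0.
Qed.

Lemma prod_triangle n (f : nat -> nat -> K) :
  \prod_(1 <= i < n) \prod_(i <= k < n) f i k = \prod_(k < n) \prod_(i < k) f i.+1 k.
Proof.
elim: n => [|n IH]; first by rewrite big_geq // big_ord0.
rewrite big_ord_recr /= -IH; case: n {IH} => [|n].
  by rewrite big_geq // [X in _ = X * _]big_geq // big_ord0 mulr1.
rewrite big_nat_recr //= big_nat1.
have -> : \prod_(1 <= i < n.+1) \prod_(i <= k < n.+2) f i k =
  \prod_(1 <= i < n.+1) (\prod_(i <= k < n.+1) f i k * f i n.+1).
  by apply: eq_big_nat => i /andP[_ ib]; rewrite big_nat_recr //=; apply: ltnW.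
rewrite big_split -mulrA [X in _ = _ * X]big_ord_recr /=; congr (_ * (_ * _)).
by rewrite big_add1 /= big_mkord.
Qed.

Definition x_mx := row_mx (\matrix_(l < L, j < r) (row_wt l * u_col j (up l)))
                          (\matrix_(l < L, k < s) phi_col l k).

(** Multiply from the left by the first r rows of the identity followed by the s rows [w_row]. These
    kill the first r columns, so the product is block triangular. *)
Lemma det_x_mx :
  \det x_mx * \det (\matrix_(a < s, i < s) w_row a (r + i)%N) =
  \det (\matrix_(l < r, j < r) (row_wt l * u_col j (up l))) *
  \det (\matrix_(a < s, k < s) \sum_(l < L) w_row a l * phi_col l k).
Proof.
rewrite /x_mx; set U := (X in row_mx X _); set Ph := (X in row_mx _ X).
pose W : 'M[K]_(s, L) := \matrix_(a, l) w_row a l.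
pose M : 'M[K]_(r + s) := col_mx (row_mx 1%:M 0) W.
have detM : \det M = \det (\matrix_(a < s, i < s) w_row a (r + i)%N).
  rewrite /M -[W]hsubmxK -[col_mx _ _]/(block_mx _ _ _ _) det_lblock det1 mul1r.
  by congr (\det _); apply/matrixP => a i; rewrite !mxE.
rewrite mulrC -detM -det_mulmx mul_col_row.
have -> : W *m U = 0.
  apply/matrixP => a j; rewrite !mxE -[RHS](w_row_u (ltn_ord a) (ltn_ord j)).
  by apply: eq_bigr => l _; rewrite !mxE.
rewrite det_ublock; congr (_ * _).
  rewrite -[U]vsubmxK mul_row_col mul1mx mul0mx addr0; congr (\det _).
  by apply/matrixP => l j; rewrite !mxE.
congr (\det _); apply/matrixP => a k; rewrite !mxE.
by apply: eq_bigr => l _; rewrite !mxE.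
Qed.

Lemma det_u_top :
  \det (\matrix_(l < r, j < r) (row_wt l * u_col j (up l))) =
  (\prod_(l < r) row_wt l) * vdm r (fun i => up i) *
  \prod_(1 <= i < r) \prod_(i <= k < r) (1 - u k * v i).
Proof.
transitivity (\det (\matrix_(l < r, j < r) (row_wt l * 1 *
    ((\prod_(j.+1 <= k < r) (1 + - u k * up l)) * (\prod_(1 <= k < j.+1) (- v k + 1 * up l)))))).
  by congr (\det _); apply/matrixP => l j; rewrite !mxE mulr1.
rewrite det_scale big1_eq mulr1 -mulrA; congr (_ * _).
rewrite (@det_linear_factors _ _ expp_inj r (fun=> 1) (fun k => - u k) (fun k => - v k)
  (fun=> 1) (fun i => up i)); last by move=> *; apply: oner_neq0.
by congr (_ * _); apply: eq_bigr => i _; apply: eq_bigr => k _; rewrite mulr1 mulrNN.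
Qed.

Lemma det_w_bot :
  \det (\matrix_(a < s, i < s) w_row a (r + i)%N) =
  (\prod_(i < s) (vweight d (r + i) / row_wt (r + i))) * vdm s (fun i => up (r + i)) *
  \prod_(k < s) ((-1) ^+ k * fa G k).
Proof.
rewrite -det_tr.
transitivity (\det (\matrix_(i < s, a < s) (vweight d (r + i) / row_wt (r + i) * 1 *
    ((\prod_(a.+1 <= k < s) (- (c * p ^- (s.-1 - k)) + 1 * up (r + i))) *
     (\prod_(1 <= k < a.+1) (1 + - (D * p ^- k) * up (r + i))))))).
  by congr (\det _); apply/matrixP => l j; rewrite !mxE /w_row /t_row mulr1 mulrAC.
rewrite det_scale big1_eq mulr1 -mulrA; congr (_ * _).
rewrite (@det_linear_factors _ _ expp_inj s (fun k => - (c * p ^- (s.-1 - k))) (fun=> 1) (fun=> 1)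
  (fun k => - (D * p ^- k)) (fun i => up (r + i))); last first.
  by move=> k _; rewrite oppr_eq0 mulf_neq0 // invr_eq0 expf_neq0.
congr (_ * _); rewrite prod_triangle; apply: eq_bigr => k _.
have -> : (-1) ^+ k = \prod_(i < k) (-1) :> K by rewrite prodr_const card_ord.
rewrite /qpo -big_split /= (reindex_inj rev_ord_inj); apply: eq_bigr => i _ /=.
have ik := ltn_ord i; have ks := ltn_ord k.
have -> : p ^+ s.-1 = p ^+ (s.-1 - k) * (p ^+ (k - i.+1).+1 * p ^+ i).
  by rewrite -!exprD; congr (_ ^+ _); lia.
have h1 : p ^+ (s.-1 - k) != 0 by rewrite expf_neq0.
have h2 : p ^+ (k - i.+1).+1 != 0 by rewrite expf_neq0.
have h3 : p ^+ i != 0 by rewrite expf_neq0.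
by move: h1 h2 h3; gen_pow => h1 h2 h3; field; rewrite h1 h2 h3.
Qed.

Local Notation e0 := (E / y).

(** The parameter y p^-k of column k is traded for y p^-(s-1), common to all columns; what still
    depends on k is linear in p^l factor by factor, which prepares [det_linear_factors]. *)
Lemma beta_factor k l : (k < s)%N -> (l <= d)%N -> fa e0 k != 0 ->
  (\prod_(k.+1 <= h < s) (1 - y * p ^- h)) * fa e0 k *
  ((E / (y * p ^- k)) ^+ l * fa (y * p ^- k) l * fa (E / (y * p ^- k)) (d - l)) =
  (e0 ^+ l * fa (y * p ^- s.-1) l * fa e0 (d - l)) *
  ((\prod_(k.+1 <= h < s) (1 + - (y * p ^- h) * up l)) *
   (\prod_(1 <= h < k.+1) (- (e0 * p ^+ (d + h.-1)) + 1 * up l))).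
Proof.
move=> ks ld e0k.
have pn m : p ^+ m != 0 by rewrite expf_neq0.
have f1 := fa_down (y * p ^- k) (s.-1 - k) l.
have es : y * p ^- k * p ^- (s.-1 - k) = y * p ^- s.-1.
  have -> : s.-1 = (k + (s.-1 - k))%N by lia.
  rewrite addKn exprD; have h1 := pn k; have h2 := pn (s.-1 - k)%N.
  by move: h1 h2; gen_pow => h1 h2; field; rewrite h1 h2.
have shift (g : nat -> K) : \prod_(k.+1 <= h < s) g h = \prod_(1 <= h < (s.-1 - k).+1) g (k + h)%N.
  rewrite -{1}[k.+1]add1n big_addn; have -> : (s - k = (s.-1 - k).+1)%N by lia.
  by apply: eq_bigr => h _; rewrite addnC.
have yE h : y * p ^- (k + h) = y * p ^- k * p ^- h by rewrite exprD invfM mulrA.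
have f0 : fa (y * p ^- s.-1) (s.-1 - k) = \prod_(k.+1 <= h < s) (1 - y * p ^- h).
  have := fa_down (y * p ^- k) (s.-1 - k) 0.
  rewrite !qpo0 mulr1 mul1r es shift => ->; apply: eq_bigr => h _.
  by rewrite expr0 mulr1 yE.
have f2 : \prod_(k.+1 <= h < s) (1 + - (y * p ^- h) * up l) =
   \prod_(1 <= h < (s.-1 - k).+1) (1 + - (y * p ^- k * p ^- h) * up l).
  by rewrite shift; apply: eq_bigr => h _; rewrite yE.
have ee : E / (y * p ^- k) = e0 * p ^+ k.
  by have h1 := pn k; move: h1; gen_pow => h1; field; rewrite h1 y_neq0.
have f3 : fa e0 k * fa (e0 * p ^+ k) (d - l) = fa e0 (d - l) * fa (e0 * p ^+ (d - l)) k.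
  by rewrite -!qpo_add addnC.
have f4 : \prod_(1 <= h < k.+1) (- (e0 * p ^+ (d + h.-1)) + 1 * up l) = up l ^+ k * fa (e0 * p ^+ (d - l)) k.
  have -> : up l ^+ k = \prod_(i < k) up l by rewrite prodr_const card_ord.
  rewrite big_add1 /= big_mkord /qpo -big_split /=; apply: eq_bigr => i _.
  have -> : (d + i = l + ((d - l) + i))%N by lia.
  by rewrite !exprD; ring.
rewrite f2 f4 ee exprMn -[up k ^+ l]exprM mulnC exprM -f0.
move: f1; rewrite es; set PD := \prod_(1 <= _ < _) _ => f1.
transitivity ((fa (y * p ^- s.-1) (s.-1 - k) * fa (y * p ^- k) l) * (fa e0 k * fa (e0 * p ^+ k) (d - l)) *
   (e0 ^+ l * (p ^+ l) ^+ k)); first by pring.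
by rewrite f1 f3; pring.
Qed.

Definition lv (l : s.-tuple 'I_L) (i : nat) : nat := nth 0%N [seq val x | x <- l] i.

Lemma lv_tnth (l : s.-tuple 'I_L) (i : 'I_s) : lv l i = tnth l i.
Proof. by rewrite /lv (nth_map (tnth l i)) ?size_tuple // -tnth_nth. Qed.

Hypothesis e0_gen : forall k, (k < s)%N -> fa e0 k != 0.
Hypothesis y_gen : forall h, (0 < h < s)%N -> 1 - y * p ^- h != 0.

Definition beta_wt l := gbin p d l * fa G l / fa D l * (e0 ^+ l * fa (y * p ^- s.-1) l * fa e0 (d - l)).

(** Both minors in the Cauchy-Binet sum are instances of [det_linear_factors], and each brings a
    Vandermonde product in the p^(l_i), whence the square. For the first minor only one of the two
    families of linear factors is present, the other being constant 1. *)
Lemma det_w_phi :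
  \det (\matrix_(a < s, k < s) \sum_(l < L) w_row a l * phi_col l k) =
  (\prod_(a < s) qpo p^-1 c a) / (qpo p^-1 c d * fa E d) ^+ s *
  ((\prod_(k < s) \prod_(i < k) - (D * p ^- i.+1)) *
   (\prod_(k < s) fa (E * p ^+ (d - k)) k) /
   \prod_(k < s) ((\prod_(k.+1 <= h < s) (1 - y * p ^- h)) * fa e0 k)) *
  \sum_(l : s.-tuple 'I_L | sorted ltn [seq val x | x <- l])
    (vdm s (fun i => up (lv l i))) ^+ 2 * \prod_(i < s) beta_wt (lv l i).
Proof.
pose A (a : 'I_s) (l : 'I_L) := \prod_(1 <= h < a.+1) (1 + - (D * p ^- h) * up l).
pose B (l : 'I_L) (k : 'I_s) := gbin p d l * fa G l / fa D l *
      ((E / (y * p ^- k)) ^+ l * fa (y * p ^- k) l * fa (E / (y * p ^- k)) (d - l)).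
transitivity (\det (\matrix_(a < s, k < s) (qpo p^-1 c (s.-1 - a) / (qpo p^-1 c d * fa E d) * 1 *
   (\sum_l A a l * B l k)))).
  congr (\det _); apply/matrixP => a k; rewrite !mxE w_row_phi ?ltn_ord // mulr1.
  by congr (_ * _); apply: eq_bigr.
rewrite det_scale big1_eq mulr1 -[RHS]mulrA; congr (_ * _).
  rewrite big_split /= prodr_const card_ord exprVn; congr (_ / _).
  rewrite [RHS](reindex_inj rev_ord_inj); apply: eq_bigr => a _ /=; congr qpo.
  by rewrite -subn1 -subnDA add1n.
rewrite cauchy_binet big_distrr /=; apply: eq_bigr => l sl.
rewrite -det_tr.
have -> : \det (\matrix_(i < s, j < s) A i (tnth l j))^T =
   vdm s (fun i => up (lv l i)) * \prod_(k < s) \prod_(i < k) - (D * p ^- i.+1).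
  transitivity (\det (\matrix_(i < s, a < s) ((\prod_(a.+1 <= k < s) (1 + 0 * up (lv l i))) *
     (\prod_(1 <= k < a.+1) (1 + - (D * p ^- k) * up (lv l i)))))).
    congr (\det _); apply/matrixP => i a; rewrite !mxE /A -lv_tnth.
    by rewrite [\prod_(a.+1 <= _ < s) _]big1 ?mul1r // => k _; rewrite mul0r addr0.
  rewrite (@det_linear_factors _ _ expp_inj s (fun=> 1) (fun=> 0) (fun=> 1)
    (fun k => - (D * p ^- k)) (fun i => up (lv l i))); last first.
    by move=> k _; rewrite oppr_eq0 mulf_neq0 // invr_eq0 expf_neq0.
  congr (_ * _); rewrite prod_triangle; apply: eq_bigr => k _; apply: eq_bigr => i _.
  by rewrite mul1r mul0r subr0.
have yk0 k : \prod_(k.+1 <= h < s) (1 - y * p ^- h) != 0.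
  rewrite prodf_seq_neq0; apply/allP => h; rewrite mem_index_iota => /andP[kh hs] /=.
  by apply: y_gen; rewrite hs (leq_ltn_trans _ kh).
have -> : \det (\matrix_(j < s, k < s) B (tnth l j) k) =
  (\prod_(i < s) beta_wt (lv l i)) *
  (\prod_(k < s) ((\prod_(k.+1 <= h < s) (1 - y * p ^- h)) * fa e0 k))^-1 *
  (vdm s (fun i => up (lv l i)) * \prod_(k < s) fa (E * p ^+ (d - k)) k).
  transitivity (\det (\matrix_(i < s, k < s) (beta_wt (lv l i) *
     ((\prod_(k.+1 <= h < s) (1 - y * p ^- h)) * fa e0 k)^-1 *
     ((\prod_(k.+1 <= h < s) (1 + - (y * p ^- h) * up (lv l i))) *
      (\prod_(1 <= h < k.+1) (- (e0 * p ^+ (d + h.-1)) + 1 * up (lv l i))))))).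
    congr (\det _); apply/matrixP => i k; rewrite !mxE /B -lv_tnth /beta_wt.
    have ld : (lv l i <= d)%N by rewrite lv_tnth; have := ltn_ord (tnth l i); lia.
    have ek := e0_gen (ltn_ord k); have yk := yk0 k.
    have bf := beta_factor (ltn_ord k) ld ek.
    apply: (mulfI (mulf_neq0 yk ek)).
    set w := _ / fa D _; rewrite mulrCA bf; field; rewrite yk ek //.
  rewrite det_scale prodfV; congr (_ * _).
  rewrite (@det_linear_factors _ _ expp_inj s (fun=> 1) (fun h => - (y * p ^- h)) (fun h => - (e0 * p ^+ (d + h.-1)))
    (fun=> 1) (fun i => up (lv l i))); last by move=> k _; apply: oner_neq0.
  congr (_ * _); rewrite prod_triangle; apply: eq_bigr => k _.
  rewrite /qpo; apply: eq_bigr => i _; rewrite mulr1 mulrNN.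
  have ks := ltn_ord k.
  have -> : (d + i.+1.-1 = (d - k) + k + i)%N by rewrite /=; lia.
  rewrite !exprD; congr (1 - _).
  have h1 : p ^+ k != 0 by rewrite expf_neq0.
  by move: h1; gen_pow => h1; field; rewrite h1 y_neq0.
by rewrite expr2; pring.
Qed.

(** Member number i of an increasing sequence must leave room below d for the s - 1 - i later ones.
    Equivalently l_i <= r + i, with i counted from 0. *)
Lemma lv_bound (l : s.-tuple 'I_L) (i : nat) : sorted ltn [seq val x | x <- l] -> (i < s)%N -> (lv l i + (s.-1 - i) <= d)%N.
Proof.
clear - l i.
move=> /(sortedP 0%N) sl is_.
have step j : (i + j < s)%N -> (lv l i + j <= lv l (i + j))%N.
  elim: j => [|j IH] ij; first by rewrite !addn0.
  have := sl (i + j)%N; rewrite size_map size_tuple -addnS => /(_ ij).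
  by have := IH (ltn_trans (_ : (i + j < i + j.+1)%N) ij); rewrite /lv; lia.
have := step (s.-1 - i)%N; have -> : (i + (s.-1 - i) = s.-1)%N by lia.
have sb : (s.-1 < s)%N by lia.
have : (lv l (Ordinal sb) < L)%N by rewrite lv_tnth ltn_ord.
by move=> /=; lia.
Qed.

(** [beta_wt] without its poles. With t = s - 1 - i one has d - l - t = r + i - l >= 0 by
    [lv_bound], so (D)_(r+i)/(D)_l and (e0)_(d-l)/(e0)_t are products; the constants so introduced
    are accounted for in [beta_reg]. *)
Definition reg_wt l t := gbin p d l * e0 ^+ l * fa (y * p ^- s.-1) l * fa G l *
  fa (D * p ^+ l) (d - l - t) * fa (e0 * p ^+ t) (d - l - t).

Definition reg_lhs_cst := vdm s (fun i => up (r + i)) * (\prod_(i < s) vweight d (r + i)) *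
  \prod_(k < s) \prod_(k.+1 <= h < s) (1 - y * p ^- h).

Definition reg_sum :=
  \sum_(l : s.-tuple 'I_L | sorted ltn [seq val x | x <- l])
    (vdm s (fun i => up (lv l i))) ^+ 2 * \prod_(i < s) reg_wt (lv l i) (s.-1 - i).

Lemma beta_reg (l : s.-tuple 'I_L) : sorted ltn [seq val x | x <- l] ->
  (\prod_(i < s) beta_wt (lv l i)) * (\prod_(i < s) fa D (r + i)) =
  (\prod_(k < s) fa e0 k) * \prod_(i < s) reg_wt (lv l i) (s.-1 - i).
Proof.
move=> sl; rewrite [\prod_(k < s) fa e0 k](reindex_inj rev_ord_inj) -!big_split /=.
apply: eq_bigr => i _; have is_ := ltn_ord i; have b := lv_bound sl is_.
set t := (s.-1 - i)%N in b *; set m := lv l i in b *.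
have -> : (s - i.+1 = t)%N by rewrite /t; lia.
have -> : (r + i = m + (d - m - t))%N by rewrite /t in b *; lia.
rewrite qpo_add /beta_wt /reg_wt -/t.
have -> : (d - m = t + (d - m - t))%N by rewrite /t in b *; lia.
rewrite qpo_add addKn.
have Dm0 : fa D m != 0.
  have s0 : (0 < s)%N by lia.
  by have := faD_neq0 s0 (_ : (m <= d)%N); rewrite expr0 invr1 mulr1; apply; lia.
by move: Dm0; gen_pow => Dm0; field.
Qed.

Lemma prod_ordD m n (f : nat -> K) : \prod_(l < m + n) f l = (\prod_(l < m) f l) * \prod_(i < n) f (m + i)%N.
Proof. by rewrite big_split_ord. Qed.

(** Neither side has a denominator in c, D or E any more. Genericity is used only in the proof, and
    the identity can be extended to all parameters afterwards. *)
Lemma det_x_mx_reg :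
  \det x_mx * (\prod_(k < s) fa G k) * reg_lhs_cst =
  (\prod_(l < r) (fa E l * fa D l)) * (\prod_(s <= l < L) qpo p^-1 (c * p ^- l) (d - l)) *
  (vdm r (fun i => up i) * \prod_(1 <= i < r) \prod_(i <= k < r) (1 - u k * v i)) *
  (\prod_(k < s) \prod_(i < k) (D * p ^- i.+1)) * reg_sum.
Proof.
set yk := \prod_(k < s) \prod_(k.+1 <= h < s) (1 - y * p ^- h).
have M := det_x_mx; rewrite det_w_bot det_u_top det_w_phi in M.
set KR := \prod_(1 <= i < r) _ in M *.
have rw0 : \prod_(i < s) row_wt (r + i) != 0.
  by apply/prodf_neq0 => i _; apply: row_wt_neq0; have := ltn_ord i; lia.
have sg : (\prod_(k < s) (-1) ^+ k) * (\prod_(k < s) (-1) ^+ k) = 1 :> K.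
  by rewrite -big_split big1 //= => k _; rewrite -expr2 sqrr_sign.
have sD : \prod_(k < s) \prod_(i < k) - (D * p ^- i.+1) =
  (\prod_(k < s) (-1) ^+ k) * \prod_(k < s) \prod_(i < k) (D * p ^- i.+1).
  rewrite -big_split; apply: eq_bigr => k _ /=.
  have -> : (-1) ^+ k = \prod_(i < k) (-1) :> K by rewrite prodr_const card_ord.
  by rewrite -big_split; apply: eq_bigr => i _ /=; rewrite mulN1r.
have EE : (\prod_(i < s) fa E (r + i)) * (\prod_(k < s) fa (E * p ^+ (d - k)) k) = fa E d ^+ s.
  rewrite (reindex_inj rev_ord_inj) -big_split /= -[X in _ ^+ X]card_ord -prodr_const.
  apply: eq_bigr => k _; have ks := ltn_ord k; have -> : (r + (s - k.+1) = d - k)%N by lia.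
  by rewrite -qpo_add subnK //; lia.
have CC : (\prod_(l < L) qpo p^-1 (c * p ^- l) (d - l)) * (\prod_(a < s) qpo p^-1 c a) =
   qpo p^-1 c d ^+ s * \prod_(s <= l < L) qpo p^-1 (c * p ^- l) (d - l).
  rewrite -(big_mkord xpredT (fun l => qpo p^-1 (c * p ^- l) (d - l))) (big_cat_nat _ (n := s)) ?leq_addl //=.
  rewrite mulrAC big_mkord -big_split /= -[X in _ ^+ X]card_ord -prodr_const; congr (_ * _).
  by apply: eq_bigr => a _; rewrite row_wt_c //; have := ltn_ord a; lia.
have RW : (\prod_(l < r) row_wt l) * (\prod_(i < s) row_wt (r + i)) =
   (\prod_(l < r) (fa E l * fa D l)) * (\prod_(i < s) fa E (r + i)) * (\prod_(i < s) fa D (r + i)) *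
   \prod_(l < L) qpo p^-1 (c * p ^- l) (d - l).
  rewrite -(prod_ordD r s row_wt) /row_wt 2!big_split /= (prod_ordD r s (fun l => fa E l)).
  rewrite (prod_ordD r s (fun l => fa D l)) [\prod_(l < r) (_ * _)]big_split /=.
  by pring.
have yk0 : yk != 0.
  apply/prodf_neq0 => k _; rewrite prodf_seq_neq0; apply/allP => h; rewrite mem_index_iota => /andP[kh hs] /=.
  by apply: y_gen; rewrite hs (leq_ltn_trans _ kh).
have e0k : \prod_(k < s) fa e0 k != 0 by apply/prodf_neq0 => k _; apply: e0_gen.
have cd0 : qpo p^-1 c d ^+ s != 0 by rewrite expf_neq0 // qpoc_neq0.
have Ed0 : fa E d ^+ s != 0 by rewrite expf_neq0 // faE_neq0.
set S0 := \sum_(l : s.-tuple _ | _) _ in M.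
have SS : S0 * (\prod_(i < s) fa D (r + i)) = (\prod_(k < s) fa e0 k) * reg_sum.
  rewrite /S0 /reg_sum big_distrl big_distrr /=; apply: eq_bigr => l sl.
  by rewrite -mulrA beta_reg // mulrCA.
have hW : \prod_(i < s) (vweight d (r + i) / row_wt (r + i)) =
    (\prod_(i < s) vweight d (r + i)) / \prod_(i < s) row_wt (r + i).
  by rewrite (big_split _ _ _ (fun i : 'I_s => vweight d (r + i))) /= prodfV.
have hS : \prod_(k < s) ((-1) ^+ k * fa G k) = (\prod_(k < s) (-1) ^+ k) * \prod_(k < s) fa G k.
  by rewrite big_split.
have hY : \prod_(k < s) ((\prod_(k.+1 <= h < s) (1 - y * p ^- h)) * fa e0 k) = yk * \prod_(k < s) fa e0 k.
  by rewrite big_split.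
rewrite hW hS hY sD exprMn in M.
rewrite /reg_lhs_cst -/yk.
move: (\det x_mx) (vdm s _) (vdm r _) (\prod_(k < s) fa G k) (\prod_(i < s) vweight _ _)
  (\prod_(k < s) \prod_(i < k) (D * _)) M RW CC EE SS sg rw0 yk0 e0k cd0 Ed0.
move: (KR) (S0) (reg_sum) (yk) (\prod_(k < s) fa e0 k) (qpo p^-1 c d ^+ s) (fa E d ^+ s).
move: (\prod_(i < s) row_wt (r + i)) (\prod_(l < r) row_wt l) (\prod_(l < r) (fa E l * fa D l))
   (\prod_(i < s) fa E (r + i)) (\prod_(i < s) fa D (r + i)) (\prod_(l < L) qpo p^-1 (c / up l) (d - l))
   (\prod_(a < s) qpo p^-1 c a) (\prod_(s <= l < L) qpo p^-1 (c / up l) (d - l)) (\prod_(k < s) fa (E * up (d - k)) k)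
   (\prod_(k < s) (-1) ^+ k).
clear => PR PRr A FE FD CL Cc C2 PE Sg KR S0 RS yk e0k cd Ed dX vd vr PG PV DD M RW CC EE SS sg PR0 yk0 e00 cd0 Ed0.
transitivity (dX * (PV / PR * vd * (Sg * PG)) * (PR * yk * Sg)).
  by apply: (etrans _ (_ : (Sg * Sg) * (dX * PG * (vd * PV * yk)) = _)); [rewrite sg mul1r | field].
rewrite M; transitivity ((PRr * PR) * vr * KR * Cc / (cd * Ed) * DD * PE / e0k * S0 * (Sg * Sg)).
  by field; rewrite yk0 e00 Ed0 cd0.
rewrite RW sg; transitivity (A * vr * KR * DD * (CL * Cc) * (FE * PE) * (S0 * FD) / (cd * Ed * e0k)).
  by field; rewrite e00 Ed0 cd0.
by rewrite CC EE SS; field; rewrite e00 Ed0 cd0.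
Qed.

End Generic.

(** * From generic to arbitrary parameters *)

Section Laurent.
Variable K : fieldType.

(** Functions instead of formal Laurent polynomials, so that the closure properties apply directly
    to the expressions at hand. *)
Definition laurent (f : K -> K) : Prop :=
  exists (P : {poly K}) (n : nat), forall z, z != 0 -> f z * z ^+ n = P.[z].

Lemma laurent_ext f g : (forall z, f z = g z) -> laurent f -> laurent g.
Proof. by move=> E [P [n H]]; exists P, n => z z0; rewrite -E H. Qed.

Lemma laurent_cst a : laurent (fun=> a).
Proof. by exists a%:P, 0%N => z _; rewrite expr0 mulr1 hornerC. Qed.

Lemma laurent_id : laurent (fun z => z).
Proof. by exists 'X, 0%N => z _; rewrite expr0 mulr1 hornerX. Qed.

Lemma laurent_inv : laurent (fun z => z^-1).
Proof. by exists 1, 1%N => z z0; rewrite expr1 mulVf // hornerC. Qed.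

Lemma laurent_mul f g : laurent f -> laurent g -> laurent (fun z => f z * g z).
Proof.
move=> [P [n Hf]] [Q [m Hg]]; exists (P * Q), (n + m)%N => z z0.
by rewrite hornerM -Hf // -Hg // exprD mulrACA.
Qed.

Lemma laurent_add f g : laurent f -> laurent g -> laurent (fun z => f z + g z).
Proof.
move=> [P [n Hf]] [Q [m Hg]]; exists (P * 'X^m + Q * 'X^n), (n + m)%N => z z0.
by rewrite hornerD !hornerM !hornerXn -Hf // -Hg // exprD mulrDl !mulrA mulrAC [g z * _ * _]mulrAC.
Qed.

Lemma laurent_opp f : laurent f -> laurent (fun z => - f z).
Proof. by move=> [P [n H]]; exists (- P), n => z z0; rewrite hornerN -H // mulNr. Qed.

Lemma laurent_exp f n : laurent f -> laurent (fun z => f z ^+ n).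
Proof.
move=> Lf; elim: n => [|n IH]; first exact: (laurent_ext _ (laurent_cst 1)).
by apply: (laurent_ext _ (laurent_mul Lf IH)) => z; rewrite exprS.
Qed.

Lemma laurent_prod I (r : seq I) (P : pred I) (f : I -> K -> K) :
  (forall i, laurent (f i)) -> laurent (fun z => \prod_(i <- r | P i) f i z).
Proof.
move=> H; elim: r => [|i r IH]; first by apply: (laurent_ext _ (laurent_cst 1)) => z; rewrite big_nil.
case Pi: (P i); last by apply: (laurent_ext _ IH) => z; rewrite big_cons Pi.
by apply: (laurent_ext _ (laurent_mul (H i) IH)) => z; rewrite big_cons Pi.
Qed.

Lemma laurent_sum I (r : seq I) (P : pred I) (f : I -> K -> K) :
  (forall i, laurent (f i)) -> laurent (fun z => \sum_(i <- r | P i) f i z).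
Proof.
move=> H; elim: r => [|i r IH]; first by apply: (laurent_ext _ (laurent_cst 0)) => z; rewrite big_nil.
case Pi: (P i); last by apply: (laurent_ext _ IH) => z; rewrite big_cons Pi.
by apply: (laurent_ext _ (laurent_add (H i) IH)) => z; rewrite big_cons Pi.
Qed.

Lemma laurent_det n (M : K -> 'M[K]_n) :
  (forall i j, laurent (fun z => M z i j)) -> laurent (fun z => \det (M z)).
Proof.
move=> H; apply: laurent_sum => s; apply: laurent_mul; first exact: laurent_cst.
exact: laurent_prod.
Qed.

Lemma laurent_eq (x : nat -> K) B f g : injective x -> (forall M, x M != 0) ->
  laurent f -> laurent g -> (forall M, (B <= M)%N -> f (x M) = g (x M)) ->
  forall z, z != 0 -> f z = g z.
Proof.
move=> x_inj x0 [P [n Hf]] [Q [m Hg]] E z z0.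
have PQ : P * 'X^m - Q * 'X^n = 0.
  set W := (LHS); pose rs := [seq x (B + i)%N | i <- iota 0 (size W)].
  apply: (roots_geq_poly_eq0 (rs := rs)); last by rewrite size_map size_iota.
    apply/allP => _ /mapP[i _ ->]; rewrite rootE /W hornerD hornerN !hornerM !hornerXn.
    by rewrite -Hf // -Hg // E ?leq_addr // mulrAC subrr.
  by rewrite map_inj_uniq ?iota_uniq // => i j /x_inj; lia.
have : (P * 'X^m - Q * 'X^n).[z] = 0 by rewrite PQ horner0.
rewrite hornerD hornerN !hornerM !hornerXn -Hf // -Hg // => /eqP; rewrite subr_eq0 => /eqP E'.
have zz : z ^+ n * z ^+ m != 0 by rewrite mulf_neq0 // expf_neq0.
by apply: (mulIf zz); rewrite mulrA E' -!mulrA [z ^+ m * _]mulrC.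
Qed.

End Laurent.

Ltac laurent_tac := repeat match goal with
  | |- laurent (fun z => \prod_(i <- _ | _) _) => apply: laurent_prod => ?
  | |- laurent (fun z => \sum_(i <- _ | _) _) => apply: laurent_sum => ?
  | |- laurent (fun z => @GRing.mul _ _ _) => apply: laurent_mul
  | |- laurent (fun z => @GRing.add _ _ _) => apply: laurent_add
  | |- laurent (fun z => @GRing.opp _ _) => apply: laurent_opp
  | |- laurent (fun z => @GRing.exp _ _ _) => apply: laurent_exp
  | |- laurent (fun z => z) => exact: laurent_id
  | |- laurent (fun z => z^-1) => exact: laurent_inv
  | |- laurent (@GRing.inv _) => exact: laurent_inv
  | |- laurent (fun=> _) => exact: laurent_cst
  end.

Section Extension.
Variables (K : fieldType) (q : K).
Hypotheses (q_neq0 : q != 0) (q_nroot : forall k, q ^+ k.+1 != 1).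
Local Notation p := ((q ^+ 2)^-1).

Lemma pexpE i : p ^+ i = q ^ (- (2 * i)%:Z).
Proof. by rewrite exprVn -exprM -exprnN. Qed.

Lemma pexpVE i : p ^- i = q ^ (2 * i)%:Z.
Proof. by rewrite exprVn invrK -exprM. Qed.

Lemma p_neq0 : p != 0. Proof. by rewrite invr_eq0 expf_neq0. Qed.

Lemma p_nroot k : p ^+ k.+1 != 1.
Proof. by rewrite exprVn invr_eq1 -exprM mulnS; apply: q_nroot. Qed.

Variables (iE ic : int) (n r s : nat) (iu iv : nat -> int).
(** D is E / q, so that (E;p)_l and (D;p)_l, in base p = q^-2, interleave to a product of 2l factors
    in base 1/q, as in [qpo_fall2] below. *)
Let E z := q ^ iE / z.
Let D z := q ^ (iE - 1) / z.
Let c z := z ^+ 2 * q ^ ic.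
Let y := q ^ (2 * n)%:Z.
Let u z k := q ^ (iu k) / z.
Let v z k := z ^+ 2 * q ^ (iv k).

Lemma det_x_mx_all z : z != 0 ->
  \det (x_mx p (c z) (D z) (E z) y (u z) (v z) r s) *
    (\prod_(k < s) qpo p (c z * D z * p ^- s.-1) k) * reg_lhs_cst p y r s =
  (\prod_(l < r) (qpo p (E z) l * qpo p (D z) l)) *
  (\prod_(s <= l < r + s) qpo p^-1 (c z * p ^- l) ((r + s).-1 - l)) *
  (vdm r (fun i => p ^+ i) * \prod_(1 <= i < r) \prod_(i <= k < r) (1 - u z k * v z i)) *
  (\prod_(k < s) \prod_(i < k) (D z * p ^- i.+1)) * reg_sum p (c z) (D z) (E z) y r s.
Proof.
have x_inj := expp_inj q_neq0 q_nroot.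
have x0 M : q ^+ M != 0 by rewrite expf_neq0.
have Lq A k : laurent A -> laurent (fun z => qpo p (A z) k).
  by move=> LA; rewrite /qpo; laurent_tac.
have Lq' A k : laurent A -> laurent (fun z => qpo p^-1 (A z) k).
  by move=> LA; rewrite /qpo; laurent_tac.
have LE : laurent E by rewrite /E; laurent_tac.
have LD : laurent D by rewrite /D; laurent_tac.
have Lc : laurent c by rewrite /c; laurent_tac.
have Lu k : laurent (fun z => u z k) by rewrite /u; laurent_tac.
have Lv k : laurent (fun z => v z k) by rewrite /v; laurent_tac.
(* For M beyond this bound the exponent coming from z = q^M outweighs all others, so no factor 1 -
   q^x assumed nonzero in the generic identity has x = 0. *)
pose B := (`|iE| + `|ic| + 2 * (r + s) + 2 * n + 2 * s + 10)%N.
move: z; match goal with |- forall z, is_true (z != 0) -> @?f z = @?g z =>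
  apply: (@laurent_eq _ _ B f g x_inj x0) end.
- apply: laurent_mul; last exact: laurent_cst.
  apply: laurent_mul.
    apply: laurent_det => l j; case: (split_ordP j) => k ->.
      apply: (laurent_ext (f := fun z => row_wt p (c z) (D z) (E z) r s l * u_col (u z) (v z) r k (p ^+ l))).
        by move=> z; rewrite /x_mx row_mxEl mxE.
      apply: laurent_mul.
        rewrite /row_wt; apply: laurent_mul; first by apply: laurent_mul; apply: Lq.
        by apply: Lq'; apply: laurent_mul; laurent_tac.
      rewrite /u_col; laurent_tac => //.
    apply: (laurent_ext (f := fun z => phi_col p (D z) (E z) y r l k)).
      by move=> z; rewrite /x_mx row_mxEr mxE.
    by rewrite /phi_col; laurent_tac.
  by apply: laurent_prod => k; apply: Lq; laurent_tac.
- apply: laurent_mul.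
    apply: laurent_mul.
      apply: laurent_mul.
        apply: laurent_mul.
          by apply: laurent_prod => l; apply: laurent_mul; apply: Lq.
        by apply: laurent_prod => l; apply: Lq'; laurent_tac.
      by laurent_tac.
    by laurent_tac.
  rewrite /reg_sum; apply: laurent_sum => l; apply: laurent_mul; first exact: laurent_cst.
  apply: laurent_prod => i; rewrite /reg_wt.
  by laurent_tac => //; apply: Lq; laurent_tac.
move=> M BM; rewrite [q ^+ M]exprnP.
have qz e : e != 0 -> 1 - q ^ e != 0 by apply: br_neq0.
have Eg i : (i < (r + s).-1)%N -> 1 - E (q ^ M) * p ^+ i != 0.
  move=> il; rewrite /E pexpE invr_expz -!expfzDr //; apply: qz; rewrite /B in BM; lia.
have Dg a i : (a < s)%N -> (i < (r + s).-1)%N -> 1 - D (q ^ M) * p ^- a * p ^+ i != 0.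
  move=> as_ il; rewrite /D pexpVE pexpE invr_expz -!expfzDr //; apply: qz; rewrite /B in BM; lia.
have cg i : (i < (r + s).-1)%N -> 1 - c (q ^ M) * p ^- i != 0.
  move=> il; rewrite /c pexpVE -exprnP -exprM exprnP -!expfzDr //; apply: qz; rewrite /B in BM; lia.
have E0 : E (q ^ M) != 0 by rewrite /E mulf_neq0 ?invr_eq0 ?expfz_neq0.
have D0 : D (q ^ M) != 0 by rewrite /D mulf_neq0 ?invr_eq0 ?expfz_neq0.
have y0 : y != 0 by rewrite expfz_neq0.
apply: (det_x_mx_reg p_neq0 p_nroot) => //.
- move=> l lL; rewrite /row_wt; apply: mulf_neq0; [apply: mulf_neq0|].
  + apply/prodf_neq0 => i _; apply: Eg; have := ltn_ord i; lia.
  + apply/prodf_neq0 => i _; rewrite /D pexpE invr_expz -!expfzDr //; apply: qz.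
    by have := ltn_ord i; rewrite /B in BM; lia.
  + apply/prodf_neq0 => i _; have -> : c (q ^ M) * p ^- l * p^-1 ^+ i = c (q ^ M) * p ^- (l + i).
      by rewrite exprD invfM -mulrA [p^-1 ^+ i]exprVn.
    apply: cg.
    by have := ltn_ord i; lia.
- move=> k ks; apply/prodf_neq0 => i _; rewrite /E /y pexpE !invr_expz -!expfzDr //; apply: qz.
  by have := ltn_ord i; rewrite /B in BM; lia.
- by move=> h hs; rewrite /y pexpVE -expfzDr //; apply: qz; lia.
Qed.

End Extension.

(** * Evaluation of the determinant of the skew staircase *)

(* Cases (a) and (b) are e = 0 and e = 1, with s standing for the paper's t in case (b). *)
Section Reduction.
Variables (K : fieldType) (q : K).
Hypotheses (q_neq0 : q != 0) (q_nroot : forall k, q ^+ k.+1 != 1).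
Local Notation p := ((q ^+ 2)^-1).
Local Notation Q := (q ^+ 2).
Variables (N n m r k s e : nat).
Hypotheses (nE : n = (r + k)%N) (NE : (N + e = n + s.*2)%N) (e1 : (e <= 1)%N) (es : (e <= s)%N)
  (mN : (0 < r)%N -> (m + r <= N.+1)%N).
Local Notation P := (r + s + k)%N.
Local Notation d := (r + s).-1.

Definition shift j : nat := if (j < r)%N then m else 0%N.
Definition skew_entry i j : K := invqf q (N%:Z - i.*2%:Z + j%:Z - (shift j)%:Z).
(* The coefficients of [oddp_sum]. *)
Definition elim_entry l i : K :=
  if (l <= i)%N then (-1) ^+ (i - l) * q ^+ ((i - l) * (i - l).-1) * oddp q (P - e - i) / qff Q (i - l) else 0.

Lemma elim_skew l j : (l < P)%N -> (j < n)%N ->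
  \sum_(i < P) elim_entry l i * skew_entry i j =
  q ^+ 'C(absz (N%:Z + j%:Z - (shift j)%:Z - l.*2%:Z)%R, 2) * qff q (n + shift j - e - j) *
  invqf q (N%:Z + j%:Z - (shift j)%:Z - l.*2%:Z) * invqf Q ((shift j)%:Z - s%:Z - j%:Z + l%:Z).
Proof.
move=> lP jn; set B := N%:Z + _ - _ - _.
transitivity (\sum_(t < P - l) (-1) ^+ t * q ^+ (t * t.-1) * oddp q ((P - e - l) - t) / qff Q t * invqf q (B - t.*2%:Z)).
  rewrite -(big_mkord xpredT (fun i => elim_entry l i * skew_entry i j)) (big_cat_nat _ (n := l)) ?(ltnW lP) //=.
  rewrite [X in X + _]big1_seq ?add0r => [|i]; last first.
    by rewrite mem_index_iota => /andP[_ /andP[_ il]]; rewrite /elim_entry leqNgt il mul0r.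
  rewrite -{1}[l]add0n big_addn big_mkord; apply: eq_bigr => t _.
  rewrite /elim_entry leq_addl addnK /skew_entry; congr (_ * oddp _ _ / _ * invqf _ _); first by lia.
  by rewrite /B; lia.
case: (lerP 0 B) => B0; last first.
  rewrite [invqf q B]invqf_neg // mulr0 mul0r big1 // => t _.
  by rewrite invqf_neg ?mulr0 //; lia.
have [b Bb] : exists b : nat, B = b by exists `|B|%N; lia.
have sh : (shift j <= m)%N by rewrite /shift; case: ifP.
rewrite Bb (oddp_sum q_neq0 q_nroot); [|rewrite /B in Bb; lia|rewrite /B in Bb; lia].
rewrite absz_nat; congr (_ * qff _ _ * _ * invqf _ _); rewrite /B in Bb; lia.
Qed.

Definition v_entry l j := q ^+ 'C(absz (N%:Z + j%:Z - (shift j)%:Z - l.*2%:Z)%R, 2) * qff q (n + shift j - e - j) *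
  invqf q (N%:Z + j%:Z - (shift j)%:Z - l.*2%:Z) * invqf Q ((shift j)%:Z - s%:Z - j%:Z + l%:Z).

Definition v_mx : 'M[K]_(r + s) :=
  row_mx (\matrix_(l < r + s, j < r) v_entry l j) (\matrix_(l < r + s, i < s) elim_entry l (n + i)).

Lemma elim_diag : \det (\matrix_(l < P, i < P) elim_entry l i) = \prod_(l < P) oddp q (P - e - l).
Proof.
rewrite -det_tr det_trig.
  by apply: eq_bigr => l _; rewrite !mxE /elim_entry leqnn subnn mul0n !expr0 qff0 invr1 !mul1r mulr1.
by apply/is_trig_mxP => i j ij; rewrite !mxE /elim_entry leqNgt ij.
Qed.

(** Unit columns inserted after the first r make room for the rows n, ..., n + s - 1; elimination
    turns them into columns of the elimination matrix. The last k columns then vanish in the first r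
    + s rows and are triangular below, with the powers of q on the diagonal. *)
Lemma det_skew_v :
  (\prod_(l < P) oddp q (P - e - l)) * (-1) ^+ (s * k) * \det (\matrix_(i < n, j < n) skew_entry i j) =
  \det v_mx * \prod_(b < k) q ^+ 'C(n - e - r - b, 2).
Proof.
have En : \det (\matrix_(i < n, j < n) skew_entry i j) = \det (\matrix_(i < r + k, j < r + k) skew_entry i j) by rewrite nE.
rewrite En -mulrA -(det_delta_cols skew_entry (erefl P)) -elim_diag -det_mulmx.
set M := _ *m _.
have Mu l j : M l j = if (j < r)%N then v_entry l j else
    if (j < r + s)%N then elim_entry l (n + (j - r)) else v_entry l (j - s).
  rewrite /M mxE; case: (ltnP j r) => jr.
    rewrite /v_entry -elim_skew ?ltn_ord //; last by lia.
    by apply: eq_bigr => i _; rewrite !mxE jr.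
  case: (ltnP j (r + s)) => jrs.
    have b : (n + (j - r) < P)%N by lia.
    rewrite (bigD1 (Ordinal b)) //= big1 => [|i ne].
      by rewrite !mxE /= ltnNge jr /= jrs -nE eqxx mulr1 addr0.
    rewrite !mxE /= ltnNge jr /= jrs -nE; case: eqP => [E|_]; last by rewrite mulr0.
    by case/eqP: ne; apply: val_inj.
  have jP := ltn_ord j; rewrite /v_entry -elim_skew ?ltn_ord //; last by lia.
  by apply: eq_bigr => i _; rewrite !mxE ltnNge jr /= ltnNge jrs.
clearbody M; rewrite -[M]submxK; have -> : ursubmx M = 0.
  apply/matrixP => l j; rewrite !mxE Mu /=.
  have h1 : (r + s + j < r)%N = false by lia.
  have h2 : (r + s + j < r + s)%N = false by lia.
  rewrite h1 h2 /v_entry /shift; have h3 : (r + s + j - s < r)%N = false by lia.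
  have lb := ltn_ord l; rewrite h3 [invqf Q _]invqf_neg ?mulr0 //; lia.
rewrite det_lblock; congr (_ * _).
  congr (\det _); apply/matrixP => l j; rewrite [LHS]mxE [LHS]mxE Mu /v_mx.
  case: (split_ordP j) => j' ->; rewrite ?row_mxEl ?row_mxEr mxE /= ?ltn_ord //.
  by rewrite ltn_add2l ltn_ord addKn.
rewrite det_trig.
  apply: eq_bigr => b _; rewrite !mxE Mu /=.
  have h1 : (r + s + b < r)%N = false by lia.
  have h2 : (r + s + b < r + s)%N = false by lia.
  rewrite h1 h2 /v_entry /shift; have h3 : (r + s + b - s < r)%N = false by lia.
  rewrite h3; have bk := ltn_ord b.
  have -> : N%:Z + (r + s + b - s)%N%:Z - 0%:Z - (r + s + b).*2%:Z = (n - e - r - b)%N by lia.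
  have -> : 0%:Z - s%:Z - (r + s + b - s)%N%:Z + (r + s + b)%N%:Z = 0%N by lia.
  have -> : (n + 0 - e - (r + s + b - s) = n - e - r - b)%N by lia.
  by rewrite /= qff0 invr1 mulr1 mulfK // qff_neq0.
apply/is_trig_mxP => a b ab; rewrite !mxE Mu /=.
have h1 : (r + s + b < r)%N = false by lia.
have h2 : (r + s + b < r + s)%N = false by lia.
rewrite h1 h2 /v_entry /shift; have h3 : (r + s + b - s < r)%N = false by lia.
by rewrite h3 [invqf Q _]invqf_neg ?mulr0 //; lia.
Qed.

(** * Identification with the determinant [x_mx] *)

Lemma qpo_fall a l : qpo p (q ^ a) l = \prod_(i < l) br q (a - (2 * i)%:Z).
Proof. by apply: eq_bigr => i _; rewrite /br pexpE -expfzDr. Qed.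

Lemma qpo_rise a l : qpo p^-1 (q ^ a) l = \prod_(i < l) br q (a + (2 * i)%:Z).
Proof. by apply: eq_bigr => i _; rewrite /br invrK -exprM exprnP -expfzDr. Qed.

(** Holds without comparing b and t: for 0 <= b < t the product contains 1 - x^0, in accordance with
    [invqf] being 0 on the left. *)
Lemma invqf_down (x : K) b t : x != 0 -> (forall i, x ^+ i.+1 != 1) ->
  invqf x (b - t%:Z) = (\prod_(i < t) br x (b - i%:Z)) * invqf x b.
Proof.
move=> x0 xn; elim: t => [|t IH]; first by rewrite big_ord0 mul1r subr0.
have -> : b - t.+1%:Z = b - t%:Z - 1 by lia.
by rewrite -(br_invqf x0 xn) IH big_ord_recr /= mulrA [br x _ * _]mulrC.
Qed.

Lemma qpo_fall2 a l : qpo p (q ^ a) l * qpo p (q ^ (a - 1)) l = \prod_(i < 2 * l) br q (a - i%:Z).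
Proof.
rewrite !qpo_fall; elim: l => [|l IH]; first by rewrite muln0 !big_ord0 mulr1.
rewrite mulnS add2n !big_ord_recr /= -IH -!mulrA; congr (_ * _).
rewrite mulrCA; congr (_ * (br q _ * br q _)); lia.
Qed.

Lemma exprz_eq (a b : int) : a = b -> q ^ a = q ^ b. Proof. by move->. Qed.

(** The parameters are read off from the entries: [xE], [xD] and [u] describe the factors of
    1/(q;q)_(N+j-m-2l), [xc] and [v] those of 1/(Q;Q)_(m-s-j+l), and [y] those of
    1/(Q;Q)_(n+i-l). *)
Let z := q ^ m%:Z.
Let iE := N%:Z + r%:Z - 1.
Let ic : int := 2 * (1 - s%:Z).
Let iu (j : nat) : int := N%:Z + j%:Z.
Let iv (j : nat) : int := 2 * (1 - s%:Z - j%:Z).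
Let xE := q ^ iE / z.
Let xD := q ^ (iE - 1) / z.
Let xc := z ^+ 2 * q ^ ic.
Let y := q ^ (2 * n)%:Z.
Let u j := q ^ (iu j) / z.
Let v j := z ^+ 2 * q ^ (iv j).

(** The part of the quadratic exponents of q that depends on l alone. It is the same for both kinds
    of columns and therefore leaves the determinant as a row factor. *)
Definition row_pow (l : nat) : K := q ^ (2 * l%:Z * l%:Z + l%:Z - 2 * l%:Z * (N%:Z - m%:Z)).
Definition col_cst (j : nat) : K :=
  qff q (n + m - e - j) * invqf q (N%:Z - m%:Z + r%:Z - 1) * invqf Q (m%:Z + r%:Z - 1) * q ^+ 'C(N + j - m, 2).
Definition phi_cst (i : nat) : K :=
  (-1) ^+ (n + i) * q ^+ (2 * 'C(n + i, 2)) * oddp q (P - e - (n + i)) / qff Q (n + i).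

Lemma v_entry_x l j : (j < r)%N -> (l < r + s)%N ->
  v_entry l j = row_pow l * col_cst j * (row_wt p xc xD xE r s l * u_col u v r j (p ^+ l)).
Proof.
move=> jr lL; have mr := mN (leq_ltn_trans (leq0n _) jr).
have Q0 : Q != 0 by rewrite expf_neq0.
have Qn := sqr_nroot q_nroot.
rewrite /v_entry /shift jr.
have E1 : xE = q ^ (N%:Z + r%:Z - 1 - m%:Z) by rewrite /xE /z invr_expz -expfzDr.
have D1 : xD = q ^ (N%:Z + r%:Z - 1 - m%:Z - 1).
  by rewrite /xD /z invr_expz -expfzDr //; apply: exprz_eq; rewrite /iE; lia.
have c1 : xc * p ^- l = q ^ (2 * (m%:Z - s%:Z + 1 + l%:Z)).
  by rewrite /xc /z pexpVE exprnP exprz_exp -!expfzDr //; apply: exprz_eq; rewrite /ic; lia.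
set b := N%:Z + r%:Z - 1 - m%:Z in E1 D1.
have hb : N%:Z + j%:Z - m%:Z - l.*2%:Z = b - (2 * l + (r.-1 - j))%N%:Z by rewrite /b; lia.
have hQ : m%:Z - s%:Z - j%:Z + l%:Z = (m%:Z + r%:Z - 1) - ((d - l) + j)%N%:Z by lia.
have h1 : invqf q (b - (2 * l + (r.-1 - j))%N%:Z) = qpo p xE l * qpo p xD l *
    (\prod_(j.+1 <= k0 < r) (1 + - u k0 * p ^+ l)) * invqf q b.
  rewrite (invqf_down b (2 * l + (r.-1 - j)) q_neq0 q_nroot) E1 D1 qpo_fall2
    (prod_ordD (2 * l) (r.-1 - j) (fun i => br q (b - i%:Z))); congr (_ * _ * _).
  have rj : (r - j.+1 = r.-1 - j)%N by lia.
  rewrite -[X in index_iota X r]add0n big_addn rj big_mkord [RHS](reindex_inj rev_ord_inj).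
  apply: eq_bigr => i _ /=; have ib := ltn_ord i.
  rewrite /u /iu /z invr_expz pexpE mulNr -!expfzDr //; congr (1 - _); apply: exprz_eq.
  by rewrite /b; lia.
have h2 : invqf Q (m%:Z + r%:Z - 1 - ((d - l) + j)%N%:Z) = qpo p^-1 (xc * p ^- l) (d - l) *
    (q ^ (2 * j%:Z * l%:Z) * \prod_(1 <= k0 < j.+1) (- v k0 + 1 * p ^+ l)) * invqf Q (m%:Z + r%:Z - 1).
  rewrite (invqf_down (m%:Z + r%:Z - 1) (d - l + j) Q0 Qn) (prod_ordD (d - l) j (fun i => br Q (m%:Z + r%:Z - 1 - i%:Z))) c1 qpo_rise; congr (_ * _ * _).
    rewrite (reindex_inj rev_ord_inj); apply: eq_bigr => i _; rewrite br_sqr; congr br.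
    by have := ltn_ord i; rewrite /=; lia.
  have -> : q ^ (2 * j%:Z * l%:Z) = \prod_(i < j) q ^ (2 * l%:Z).
    by rewrite prodr_const card_ord exprnP exprz_exp; apply: exprz_eq; lia.
  rewrite big_add1 /= big_mkord -big_split /=; apply: eq_bigr => i _.
  rewrite br_sqr /br mul1r [q ^ (2 * l%:Z) * _]mulrDr [RHS]addrC pexpE.
  have -> : q ^ (2 * l%:Z) * q ^ (- (2 * l)%N%:Z) = 1.
    by rewrite -expfzDr // (_ : _ + - _ = 0) ?expr0z //; lia.
  rewrite mulrN; congr (1 - _).
  by rewrite /v /z exprnP exprz_exp -!expfzDr //; apply: exprz_eq; rewrite /iv; lia.
rewrite hb hQ h1 h2 /col_cst (_ : N%:Z - m%:Z + r%:Z - 1 = b); last by rewrite /b; lia.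
rewrite /row_wt /u_col.
(* For a negative argument [absz] spoils the exponent of q, but then the reciprocal factorial makes
   both sides vanish. *)
case: (lerP 0 (b - (2 * l + (r.-1 - j))%N%:Z)) => bp; last first.
  have z0 : qpo p xE l * qpo p xD l * (\prod_(j.+1 <= k0 < r) (1 + - u k0 * p ^+ l)) * invqf q b = 0.
    by rewrite -h1 invqf_neg.
  transitivity (0 : K); first by rewrite z0 mulr0 mul0r.
  symmetry; rewrite -[RHS](mul0r (row_pow l * qff q (n + m - e - j) * invqf Q (m%:Z + r%:Z - 1) * q ^+ 'C(N + j - m, 2) *
     qpo p^-1 (xc / p ^+ l) (d - l) * \prod_(1 <= k0 < j.+1) (- v k0 + 1 * p ^+ l))) -z0.
  by pring.
have pw : q ^+ 'C(absz (b - (2 * l + (r.-1 - j))%N%:Z)%R, 2) * q ^ (2 * j%:Z * l%:Z) =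
   row_pow l * q ^+ 'C(N + j - m, 2).
  rewrite /row_pow !exprnP -!expfzDr //; apply: exprz_eq.
  have B2 (x : nat) : ('C(x, 2) + 'C(x, 2))%N%:Z = x%:Z * x%:Z - x%:Z.
    by rewrite bin2_double; case: x => [|x] //=; lia.
  have := B2 (absz (b - (2 * l + (r.-1 - j))%N%:Z)%R); have := B2 (N + j - m)%N.
  have -> : (N + j - m)%N%:Z = N%:Z + j%:Z - m%:Z by lia.
  rewrite gez0_abs // -hb; lia.
transitivity ((q ^+ 'C(absz (b - (2 * l + (r.-1 - j))%N%:Z)%R, 2) * q ^ (2 * j%:Z * l%:Z)) *
  (qff q (n + m - e - j) * (qpo p xE l * qpo p xD l * \prod_(j.+1 <= k0 < r) (1 + - u k0 * p ^+ l) * invqf q b) *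
   (qpo p^-1 (xc / p ^+ l) (d - l) * (\prod_(1 <= k0 < j.+1) (- v k0 + 1 * p ^+ l)) * invqf Q (m%:Z + r%:Z - 1)))).
  by pring.
by rewrite pw; pring.
Qed.

Lemma elim_entry_phi l i : (i < s)%N -> (l < r + s)%N ->
  elim_entry l (n + i) = row_pow l * phi_cst i * phi_col p xD xE y r l i.
Proof.
move=> is_ lL; have Q0 : Q != 0 by rewrite expf_neq0.
have Qn := sqr_nroot q_nroot.
have fa_y : invqf Q ((n + i)%N%:Z - l%:Z) = qpo p (y * p ^- i) l * invqf Q (n + i)%N%:Z.
  rewrite (invqf_down (n + i)%N%:Z l Q0 Qn); congr (_ * _).
  have -> : y * p ^- i = q ^ (2 * (n + i)%N%:Z).
    by rewrite /y pexpVE -expfzDr //; apply: exprz_eq; lia.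
  by rewrite qpo_fall; apply: eq_bigr => h _; rewrite br_sqr; congr br; lia.
rewrite /elim_entry; case: leqP => lM; last first.
  have q0 : qpo p (y * p ^- i) l = 0.
    move/eqP: fa_y; rewrite invqf_neg; last by lia.
    rewrite eq_sym mulf_eq0 => /orP[/eqP//|].
    by rewrite /= invr_eq0 (negPf (qff_neq0 _ _)).
  by rewrite /phi_col q0 !mulr0.
have -> : (qff Q (n + i - l))^-1 = invqf Q ((n + i)%N%:Z - l%:Z).
  by rewrite (_ : (n + i)%N%:Z - l%:Z = (n + i - l)%N%:Z) //; lia.
rewrite fa_y /= /phi_col /phi_cst.
have sg : (-1) ^+ (n + i - l) = (-1) ^+ (n + i) * (-1) ^+ l :> K.
  rewrite -{2}(subnK lM) exprD -mulrA -[(-1) ^+ l * _]expr2 sqrr_sign mulr1 //.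
have pw : q ^+ ((n + i - l) * (n + i - l).-1) =
   row_pow l * q ^+ (2 * 'C(n + i, 2)) * (p ^+ 'C(l, 2) * (xD * xE * p ^+ (r + i) / (p * y)) ^+ l).
  have -> : xD * xE * p ^+ (r + i) / (p * y) =
     q ^ ((iE - 1 - m%:Z) + (iE - m%:Z) - (2 * (r + i))%N%:Z + 2 - (2 * n)%N%:Z).
    have pE1 : p^-1 = q ^ 2 by rewrite invrK.
    rewrite /xD /xE /y /z invfM pE1 pexpE !invr_expz -!expfzDr //; apply: exprz_eq; lia.
  have B2 (x : nat) : (2 * 'C(x, 2))%N%:Z = x%:Z * x%:Z - x%:Z.
    by rewrite mul2n -addnn bin2_double; case: x => [|x] //=; lia.
  rewrite /row_pow pexpE !exprnP exprz_exp -!expfzDr //; apply: exprz_eq.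
  rewrite !B2 /iE.
  have -> : ((n + i - l) * (n + i - l).-1)%N%:Z = ((n + i)%:Z - l%:Z) * ((n + i)%:Z - l%:Z - 1).
    by case: (n + i - l)%N (subnK lM) => [|x] //=; lia.
  by rewrite PoszD; lia.
by rewrite sg pw; pring.
Qed.

Lemma det_v_mx :
  \det v_mx = (\prod_(l < r + s) row_pow l) * ((\prod_(j < r) col_cst j) * (\prod_(i < s) phi_cst i)) *
  \det (x_mx p xc xD xE y u v r s).
Proof.
pose w (j : nat) := if (j < r)%N then col_cst j else phi_cst (j - r).
transitivity (\det (\matrix_(l < r + s, j < r + s) (row_pow l * w j * x_mx p xc xD xE y u v r s l j))).
  congr (\det _); apply/matrixP => l j; rewrite [RHS]mxE /v_mx /x_mx.
  case: (split_ordP j) => j' ->; rewrite !(row_mxEl, row_mxEr) !mxE /w /=.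
    by rewrite ltn_ord v_entry_x ?ltn_ord.
  by rewrite ltnNge leq_addr /= addKn elim_entry_phi ?ltn_ord.
rewrite det_scale; congr (_ * _ * _); last by congr (\det _); apply/matrixP => l j; rewrite mxE.
rewrite (prod_ordD r s w); congr (_ * _); apply: eq_bigr => j _; rewrite /w.
  by rewrite ltn_ord.
by rewrite ltnNge leq_addr /= addKn.
Qed.

(** * The sum over increasing tuples in base q^2 *)

Local Notation xG := (xc * xD * p ^- s.-1).

(* The summand of the theorem, with i starting from 0. *)
Definition paper_term (l : s.-tuple 'I_(r + s)) : K :=
  (\prod_(i < s) q ^ ((N%:Z + n%:Z + e%:Z - 2 * (2 * i.+1%:Z - 1)) * (lv l i)%:Z)) *
  (\prod_(i < s) \prod_(j < s | (i < j)%N) ((1 - Q ^+ (lv l j - lv l i)) / (1 - Q)) ^+ 2) *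
  \prod_(i < s) (gbin Q d (lv l i) * qpo Q (q ^ (2 - N%:Z - n%:Z - e%:Z)) (lv l i) *
    qpo Q (q ^ (n%:Z + m%:Z - r%:Z - 2 * i%:Z - 1 + e%:Z)) (r + i - lv l i) *
    (qpo Q (q ^ (N%:Z - m%:Z - r%:Z - 2 * i%:Z)) (r + i - lv l i) /
     qpo Q (q ^ (N%:Z + m%:Z - r%:Z - 2 * i%:Z)) (r + i - lv l i))).

(** The factor free of l_i by which [reg_wt], after absorbing its share of the Vandermonde square,
    differs from the summand of the theorem. *)
Definition reg_cst (i : nat) : K :=
  (-1) ^+ (r + i) *
  q ^ (- ((n%:Z + m%:Z - r%:Z - 2 * i%:Z - 1 + e%:Z) * (r + i)%N%:Z + (r + i)%N%:Z * ((r + i)%N%:Z - 1))) *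
  qpo p xG (r + i).

Lemma qpo_Q a l : qpo Q (q ^ a) l = \prod_(i < l) br q (a + (2 * i)%:Z).
Proof. by rewrite -qpo_rise invrK. Qed.

Lemma qff_inv a : qff p a = (-1) ^+ a * p ^+ 'C(a.+1, 2) * qff Q a.
Proof.
elim: a => [|a IH]; first by rewrite !qff0 !mulr1.
have hw : p ^+ a.+1 * Q ^+ a.+1 = 1 by rewrite exprVn mulVf // !expf_neq0.
have -> : qff p a.+1 = qff p a * (- p ^+ a.+1 * (1 - Q ^+ a.+1)).
  by rewrite qffS; congr (_ * _); rewrite mulrBr mulr1 mulNr hw opprK addrC.
have -> : 'C(a.+2, 2) = (a.+1 + 'C(a.+1, 2))%N by rewrite binS bin1 addnC.
by rewrite qffS IH exprD [(-1) ^+ a.+1]exprS /br -exprnP; pring.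
Qed.

Lemma gbin_inv a l : (l <= a)%N -> gbin p a l = p ^+ (l * (a - l)) * gbin Q a l.
Proof.
move=> la; have Qn := sqr_nroot q_nroot.
have f0 b : qff Q b != 0 by apply: qff_neq0; rewrite ?expf_neq0.
have h : qff p l * qff p (a - l) != 0.
  by rewrite mulf_neq0 // qff_neq0 //; exact: p_nroot.
apply: (mulIf h); rewrite gbin_fact // !qff_inv -(gbin_fact Q la).
have -> : 'C(a.+1, 2) = ('C(l.+1, 2) + 'C((a - l).+1, 2) + l * (a - l))%N.
  have B1 x : 'C(x.+1, 2) = ('C(x, 2) + x)%N by rewrite binS bin1.
  by rewrite -{1}(subnKC la) !B1 binD2; lia.
by rewrite -{1}(subnKC la) !exprD; pring.
Qed.

(** The factors are converted one by one from base 1/Q to base Q. Writing (xG)_l as (xG)_(r+i)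
    divided by a product of length r + i - l is the origin of the quotient in the summand. The
    factor q^(-4 l i) is the share of l_i in the squared Vandermonde product. *)
Lemma reg_wt_paper l i : (i < s)%N -> (l <= r + i)%N ->
  reg_wt p xc xD xE y r s l (s.-1 - i) * q ^ (- (4 * l%:Z * i%:Z)) =
  reg_cst i * (q ^ ((N%:Z + n%:Z + e%:Z - 2 * (2 * i.+1%:Z - 1)) * l%:Z) *
    (gbin Q d l * qpo Q (q ^ (2 - N%:Z - n%:Z - e%:Z)) l *
    qpo Q (q ^ (n%:Z + m%:Z - r%:Z - 2 * i%:Z - 1 + e%:Z)) (r + i - l) *
    (qpo Q (q ^ (N%:Z - m%:Z - r%:Z - 2 * i%:Z)) (r + i - l) /
     qpo Q (q ^ (N%:Z + m%:Z - r%:Z - 2 * i%:Z)) (r + i - l)))).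
Proof.
move=> is_ li; set cnt := (r + i - l)%N.
have cntE : (d - l - (s.-1 - i) = cnt)%N by rewrite /cnt; lia.
have ld : (l <= d)%N by lia.
have GE : xG = q ^ (N%:Z + m%:Z + r%:Z - 2).
  rewrite /xc /xD /iE /ic /z pexpVE exprnP exprz_exp invr_expz -!expfzDr //; apply: exprz_eq; lia.
have h1 : qpo p xG (r + i) = qpo p xG l * qpo Q (q ^ (N%:Z + m%:Z - r%:Z - 2 * i%:Z)) cnt.
  have -> : (r + i = l + cnt)%N by rewrite /cnt; lia.
  rewrite qpo_add GE pexpE -expfzDr // [X in _ * X = _]qpo_fall qpo_Q; congr (_ * _).
  rewrite (reindex_inj rev_ord_inj); apply: eq_bigr => h _; congr br.
  by have := ltn_ord h; rewrite /cnt /=; lia.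
have den0 : qpo Q (q ^ (N%:Z + m%:Z - r%:Z - 2 * i%:Z)) cnt != 0.
  rewrite qpo_Q; apply/prodf_neq0 => h _; apply: br_neq0 => //; lia.
have h2 : qpo p (xD * p ^+ l) cnt = qpo Q (q ^ (N%:Z - m%:Z - r%:Z - 2 * i%:Z)) cnt.
  have -> : xD * p ^+ l = q ^ (N%:Z + r%:Z - 2 - m%:Z - 2 * l%:Z).
    rewrite /xD /iE /z pexpE invr_expz -!expfzDr //; apply: exprz_eq; lia.
  rewrite qpo_fall qpo_Q (reindex_inj rev_ord_inj); apply: eq_bigr => h _; congr br.
  by have := ltn_ord h; rewrite /cnt /=; lia.
have brN a : br q (- a) = - q ^ (- a) * br q a.
  by rewrite /br mulrBr mulr1 mulNr -expfzDr // addNr expr0z opprK addrC.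
have flip (a : int) t : \prod_(h < t) br q (- (a + (2 * h)%:Z)) =
   (-1) ^+ t * q ^ (- (a * t%:Z + t%:Z * (t%:Z - 1))) * \prod_(h < t) br q (a + (2 * h)%:Z).
  elim: t => [|t IH]; first by rewrite !big_ord0 mulr0 mul0r oppr0 expr0z !mulr1.
  rewrite !big_ord_recr /= IH brN.
  have -> : q ^ (- (a * t.+1%:Z + t.+1%:Z * (t.+1%:Z - 1))) =
     q ^ (- (a * t%:Z + t%:Z * (t%:Z - 1))) * q ^ (- (a + (2 * t)%N%:Z)).
    by rewrite -expfzDr //; apply: exprz_eq; lia.
  by rewrite exprS; pring.
have h3 : qpo p (xE / y * p ^+ (s.-1 - i)) cnt =
   (-1) ^+ cnt * q ^ (- ((n%:Z + m%:Z - r%:Z - 2 * i%:Z - 1 + e%:Z) * cnt%:Z + cnt%:Z * (cnt%:Z - 1))) *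
   qpo Q (q ^ (n%:Z + m%:Z - r%:Z - 2 * i%:Z - 1 + e%:Z)) cnt.
  have -> : xE / y * p ^+ (s.-1 - i) = q ^ (- (n%:Z + m%:Z - r%:Z - 2 * i%:Z - 1 + e%:Z)).
    rewrite /xE /iE /y /z pexpE !invr_expz -!expfzDr //; apply: exprz_eq; lia.
  by rewrite qpo_fall qpo_Q -flip; apply: eq_bigr => h _; congr br; lia.
have h4 : qpo p (y * p ^- s.-1) l =
   (-1) ^+ l * q ^ (- ((2 - N%:Z - n%:Z - e%:Z) * l%:Z + l%:Z * (l%:Z - 1))) * qpo Q (q ^ (2 - N%:Z - n%:Z - e%:Z)) l.
  have -> : y * p ^- s.-1 = q ^ (- (2 - N%:Z - n%:Z - e%:Z)).
    rewrite /y pexpVE -!expfzDr //; apply: exprz_eq; lia.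
  by rewrite qpo_fall qpo_Q -flip; apply: eq_bigr => h _; congr br; lia.
have sg : (-1) ^+ l * (-1) ^+ cnt = (-1) ^+ (r + i) :> K.
  by rewrite -exprD; congr (_ ^+ _); rewrite /cnt; lia.
have pw : p ^+ (l * (d - l)) * (xE / y) ^+ l * q ^ (- ((2 - N%:Z - n%:Z - e%:Z) * l%:Z + l%:Z * (l%:Z - 1))) *
   q ^ (- ((n%:Z + m%:Z - r%:Z - 2 * i%:Z - 1 + e%:Z) * cnt%:Z + cnt%:Z * (cnt%:Z - 1))) * q ^ (- (4 * l%:Z * i%:Z)) =
   q ^ (- ((n%:Z + m%:Z - r%:Z - 2 * i%:Z - 1 + e%:Z) * (r + i)%N%:Z + (r + i)%N%:Z * ((r + i)%N%:Z - 1))) *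
   q ^ ((N%:Z + n%:Z + e%:Z - 2 * (2 * i.+1%:Z - 1)) * l%:Z).
  have -> : xE / y = q ^ (iE - m%:Z - (2 * n)%N%:Z).
    rewrite /xE /y /z !invr_expz -!expfzDr //; apply: exprz_eq; lia.
  rewrite [(q ^ _) ^+ l]exprnP exprz_exp pexpE -!expfzDr //; apply: exprz_eq.
  have -> : (2 * (l * (d - l)))%N%:Z = 2 * l%:Z * (r%:Z + s%:Z - 1 - l%:Z) by rewrite !PoszM (_ : (d - l)%N%:Z = r%:Z + s%:Z - 1 - l%:Z); [ring | lia].
  have -> : cnt%:Z = r%:Z + i%:Z - l%:Z by rewrite /cnt; lia.
  rewrite /iE PoszD; have -> : N%:Z = n%:Z + 2 * s%:Z - e%:Z by lia.
  lia.
rewrite /reg_wt cntE gbin_inv // h2 h3 h4 /reg_cst h1 -sg.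
transitivity ((p ^+ (l * (d - l)) * (xE / y) ^+ l * q ^ (- ((2 - N%:Z - n%:Z - e%:Z) * l%:Z + l%:Z * (l%:Z - 1))) *
   q ^ (- ((n%:Z + m%:Z - r%:Z - 2 * i%:Z - 1 + e%:Z) * cnt%:Z + cnt%:Z * (cnt%:Z - 1))) * q ^ (- (4 * l%:Z * i%:Z))) *
   ((-1) ^+ l * (-1) ^+ cnt * gbin Q d l * qpo Q (q ^ (2 - N%:Z - n%:Z - e%:Z)) l * qpo p xG l *
    qpo Q (q ^ (N%:Z - m%:Z - r%:Z - 2 * i%:Z)) cnt *
    qpo Q (q ^ (n%:Z + m%:Z - r%:Z - 2 * i%:Z - 1 + e%:Z)) cnt)).
  by pring.
rewrite pw; move: den0; gen_pow => den0; field.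
exact: den0.
Qed.

Lemma prod_pairs t (g : nat -> K) :
  \prod_(i < t) \prod_(j < t | (i < j)%N) g j = \prod_(j < t) g j ^+ j.
Proof.
rewrite (exchange_big_dep xpredT) //=; apply: eq_bigr => j _.
by rewrite -(big_ord_widen t (fun=> g j)) 1?ltnW // prodr_const card_ord.
Qed.

(** For i < j, p^(l_j) - p^(l_i) = p^(l_j) (1 - Q^(l_j - l_i)); since l_j is the larger member in j
    pairs, the square carries q^(-4 j l_j), which [reg_wt_paper] absorbs. *)
Lemma reg_sum_paper :
  reg_sum p xc xD xE y r s = (\prod_(i < s) reg_cst i) * (1 - Q) ^+ (2 * 'C(s, 2)) *
  \sum_(l : s.-tuple 'I_(r + s) | sorted ltn [seq val x | x <- l]) paper_term l.
Proof.
rewrite /reg_sum big_distrr; apply: eq_bigr => l sl /=.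
have Q1 : 1 - Q != 0 by rewrite subr_eq0 eq_sym q_nroot.
have vE : vdm s (fun i => p ^+ lv l i) ^+ 2 = (1 - Q) ^+ (2 * 'C(s, 2)) * (\prod_(j < s) q ^ (- (4 * (lv l j)%:Z * j%:Z))) *
   \prod_(i < s) \prod_(j < s | (i < j)%N) ((1 - Q ^+ (lv l j - lv l i)) / (1 - Q)) ^+ 2.
  have -> : \prod_(j < s) q ^ (- (4 * (lv l j)%:Z * j%:Z)) = \prod_(j < s) (q ^ (- (4 * (lv l j)%:Z))) ^+ j.
    by apply: eq_bigr => j _; rewrite exprnP exprz_exp; congr (_ ^ _); lia.
  have -> : (1 - Q) ^+ (2 * 'C(s, 2)) = \prod_(j < s) ((1 - Q) ^+ 2) ^+ j.
    by rewrite -triangular_sum big_mkord exprM expr_sum.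
  rewrite -(prod_pairs s (fun j => q ^ (- (4 * (lv l j)%:Z)))) -(prod_pairs s (fun=> (1 - Q) ^+ 2)).
  rewrite -!big_split -prodrXl; apply: eq_bigr => i _; rewrite -!big_split -prodrXl; apply: eq_bigr => j ij /=.
  have lij : (lv l i < lv l j)%N.
    by apply: (sorted_ltn_nth ltn_trans 0%N sl) => //; rewrite inE size_map size_tuple.
  have -> : p ^+ lv l j - p ^+ lv l i = p ^+ lv l j * (1 - Q ^+ (lv l j - lv l i)).
    rewrite mulrBr mulr1; congr (_ - _); rewrite -{1}(subnK (ltnW lij)) exprD mulrAC [p ^+ (_ - _)]exprVn.
    by rewrite mulVf ?mul1r // !expf_neq0.
  have -> : q ^ (- (4 * (lv l j)%:Z)) = (p ^+ lv l j) ^+ 2.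
    by rewrite pexpE exprnP exprz_exp; apply: exprz_eq; lia.
  by have := expf_neq0 2 Q1; rewrite expr_div_n exprMn; gen_pow => Q2; field.
rewrite vE /paper_term.
transitivity ((1 - Q) ^+ (2 * 'C(s, 2)) * (\prod_(i < s) \prod_(j < s | (i < j)%N) ((1 - Q ^+ (lv l j - lv l i)) / (1 - Q)) ^+ 2) *
   \prod_(i < s) (reg_wt p xc xD xE y r s (lv l i) (s.-1 - i) * q ^ (- (4 * (lv l i)%:Z * i%:Z)))).
  by rewrite (big_split _ _ _ (fun i : 'I_s => reg_wt p xc xD xE y r s (lv l i) (s.-1 - i))) /=; pring.
rewrite [X in _ * X = _](eq_bigr (fun i : 'I_s => reg_cst i * (q ^ ((N%:Z + n%:Z + e%:Z - 2 * (2 * i.+1%:Z - 1)) * (lv l i)%:Z) *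
    (gbin Q d (lv l i) * qpo Q (q ^ (2 - N%:Z - n%:Z - e%:Z)) (lv l i) *
    qpo Q (q ^ (n%:Z + m%:Z - r%:Z - 2 * i%:Z - 1 + e%:Z)) (r + i - lv l i) *
    (qpo Q (q ^ (N%:Z - m%:Z - r%:Z - 2 * i%:Z)) (r + i - lv l i) /
     qpo Q (q ^ (N%:Z + m%:Z - r%:Z - 2 * i%:Z)) (r + i - lv l i)))))) => [|i _].
  by rewrite (big_split _ _ _ (fun i : 'I_s => reg_cst i)) (big_split _ _ _ (fun i : 'I_s => q ^ ((N%:Z + n%:Z + e%:Z - 2 * (2 * i.+1%:Z - 1)) * (lv l i)%:Z))) /=; pring.
apply: reg_wt_paper => //; have := lv_bound sl (ltn_ord i).
by have := ltn_ord i; lia.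
Qed.

(** * Closed forms of the factors outside the sum *)

Lemma prod_exprzx (x : K) t (f : nat -> int) : x != 0 -> \prod_(i < t) x ^ f i = x ^ (\sum_(i < t) f i).
Proof.
move=> x0; elim: t => [|t IH]; first by rewrite !big_ord0 expr0z.
by rewrite !big_ord_recr /= IH expfzDr.
Qed.

Lemma prod_exprz t (f : nat -> int) : \prod_(i < t) q ^ f i = q ^ (\sum_(i < t) f i).
Proof. exact: prod_exprzx. Qed.

Lemma vdm_pow t a : vdm t (fun i => p ^+ (a + i)) =
  q ^ (\sum_(j < t) - (2 * (a + j)%N%:Z * j%:Z)) * \prod_(j < t) qff Q j.
Proof.
rewrite -(prod_exprz t (fun j => - (2 * (a + j)%N%:Z * j%:Z))) -big_split /vdm /=.
rewrite (exchange_big_dep xpredT) //=; apply: eq_bigr => j _.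
rewrite -(big_ord_widen t (fun i => p ^+ (a + j) - p ^+ (a + i))) 1?ltnW //.
have -> : q ^ (- (2 * (a + j)%N%:Z * j%:Z)) = \prod_(i < j) p ^+ (a + j).
  by rewrite prodr_const card_ord pexpE exprnP exprz_exp; apply: exprz_eq; rewrite PoszM; ring.
rewrite /qff (reindex_inj rev_ord_inj) -big_split; apply: eq_bigr => i _ /=.
have ij := ltn_ord i; rewrite /br mulrBr mulr1 -exprnP; congr (_ - _).
have {1}-> : (a + j = a + (j - i.+1) + i.+1)%N by lia.
by rewrite [p ^+ (_ + i.+1)]exprD -mulrA -exprMn mulVf ?expr1n ?mulr1 // expf_neq0.
Qed.

Let Qn := sqr_nroot q_nroot.
Lemma qffQ_neq0 a : qff Q a != 0. Proof. exact: qff_neq0. Qed.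

Lemma vweight_E i : (i < s)%N -> vweight p d (r + i) =
  (-1) ^+ (r + i) * q ^ ((r + i)%N%:Z * (r + i)%N%:Z - (r + i)%N%:Z) *
  (qff Q d / (qff Q (r + i) * qff Q (s.-1 - i))).
Proof.
move=> is_; have ld : (r + i <= d)%N by lia.
have -> : qff Q d / (qff Q (r + i) * qff Q (s.-1 - i)) = gbin Q d (r + i).
  have -> : (s.-1 - i = d - (r + i))%N by lia.
  by rewrite -(gbin_fact Q ld) mulfK // mulf_neq0 ?qffQ_neq0.
rewrite /vweight gbin_inv // -!mulrA; congr (_ * _); rewrite !mulrA; congr (_ * _).
have B2 (x : nat) : (2 * 'C(x, 2))%N%:Z = x%:Z * x%:Z - x%:Z.
  by rewrite mul2n -addnn bin2_double; case: x => [|x] //=; lia.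
rewrite pexpVE !pexpE -!expfzDr //; apply: exprz_eq; rewrite B2 !PoszM.
case: (posnP d) => [d0|d_gt0].
  by have -> : (r + i = 0)%N; lia.
have -> : d.-1%:Z = d%:Z - 1 by lia.
have -> : (d - (r + i))%N%:Z = d%:Z - (r + i)%N%:Z by lia.
by ring.
Qed.

Lemma qff_rise (x : K) a t : qff x a * \prod_(h < t) br x (a + h).+1 = qff x (a + t).
Proof.
elim: t => [|t IH]; first by rewrite big_ord0 mulr1 addn0.
by rewrite big_ord_recr /= mulrA IH addnS qffS.
Qed.

(** Here and in the next three lemmas a run of consecutive factors completes a shorter factorial to
    a longer one, by [qff_rise]. *)
Lemma y_factor :
  (\prod_(k0 < s) \prod_(k0.+1 <= h < s) (1 - y * p ^- h)) * (\prod_(i < s) qff Q (n + i)) = qff Q (n + s).-1 ^+ s.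
Proof.
rewrite -[X in _ = _ ^+ X]card_ord -prodr_const -big_split; apply: eq_bigr => i _ /=.
have is_ := ltn_ord i; rewrite mulrC.
have -> : ((n + s).-1 = n + i + (s - i.+1))%N by lia.
rewrite -[RHS]qff_rise; congr (_ * _).
rewrite -{1}[i.+1]add0n big_addn big_mkord; apply: eq_bigr => h _.
by rewrite /y pexpVE -expfzDr // br_sqr /br; congr (1 - _); apply: exprz_eq; lia.
Qed.

(** By [qpo_fall2], (xE)_l (xD)_l is a descending run of 2l factors starting at 1 - q^(N+r-1-m). The
    power r on the right, and the one in [col_factor], cancel those in [col_cst_factor]. *)
Lemma row_factor : (\prod_(l < r) (qpo p xE l * qpo p xD l)) * (\prod_(i < r) qff q (N + i.*2.+1 - (m + r))) =
  qff q (N + r - 1 - m) ^+ r.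
Proof.
rewrite [X in _ * X](reindex_inj rev_ord_inj) -[X in _ = _ ^+ X]card_ord -prodr_const -big_split.
apply: eq_bigr => l _ /=; have lr := ltn_ord l; have mr := mN (leq_ltn_trans (leq0n _) lr).
have -> : xE = q ^ (N%:Z + r%:Z - 1 - m%:Z) by rewrite /xE /z invr_expz -expfzDr.
have -> : xD = q ^ (N%:Z + r%:Z - 1 - m%:Z - 1).
  by rewrite /xD /z invr_expz -expfzDr //; apply: exprz_eq; rewrite /iE; lia.
rewrite qpo_fall2 mulrC.
have -> : (N + r - 1 - m = (N + (r - l.+1).*2.+1 - (m + r)) + 2 * l)%N by lia.
rewrite -[RHS]qff_rise; congr (_ * _); rewrite [RHS](reindex_inj rev_ord_inj).
by apply: eq_bigr => h _; congr br; have := ltn_ord h; rewrite /=; lia.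
Qed.

Lemma col_factor : (\prod_(s <= l < r + s) qpo p^-1 (xc * p ^- l) (d - l)) * (\prod_(i < r) qff Q (m + i)) =
  qff Q (m + r).-1 ^+ r.
Proof.
rewrite -{1}[s]add0n big_addn addnK big_mkord -[X in _ = _ ^+ X]card_ord -prodr_const -big_split.
apply: eq_bigr => l _ /=; have lr := ltn_ord l; rewrite mulrC.
have -> : ((m + r).-1 = m + l + (d - (l + s)))%N by lia.
rewrite -[RHS]qff_rise; congr (_ * _).
have -> : xc * p ^- (l + s) = q ^ (2 * (m%:Z + l%:Z + 1)).
  by rewrite /xc /z pexpVE exprnP exprz_exp -!expfzDr //; apply: exprz_eq; rewrite /ic; lia.
by rewrite qpo_rise; apply: eq_bigr => h _; rewrite br_sqr; congr br; lia.
Qed.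

Lemma uv_factor : (\prod_(j < r) qff q (n + m - e - j)) * (\prod_(1 <= i < r) \prod_(i <= k0 < r) (1 - u k0 * v i)) =
  \prod_(i < r) qff q (n + m - e + i.*2.+1 - r).
Proof.
have -> : \prod_(1 <= i < r) \prod_(i <= k0 < r) (1 - u k0 * v i) =
  \prod_(i < r) \prod_(i.+1 <= k0 < r) (1 - u k0 * v i.+1).
  case: r => [|r']; first by rewrite big_geq // big_ord0.
  by rewrite big_ord_recr /= [X in _ * X]big_geq // mulr1 big_add1 /= big_mkord.
rewrite [RHS](reindex_inj rev_ord_inj) -big_split; apply: eq_bigr => i _ /=.
have ir := ltn_ord i.
have -> : (n + m - e + (r - i.+1).*2.+1 - r = (n + m - e - i) + (r - i.+1))%N by lia.
rewrite -[RHS]qff_rise; congr (_ * _).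
rewrite -{1}[i.+1]add0n big_addn big_mkord; apply: eq_bigr => h _.
rewrite /u /v /iu /iv /z mulrA exprnP exprz_exp invr_expz -!expfzDr // /br; congr (1 - _); apply: exprz_eq.
by lia.
Qed.

Lemma xD_factor : \prod_(k0 < s) \prod_(i < k0) (xD * p ^- i.+1) =
  q ^ (\sum_(k0 < s) (k0%:Z * (N%:Z + r%:Z - 2 - m%:Z) + k0%:Z * (k0%:Z + 1))).
Proof.
rewrite -(prod_exprz s (fun k0 => k0%:Z * (N%:Z + r%:Z - 2 - m%:Z) + k0%:Z * (k0%:Z + 1))).
apply: eq_bigr => k0 _; elim: (k0 : nat) => [|a IH]; first by rewrite big_ord0 !mul0r expr0z.
rewrite big_ord_recr /= IH pexpVE /xD /z invr_expz -!expfzDr //; apply: exprz_eq; rewrite /iE; lia.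
Qed.

(** Split each (xG)_(r+i) after i factors and exchange the order in the rest. The product of the
    (xG)_i is exactly the one on the left of [det_x_mx_all], where it cancels. *)
Lemma G_factor : \prod_(i < s) qpo p xG (r + i) =
  (\prod_(i < s) qpo p xG i) * \prod_(i < r) qpo Q (q ^ (n%:Z + m%:Z - r%:Z + 2 * i%:Z + 2 - e%:Z)) s.
Proof.
(* For s = 0 the truncated [s.-1] gives [xG] another value, but then all products over i < s are
   empty. *)
have GE : xG = q ^ (N%:Z + m%:Z + r%:Z - 2) \/ s = 0%N.
  case: (posnP s) => [|s0]; [by right | left].
  rewrite /xc /xD /iE /ic /z pexpVE exprnP exprz_exp invr_expz -!expfzDr //; apply: exprz_eq; lia.
case: GE => [GE|s0]; last first.
  rewrite s0 !big_ord0 mul1r big1 // => i _; exact: big_ord0.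
transitivity (\prod_(i < s) (qpo p xG i * \prod_(h < r) br q (N%:Z + m%:Z + r%:Z - 2 - (2 * (i + h))%N%:Z))).
  apply: eq_bigr => i _; rewrite [(r + i)%N]addnC qpo_add; congr (_ * _).
  rewrite GE pexpE -expfzDr // qpo_fall; apply: eq_bigr => h _; congr br; lia.
rewrite big_split /=; congr (_ * _); rewrite (exchange_big_dep xpredT) //=.
rewrite (reindex_inj rev_ord_inj); apply: eq_bigr => h _; rewrite qpo_Q.
rewrite (reindex_inj rev_ord_inj); apply: eq_bigr => i _; congr br.
by have := ltn_ord h; have := ltn_ord i; rewrite /=; lia.
Qed.

Lemma odd_factor : \prod_(l < P) oddp q (P - e - l) =
  (\prod_(i < n) oddp q (s + i.+1 - e)) * \prod_(i < s) oddp q (P - e - (n + i)).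
Proof.
have -> : \prod_(l < P) oddp q (P - e - l) = \prod_(l < n + s) oddp q (P - e - l).
  by have -> : (P = n + s)%N by lia.
rewrite (prod_ordD n s (fun l => oddp q (P - e - l))); congr (_ * _).
rewrite (reindex_inj rev_ord_inj); apply: eq_bigr => i _; congr oddp.
by have := ltn_ord i; rewrite /=; lia.
Qed.

Lemma reg_cst_factor : \prod_(i < s) reg_cst i = (\prod_(i < s) (-1) ^+ (r + i)) *
  q ^ (\sum_(i < s) - ((n%:Z + m%:Z - r%:Z - 2 * i%:Z - 1 + e%:Z) * (r + i)%N%:Z + (r + i)%N%:Z * ((r + i)%N%:Z - 1))) *
  \prod_(i < s) qpo p xG (r + i).
Proof.
by rewrite -(prod_exprz s (fun i => - ((n%:Z + m%:Z - r%:Z - 2 * i%:Z - 1 + e%:Z) * (r + i)%N%:Z + (r + i)%N%:Z * ((r + i)%N%:Z - 1))))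
  -!big_split.
Qed.

Let B2 (x : nat) : (2 * 'C(x, 2))%N%:Z = x%:Z * x%:Z - x%:Z.
Proof. by rewrite mul2n -addnn bin2_double; case: x => [|x] //=; lia. Qed.

Lemma col_cst_factor : \prod_(j < r) col_cst j =
  (\prod_(j < r) qff q (n + m - e - j)) / (qff q (N + r - 1 - m) ^+ r * qff Q (m + r).-1 ^+ r) *
  q ^ (\sum_(j < r) 'C(N + j - m, 2)%:Z).
Proof.
rewrite -(prod_exprz r (fun j => 'C(N + j - m, 2)%:Z)) -[X in _ ^+ X * _]card_ord -[X in _ * _ ^+ X]card_ord.
rewrite -!prodr_const -big_split -prodf_div -big_split /=.
apply: eq_bigr => j _; have jr := ltn_ord j; have mr := mN (leq_ltn_trans (leq0n _) jr).
rewrite /col_cst -exprnP.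
have -> : N%:Z - m%:Z + r%:Z - 1 = (N + r - 1 - m)%N by lia.
have -> : m%:Z + r%:Z - 1 = (m + r).-1 by lia.
by rewrite /= invfM; pring.
Qed.

Lemma phi_cst_factor : \prod_(i < s) phi_cst i =
  (\prod_(i < s) (-1) ^+ (n + i)) * q ^ (\sum_(i < s) ((n + i)%N%:Z * (n + i)%N%:Z - (n + i)%N%:Z)) *
  ((\prod_(i < s) oddp q (P - e - (n + i))) / \prod_(i < s) qff Q (n + i)).
Proof.
rewrite -(prod_exprz s (fun i => (n + i)%N%:Z * (n + i)%N%:Z - (n + i)%N%:Z)) -prodf_div -!big_split.
by apply: eq_bigr => i _; rewrite /phi_cst /= [q ^+ (2 * _)]exprnP B2 !mulrA.
Qed.

Lemma reg_lhs_factor : reg_lhs_cst p y r s =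
  (q ^ (\sum_(j < s) - (2 * (r + j)%N%:Z * j%:Z)) * q ^ (\sum_(i < s) ((r + i)%N%:Z * (r + i)%N%:Z - (r + i)%N%:Z))) *
  (\prod_(i < s) (-1) ^+ (r + i)) * (qff Q d ^+ s / \prod_(i < s) qff Q (r + i)) *
  (qff Q (n + s).-1 ^+ s / \prod_(i < s) qff Q (n + i)).
Proof.
have nz (f : nat -> nat) t : \prod_(i < t) qff Q (f i) != 0.
  by apply/prodf_neq0 => i _; apply: qffQ_neq0.
rewrite /reg_lhs_cst vdm_pow -y_factor mulfK //.
have -> : \prod_(i < s) vweight p d (r + i) = (\prod_(i < s) (-1) ^+ (r + i)) *
   q ^ (\sum_(i < s) ((r + i)%N%:Z * (r + i)%N%:Z - (r + i)%N%:Z)) *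
   (qff Q d ^+ s / ((\prod_(i < s) qff Q (r + i)) * \prod_(i < s) qff Q i)).
  rewrite [\prod_(i < s) qff Q i](reindex_inj rev_ord_inj).
  rewrite -(prod_exprz s (fun i => (r + i)%N%:Z * (r + i)%N%:Z - (r + i)%N%:Z)) -[X in _ ^+ X / _]card_ord -prodr_const.
  rewrite -[\prod_(i < s) qff Q (r + i) * _]big_split -prodf_div -!big_split.
  apply: eq_bigr => i _; rewrite vweight_E ?ltn_ord //=.
  by have -> : (s.-1 - i = s - i.+1)%N by lia.
have q1 : \prod_(i < s) qff Q i != 0 := nz id s.
have q2 : \prod_(i < s) qff Q (r + i) != 0 := nz (addn r) s.
move: q1 q2; gen_pow => q1 q2; field; rewrite q1 q2 //.
Qed.

(** The total exponent of q, one sum for each factor evaluated above; the last two sums come from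
    the left side of [det_x_mx_all]. *)
Definition det_expt : int :=
  \sum_(b < k) 'C(n - e - r - b, 2)%:Z +
  \sum_(l < r + s) (2 * l%:Z * l%:Z + l%:Z - 2 * l%:Z * (N%:Z - m%:Z)) +
  \sum_(j < r) 'C(N + j - m, 2)%:Z +
  \sum_(i < s) ((n + i)%N%:Z * (n + i)%N%:Z - (n + i)%N%:Z) +
  \sum_(j < r) - (2 * (0 + j)%N%:Z * j%:Z) +
  \sum_(k0 < s) (k0%:Z * (N%:Z + r%:Z - 2 - m%:Z) + k0%:Z * (k0%:Z + 1)) +
  \sum_(i < s) - ((n%:Z + m%:Z - r%:Z - 2 * i%:Z - 1 + e%:Z) * (r + i)%N%:Z + (r + i)%N%:Z * ((r + i)%N%:Z - 1)) -
  \sum_(j < s) - (2 * (r + j)%N%:Z * j%:Z) -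
  \sum_(i < s) ((r + i)%N%:Z * (r + i)%N%:Z - (r + i)%N%:Z).

Lemma sign_factor : \prod_(i < s) (-1) ^+ (n + i) = (-1) ^+ ('C(s, 2) + r * s) * (-1) ^+ (s * k) :> K.
Proof.
rewrite -expr_sum big_split /= sum_nat_const card_ord -(big_mkord xpredT id) triangular_sum -exprD.
by rewrite -signr_odd -[RHS]signr_odd nE; congr (_ ^+ nat_of_bool _); rewrite -(mulnC k) mulnDr; lia.
Qed.

Lemma det_skew_eval :
  \det (\matrix_(i < n, j < n) skew_entry i j) *
    ((\prod_(i < n) oddp q (s + i.+1 - e)) * qff Q d ^+ s * qff Q (n + s).-1 ^+ s *
     (\prod_(i < r) qff Q (m + i)) * \prod_(i < r) qff q (N + i.*2.+1 - (m + r))) =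
  (-1) ^+ ('C(s, 2) + r * s) * q ^ det_expt * (1 - Q) ^+ (2 * 'C(s, 2)) *
  ((\prod_(i < r) qff q (n + m - e + i.*2.+1 - r)) *
   (\prod_(i < r) qpo Q (q ^ (n%:Z + m%:Z - r%:Z + 2 * i%:Z + 2 - e%:Z)) s) *
   ((\prod_(i < r) qff Q i) * \prod_(i < s) qff Q (r + i))) *
  \sum_(l : s.-tuple 'I_(r + s) | sorted ltn [seq val x | x <- l]) paper_term l.
Proof.
have nz (f : nat -> nat) t : \prod_(i < t) qff Q (f i) != 0.
  by apply/prodf_neq0 => i _; apply: qffQ_neq0.
have nzq (f : nat -> nat) t : \prod_(i < t) qff q (f i) != 0.
  by apply/prodf_neq0 => i _; apply: qff_neq0.
have od0 (f : nat -> nat) t : \prod_(i < t) oddp q (f i) != 0.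
  apply/prodf_neq0 => i _; apply/prodf_neq0 => h _; rewrite subr_eq0 eq_sym; exact: q_nroot.
have sg0 (f : nat -> nat) t : \prod_(i < t) (-1) ^+ f i != 0 :> K.
  by apply/prodf_neq0 => i _; rewrite signr_eq0.
have GK0 : \prod_(i < s) qpo p xG i != 0.
  apply/prodf_neq0 => i _; have is_ := ltn_ord i.
  have -> : xG = q ^ (N%:Z + m%:Z + r%:Z - 2).
    rewrite /xc /xD /iE /ic /z pexpVE exprnP exprz_exp invr_expz -!expfzDr //; apply: exprz_eq; lia.
  rewrite qpo_fall; apply/prodf_neq0 => h _; apply: br_neq0 => //; have := ltn_ord h; lia.
have z0 : z != 0 by rewrite expfz_neq0.
have H1 := det_skew_v; rewrite odd_factor det_v_mx col_cst_factor phi_cst_factor sign_factor in H1.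
have H3 := det_x_mx_all q_neq0 q_nroot iE ic n r s iu iv z0; rewrite reg_lhs_factor in H3.
rewrite (vdm_pow r 0) in H3.
have h1 := row_factor; have h2 := col_factor; have h3 := uv_factor.
have hR := reg_sum_paper; rewrite reg_cst_factor G_factor in hR.
cbv beta in H3; rewrite xD_factor hR in H3.
have X1 := prod_exprz k (fun b => 'C(n - e - r - b, 2)%:Z).
have X2 := prod_exprz (r + s) (fun l => 2 * l%:Z * l%:Z + l%:Z - 2 * l%:Z * (N%:Z - m%:Z)).
rewrite (_ : \prod_(l < r + s) row_pow l = q ^ (\sum_(l < r + s) (2 * l%:Z * l%:Z + l%:Z - 2 * l%:Z * (N%:Z - m%:Z)))) in H1;
  last by rewrite -X2.
rewrite (_ : \prod_(b < k) q ^+ 'C(n - e - r - b, 2) = q ^ (\sum_(b < k) 'C(n - e - r - b, 2)%:Z)) in H1;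
  last by rewrite -X1.
have NR0 := expf_neq0 r (qff_neq0 q_nroot (N + r - 1 - m)).
have MR0 := expf_neq0 r (qffQ_neq0 (m + r).-1).
have Dd0 := expf_neq0 s (qffQ_neq0 d).
have Yn0 := expf_neq0 s (qffQ_neq0 (n + s).-1).
have NC0 := nzq (fun j => n + m - e - j)%N r.
have NN0 := nzq (fun i => N + i.*2.+1 - (m + r))%N r.
have MM0 := nz (fun i => m + i)%N r.
have QN0 := nz (fun i => n + i)%N s.
have QR0 := nz (fun i => r + i)%N s.
have on0 := od0 (fun i => s + i.+1 - e)%N n.
have os0 := od0 (fun i => P - e - (n + i))%N s.
have sr0 := sg0 (fun i => r + i)%N s.
have sk0 : (-1) ^+ (s * k) != 0 :> K by rewrite signr_eq0.
cbv beta in NC0, NN0, MM0, QN0, QR0, on0, os0, sr0.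
rewrite /det_expt !expfzDr // -2!invr_expz.
have [a1 a2] := (expfz_neq0 (\sum_(j < s) - (2 * (r + j)%N%:Z * j%:Z)) q_neq0,
   expfz_neq0 (\sum_(i < s) ((r + i)%N%:Z * (r + i)%N%:Z - (r + i)%N%:Z)) q_neq0).
set dX := \det (x_mx p xc xD xE y u v r s) in H1 H3.
set GK := \prod_(i < s) qpo p xG i in H3 GK0.
set KR := \prod_(1 <= i < r) _ in h3; rewrite -/KR in H3.
set R12 := \prod_(l < r) (_ * _) in h1; rewrite -/R12 in H3.
set C12 := \prod_(s <= l < r + s) _ in h2; rewrite -/C12 in H3.
set S := \sum_(l : s.-tuple _ | _) _ in H3 *.
have {h1}h1 := canRL (mulfK NN0) h1; have {h2}h2 := canRL (mulfK MM0) h2.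
rewrite h1 h2 in H3.
move: h3; rewrite mulrC => /(canRL (mulfK NC0)) h3; rewrite h3 in H3.
move: H1; rewrite mulrC => /(canRL (mulfK (mulf_neq0 (mulf_neq0 on0 os0) sk0))) ->.
have lhs0 : forall Y1 Y2 sr Dd QR Yn QN, Y1 != 0 -> Y2 != 0 -> sr != 0 -> Dd != 0 -> QR != 0 -> Yn != 0 -> QN != 0 ->
    GK * (Y1 * Y2 * sr * (Dd / QR) * (Yn / QN)) != 0 :> K.
  by move=> *; rewrite !mulf_neq0 ?invr_eq0.
rewrite -mulrA in H3; move/(canRL (mulfK (lhs0 _ _ _ _ _ _ _ a1 a2 sr0 Dd0 QR0 Yn0 QN0))): H3 => ->.
move: NR0 MR0 Dd0 Yn0 NC0 NN0 MM0 QN0 QR0 on0 os0 sr0 sk0 a1 a2 GK0.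
do 9 (match goal with |- context [q ^ ?a] => move: (q ^ a) end).
move: (GK) (S).
gen_pow; clear => *; field.
by do !(apply/andP; split).
Qed.

(** * The exponent of q *)

Lemma sum_poly2 (a b c : int) t : 6 * (\sum_(i < t) (a * (i%:Z * i%:Z) + b * i%:Z + c)) =
  a * (t%:Z * (t%:Z - 1) * (2 * t%:Z - 1)) + 3 * b * (t%:Z * (t%:Z - 1)) + 6 * c * t%:Z.
Proof.
elim: t => [|t IH]; first by rewrite big_ord0; ring.
by rewrite big_ord_recr /= mulrDr IH -[t.+1]addn1 PoszD; ring.
Qed.

Lemma sum_poly2E (f : nat -> int) (a b c : int) t :
  (forall i, (i < t)%N -> f i = a * (i%:Z * i%:Z) + b * i%:Z + c) ->
  6 * (\sum_(i < t) f i) =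
  a * (t%:Z * (t%:Z - 1) * (2 * t%:Z - 1)) + 3 * b * (t%:Z * (t%:Z - 1)) + 6 * c * t%:Z.
Proof.
by move=> fE; rewrite -sum_poly2; congr (_ * _); apply: eq_bigr => i _; apply: fE.
Qed.

Lemma bin3_poly t : 6 * 'C(t.+1, 3)%:Z = t.+1%:Z * t%:Z * (t%:Z - 1).
Proof.
elim: t => [|t IH] //; rewrite binS PoszD mulrDr IH.
have := B2 t.+1; rewrite PoszM => b2.
have -> : 6 * 'C(t.+1, 2)%:Z = 3 * (2%N%:Z * 'C(t.+1, 2)%:Z) by ring.
by rewrite b2 -[t.+2]addn2 -[t.+1]addn1 !PoszD; ring.
Qed.

(** All summands are quadratic polynomials in the index. The factor 12 clears the 6 of the sums of
    squares and the 2 of the binomials C(x,2); the final polynomial identity is checked for e = 0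
    and for e = 1. *)
Lemma det_exptE : 12 * det_expt =
  6 * m%:Z * r%:Z * (r%:Z + m%:Z - 2 * n%:Z + 2 * e%:Z) +
  12 * r%:Z * s%:Z * (s%:Z - n%:Z + 1 - e%:Z - m%:Z) + 12 * 'C(n.+1, 3)%:Z +
  12 * (N%:Z - n%:Z) * 'C(n, 2)%:Z + 12 * (N%:Z - n%:Z + e%:Z) * 'C(s, 2)%:Z.
Proof.
have dbl t (f : nat -> nat) : 12 * (\sum_(i < t) 'C(f i, 2)%:Z) = 6 * \sum_(i < t) ((f i)%:Z * (f i)%:Z - (f i)%:Z).
    have -> : 12 * \sum_(i < t) 'C(f i, 2)%:Z = 6 * (2 * \sum_(i < t) 'C(f i, 2)%:Z) by ring.
    by rewrite [2 * _]big_distrr; congr (6 * _); apply: eq_bigr => i _; rewrite -B2 PoszM.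
have E1 := dbl k (fun b => n - e - r - b)%N.
rewrite (sum_poly2E (f := fun b => ((n - e - r - b)%N%:Z * (n - e - r - b)%N%:Z - (n - e - r - b)%N%:Z))
    (a := 1) (b := - (2 * (k%:Z - e%:Z) - 1)) (c := (k%:Z - e%:Z) * (k%:Z - e%:Z - 1))) in E1; last first.
  by move=> i ik; have -> : (n - e - r - i)%N%:Z = k%:Z - e%:Z - i%:Z by [lia|]; ring.
have E2 := @sum_poly2E (fun l => 2 * l%:Z * l%:Z + l%:Z - 2 * l%:Z * (N%:Z - m%:Z)) 2 (1 - 2 * (N%:Z - m%:Z)) 0 (r + s)
  (fun i _ => ltac:(cbv beta; ring)).
have E3 := dbl r (fun j => N + j - m)%N.
rewrite (sum_poly2E (f := fun j => ((N + j - m)%N%:Z * (N + j - m)%N%:Z - (N + j - m)%N%:Z))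
    (a := 1) (b := 2 * (N%:Z - m%:Z) - 1) (c := (N%:Z - m%:Z) * (N%:Z - m%:Z - 1))) in E3; last first.
  move=> i ir; have mr := mN (leq_ltn_trans (leq0n _) ir).
  by have -> : (N + i - m)%N%:Z = N%:Z - m%:Z + i%:Z by [lia|]; ring.
have E4 := @sum_poly2E (fun i => (n + i)%N%:Z * (n + i)%N%:Z - (n + i)%N%:Z) 1 (2 * n%:Z - 1) (n%:Z * (n%:Z - 1)) s
  (fun i _ => ltac:(cbv beta; rewrite ?PoszD; ring)).
have E5 := @sum_poly2E (fun j => - (2 * (0 + j)%N%:Z * j%:Z)) (- 2) 0 0 r (fun i _ => ltac:(cbv beta; rewrite add0n; ring)).
have E6 := @sum_poly2E (fun k0 => k0%:Z * (N%:Z + r%:Z - 2 - m%:Z) + k0%:Z * (k0%:Z + 1)) 1 (N%:Z + r%:Z - 1 - m%:Z) 0 s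
  (fun i _ => ltac:(cbv beta; ring)).
have E7 := @sum_poly2E (fun i => - ((n%:Z + m%:Z - r%:Z - 2 * i%:Z - 1 + e%:Z) * (r + i)%N%:Z + (r + i)%N%:Z * ((r + i)%N%:Z - 1)))
  1 (- (n%:Z + m%:Z - r%:Z - 2 + e%:Z)) (- ((n%:Z + m%:Z - 2 + e%:Z) * r%:Z)) s
  (fun i _ => ltac:(cbv beta; rewrite ?PoszD; ring)).
have E8 := @sum_poly2E (fun j => - (2 * (r + j)%N%:Z * j%:Z)) (- 2) (- (2 * r%:Z)) 0 s (fun i _ => ltac:(cbv beta; rewrite ?PoszD; ring)).
have E9 := @sum_poly2E (fun i => (r + i)%N%:Z * (r + i)%N%:Z - (r + i)%N%:Z) 1 (2 * r%:Z - 1) (r%:Z * (r%:Z - 1)) s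
  (fun i _ => ltac:(cbv beta; rewrite ?PoszD; ring)).
have E10 := bin3_poly n.
have -> : 12 * (N%:Z - n%:Z) * 'C(n, 2)%:Z = 6 * (N%:Z - n%:Z) * (n%:Z * n%:Z - n%:Z) by rewrite -B2 PoszM; ring.
have -> : 12 * (N%:Z - n%:Z + e%:Z) * 'C(s, 2)%:Z = 6 * (N%:Z - n%:Z + e%:Z) * (s%:Z * s%:Z - s%:Z) by rewrite -B2 PoszM; ring.
have -> : 12 * 'C(n.+1, 3)%:Z = 2 * (n%:Z + 1) * n%:Z * (n%:Z - 1).
  have -> : 12 * 'C(n.+1, 3)%:Z = 2 * (6 * 'C(n.+1, 3)%:Z) by ring.
  by rewrite E10 -[n.+1]addn1 PoszD; ring.
rewrite /det_expt !(mulrDr, mulrN) E1 E3 (_ : 12%:R = 2 * 6) // -!(mulrA 2) E2 E4 E5 E6 E7 E8 E9.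
have -> : N%:Z = n%:Z + 2 * s%:Z - e%:Z by lia.
have -> : n%:Z = r%:Z + k%:Z by lia.
rewrite PoszD; have : e%:Z = 0 \/ e%:Z = 1 by lia.
clear; move: (e%:Z) (r%:Z) (s%:Z) (k%:Z) (m%:Z) => e' r' s' k' m' [->|->]; ring.
Qed.

(** * From q-shifted factorials to q-factorials *)

Definition qfac (x : K) (a : nat) : K := \prod_(i < a) ((1 - x ^+ i.+1) / (1 - x)).

Lemma qfacE x a : qfac x a = qff x a * (1 - x) ^ (- a%:Z).
Proof.
rewrite -exprnN -exprVn -[X in _ ^+ X]card_ord -prodr_const -big_split.
by apply: eq_bigr => i _.
Qed.

Lemma prod_qfac (x : K) t (f : nat -> nat) : 1 - x != 0 ->
  \prod_(i < t) qfac x (f i) = (\prod_(i < t) qff x (f i)) * (1 - x) ^ (- \sum_(i < t) (f i)%:Z).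
Proof.
move=> x1; rewrite -sumrN -(prod_exprzx t (fun i => - (f i)%:Z) x1) -big_split.
by apply: eq_bigr => i _; rewrite qfacE.
Qed.

(** The order N - n + 2i + 1 is 2(s + i) + 1 for e = 0 and 2(s + i) for e = 1. An even order is
    split by [qff_double]; an odd one is first completed by the factor 1 - q^(2(s+i+1)). *)
Lemma odd_even_split :
  \prod_(i < n) qff q (N - n + i.*2.+1) = (\prod_(i < n) oddp q (s + i.+1 - e)) * \prod_(i < n) qff Q (s + i).
Proof.
rewrite -big_split; apply: eq_bigr => i _ /=; case: e e1 NE es => [|[|//]] _ NE' es'.
  have b0 : br q (s + i.+1).*2 != 0 by apply: br_neq0; [exact: q_nroot | lia].
  apply: (mulIf b0); have -> : (N - n + i.*2.+1 = (s + i.+1).*2.-1)%N by lia.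
  have [a aE] : exists a, (s + i.+1).*2 = a.+1 by exists (s + i.+1).*2.-1; lia.
  rewrite aE -qffS -aE qff_double subn0 -!mulrA addnS qffS; congr (_ * (_ * _)).
  by rewrite br_sqr; congr br; lia.
have -> : (N - n + i.*2.+1 = (s + i).*2)%N by lia.
by rewrite qff_double; congr (oddp _ _ * _); lia.
Qed.

(** For e = 1 the first factor 1 - q^(n+m+2i+1-r) of the product in base Q moves into the
    q-factorial, which leaves a product of length s - 1. *)
Lemma shift_split :
  (\prod_(i < r) qff q (n + m + i.*2.+1 - r)) * (\prod_(i < r) qpo Q (q ^ (n + m + i.*2.+2 + e - r)%N%:Z) (s - e)) =
  (\prod_(i < r) qff q (n + m - e + i.*2.+1 - r)) *
   \prod_(i < r) qpo Q (q ^ (n%:Z + m%:Z - r%:Z + 2 * i%:Z + 2 - e%:Z)) s.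
Proof.
rewrite -!big_split; apply: eq_bigr => i _ /=; have ir := ltn_ord i.
case: e e1 es => [|[|//]] _ es'.
  rewrite !subn0; congr (qff _ _ * qpo _ (q ^ _) _); lia.
have -> : (n + m + i.*2.+1 - r = (n + m - 1 + i.*2.+1 - r).+1)%N by lia.
rewrite qffS -mulrA; congr (_ * _).
rewrite !qpo_Q //; case: s es' => [//|s'] _; rewrite subSS subn0 big_ord_recl; congr (_ * _).
  by congr br; rewrite /=; lia.
by apply: eq_bigr => h _; rewrite /= /bump /=; congr br; lia.
Qed.

(** The powers of 1 - x in [k]_x! = (x;x)_k / (1 - x)^k, collected over all factors. With 1 - Q = (1
    - q)(1 + q), the exponents of 1 - q and of 1 + q are compared separately; the hypothesis says
    that M is the number of cells. *)
Lemma norm_pow M : 2 * M%:Z = (N%:Z + 1) * N%:Z - (N%:Z - n%:Z + 1) * (N%:Z - n%:Z) - 2 * (m%:Z * r%:Z) ->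
  (1 + q) ^ ('C(n, 2)%:Z - 'C(s, 2)%:Z - (m * r)%N%:Z) * (1 - q) ^ (- 'C(s, 2)%:Z - r%:Z * (N%:Z - n%:Z)) *
  (1 - q) ^ (- M%:Z) * (1 - Q) ^ (- \sum_(i < n + s) i%:Z) * (1 - Q) ^ (- \sum_(i < r) (s + i)%N%:Z) *
  (1 - q) ^ (- \sum_(i < r) (n + m + i.*2.+1 - r)%N%:Z) =
  (1 - Q) ^+ (2 * 'C(s, 2)) * ((1 - Q) ^ (- d%:Z)) ^+ s * ((1 - Q) ^ (- (n + s).-1%:Z)) ^+ s *
  (1 - q) ^ (- \sum_(i < n) (N - n + i.*2.+1)%N%:Z) *
  (1 - Q) ^ (- \sum_(i < r) (m + i)%N%:Z) * (1 - q) ^ (- \sum_(i < r) (N + i.*2.+1 - (m + r))%N%:Z).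
Proof.
move=> E7; have a0 : 1 - q != 0 by have := q_nroot 0; rewrite subr_eq0 eq_sym.
have Q0 : 1 - Q != 0 by have := q_nroot 1; rewrite subr_eq0 eq_sym.
have QE : 1 - Q = (1 - q) * (1 + q) by ring.
have b0 : 1 + q != 0 by move: Q0; rewrite QE mulf_eq0 negb_or => /andP[].
have uM (f : int) : (1 - Q) ^ f = (1 - q) ^ f * (1 + q) ^ f by rewrite QE expfzMl.
have E1 := @sum_poly2E (fun i => i%:Z) 0 1 0 (n + s) (fun i _ => ltac:(cbv beta; ring)).
have E2 := @sum_poly2E (fun i => (s + i)%N%:Z) 0 1 s r (fun i _ => ltac:(cbv beta; rewrite ?PoszD; ring)).
have E3 := @sum_poly2E (fun i => (n + m + i.*2.+1 - r)%N%:Z) 0 2 (n%:Z + m%:Z + 1 - r%:Z) r (fun i ir => ltac:(cbv beta; have mr := mN (leq_ltn_trans (leq0n _) ir); lia)).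
have E4 := @sum_poly2E (fun i => (N - n + i.*2.+1)%N%:Z) 0 2 (N%:Z - n%:Z + 1) n (fun i ir => ltac:(cbv beta; lia)).
have E5 := @sum_poly2E (fun i => (m + i)%N%:Z) 0 1 m r (fun i ir => ltac:(cbv beta; have mr := mN (leq_ltn_trans (leq0n _) ir); lia)).
have E6 := @sum_poly2E (fun i => (N + i.*2.+1 - (m + r))%N%:Z) 0 2 (N%:Z + 1 - m%:Z - r%:Z) r (fun i ir => ltac:(cbv beta; have mr := mN (leq_ltn_trans (leq0n _) ir); lia)).
rewrite [(1 - Q) ^+ _]exprnP !exprnP !exprz_exp !uM.
have Hd : d%:Z * s%:Z = (r%:Z + s%:Z - 1) * s%:Z.
  by case: (posnP s) => [->|s0]; rewrite ?mulr0 //; congr (_ * _); lia.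
have Hn : (n + s).-1%:Z * s%:Z = (n%:Z + s%:Z - 1) * s%:Z.
  by case: (posnP s) => [->|s0]; rewrite ?mulr0 //; congr (_ * _); lia.
have Cs : 2 * 'C(s, 2)%:Z = s%:Z * s%:Z - s%:Z.
  by have := bin2_double s; case: (s) => [|s'] //=; lia.
have Cn : 2 * 'C(n, 2)%:Z = n%:Z * n%:Z - n%:Z.
  by have := bin2_double n; case: (n) => [|n'] //=; lia.
have NZ : N%:Z = n%:Z + 2 * s%:Z - e%:Z by lia.
have eZ : e%:Z = 0 \/ e%:Z = 1 by lia.
rewrite !mulNr Hd Hn !PoszM; rewrite !PoszD in E1.
move: E1 E2 E3 E4 E5 E6 E7.
move: (\sum_(i < n + s) _) (\sum_(i < r) (s + i)%N%:Z) (\sum_(i < r) (n + m + _ - _)%N%:Z)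
  (\sum_(i < n) _) (\sum_(i < r) (m + i)%N%:Z) (\sum_(i < r) (N + _ - _)%N%:Z) (M%:Z).
move=> S1 S2 S3 S4 S5 S6 M' E1 E2 E3 E4 E5 E6 E7.
transitivity ((1 - q) ^ (- 'C(s, 2)%:Z - r%:Z * (N%:Z - n%:Z) - M' - S1 - S2 - S3) *
   (1 + q) ^ ('C(n, 2)%:Z - 'C(s, 2)%:Z - m%:Z * r%:Z - S1 - S2)).
  by rewrite !expfzDr //; ring.
transitivity ((1 - q) ^ (2 * 'C(s, 2)%:Z - (r%:Z + s%:Z - 1) * s%:Z - (n%:Z + s%:Z - 1) * s%:Z - S4 - S5 - S6) *
   (1 + q) ^ (2 * 'C(s, 2)%:Z - (r%:Z + s%:Z - 1) * s%:Z - (n%:Z + s%:Z - 1) * s%:Z - S5)); last first.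
  by rewrite !expfzDr //; ring.
rewrite NZ in E4 E6 E7 *.
congr (_ ^ _ * _ ^ _); move: eZ; clear NZ.
  by case=> e0; rewrite e0 in E4 E6 E7 *; lia.
by lia.
Qed.

(** M and X enter only through 2M and 12X, so that expressions with exact divisions, different for
    the two parities, can be substituted. *)
Lemma det_qfac_eval X M : 2 * M%:Z = (N%:Z + 1) * N%:Z - (N%:Z - n%:Z + 1) * (N%:Z - n%:Z) - 2 * (m%:Z * r%:Z) ->
   12 * X =
  6 * m%:Z * r%:Z * (r%:Z + m%:Z - 2 * n%:Z + 2 * e%:Z) +
  12 * r%:Z * s%:Z * (s%:Z - n%:Z + 1 - e%:Z - m%:Z) + 12 * 'C(n.+1, 3)%:Z +
  12 * (N%:Z - n%:Z) * 'C(n, 2)%:Z + 12 * (N%:Z - n%:Z + e%:Z) * 'C(s, 2)%:Z ->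
  qff q M * \det (\matrix_(i < n, j < n) skew_entry i j) =
  (-1) ^+ ('C(s, 2) + r * s) *
  (1 + q) ^ ('C(n, 2)%:Z - 'C(s, 2)%:Z - (m * r)%N%:Z) *
  (1 - q) ^ (- 'C(s, 2)%:Z - r%:Z * (N%:Z - n%:Z)) * q ^ X *
  (qfac q M / (qfac Q d ^+ s * qfac Q (n + s).-1 ^+ s)) *
  ((\prod_(i < n + s) qfac Q i) / \prod_(i < n) qfac q (N - n + i.*2.+1)) *
  (\prod_(i < r) ((qfac Q (s + i) * qfac q (n + m + i.*2.+1 - r) *
      qpo Q (q ^ (n + m + i.*2.+2 + e - r)%N%:Z) (s - e)) /
    (qfac Q (m + i) * qfac q (N + i.*2.+1 - (m + r))))) *
  \sum_(l : s.-tuple 'I_(r + s) | sorted ltn [seq val x | x <- l]) paper_term l.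
Proof.
move=> ME XE.
have a0 : 1 - q != 0 by have := q_nroot 0; rewrite subr_eq0 eq_sym.
have Q0 : 1 - Q != 0 by have := q_nroot 1; rewrite subr_eq0 eq_sym.
have := det_exptE; rewrite -XE => /(mulfI (isT : 12 != 0 :> int)) <-.
have H := det_skew_eval.
have nz (x : K) t (f : nat -> nat) : (forall i, x ^+ i.+1 != 1) -> \prod_(i < t) qff x (f i) != 0.
  by move=> xn; apply/prodf_neq0 => i _; apply: qff_neq0.
have on0 : \prod_(i < n) oddp q (s + i.+1 - e) != 0.
  apply/prodf_neq0 => i _; apply/prodf_neq0 => h _; rewrite subr_eq0 eq_sym; exact: q_nroot.
have Dd0 := expf_neq0 s (qff_neq0 Qn d).
have Yn0 := expf_neq0 s (qff_neq0 Qn (n + s).-1).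
have MM0 := nz Q r (fun i => m + i)%N Qn.
have NN0 := nz q r (fun i => N + i.*2.+1 - (m + r))%N q_nroot.
have SN0 := nz Q n (fun i => s + i)%N Qn.
cbv beta in MM0, NN0, SN0.
have den0 := mulf_neq0 (mulf_neq0 (mulf_neq0 (mulf_neq0 on0 Dd0) Yn0) MM0) NN0.
move/(canRL (mulfK den0)): H => ->.
have P1 : (\prod_(i < s) qff Q i) * (\prod_(i < r) qff Q (s + i)) = (\prod_(i < r) qff Q i) * \prod_(i < s) qff Q (r + i).
  by rewrite -!prod_ordD addnC.
have P2 := shift_split.
have W := norm_pow ME.
rewrite prodf_div !big_split /= (prod_qfac (n + s) (fun i => i) Q0) (prod_qfac n (fun i => N - n + i.*2.+1)%N a0)
  (prod_qfac r (fun i => s + i)%N Q0) (prod_qfac r (fun i => n + m + i.*2.+1 - r)%N a0)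
  (prod_qfac r (fun i => m + i)%N Q0) (prod_qfac r (fun i => N + i.*2.+1 - (m + r))%N a0).
have P3 : \prod_(i < n + s) qff Q i = (\prod_(i < s) qff Q i) * \prod_(i < n) qff Q (s + i).
  by rewrite addnC prod_ordD.
rewrite odd_even_split P3 !qfacE !exprMn.
have w1 : ((1 - Q) ^ (- d%:Z)) ^+ s != 0 by rewrite expf_neq0 ?expfz_neq0.
have w2 : ((1 - Q) ^ (- (n + s).-1%:Z)) ^+ s != 0 by rewrite expf_neq0 ?expfz_neq0.
have w3 := expfz_neq0 (- \sum_(i < n) (N - n + i.*2.+1)%N%:Z) a0.
have w4 := expfz_neq0 (- \sum_(i < r) (m + i)%N%:Z) Q0.
have w5 := expfz_neq0 (- \sum_(i < r) (N + i.*2.+1 - (m + r))%N%:Z) a0.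
rewrite -!mulrA in W; move/(canLR (mulfK (mulf_neq0 w1 (mulf_neq0 w2 (mulf_neq0 w3 (mulf_neq0 w4 w5)))))): W => <-.
rewrite -P2 -P1.
move: on0 Dd0 Yn0 MM0 NN0 SN0 w1 w2 w3 w4 w5.
do 12 (try match goal with |- context [@exprz ?R ?x ?a] => move: (@exprz R x a) end).
gen_pow; clear => *; field.
by do !(apply/andP; split).
Qed.

End Reduction.

(** * Matching the two formulas *)

Lemma q_neq0 : q != 0.
Proof. by rewrite /q tofrac_eq0 polyX_eq0. Qed.

Lemma q_nroot k : q ^+ k.+1 != 1.
Proof.
rewrite /q -tofracXn -tofrac1 tofrac_eq.
by apply/eqP => /(congr1 (fun s : {poly rat} => size s)); rewrite size_polyXn size_poly1.
Qed.

Lemma qfactE (x : F) a : qfact x a = qfac x a.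
Proof. by rewrite /qfact big_add1 /= big_mkord. Qed.

Lemma qpochE (a x : F) t : qpoch a x t = qpo x a t.
Proof. by rewrite /qpoch big_mkord. Qed.

Lemma gaussE (x : F) a t : (forall i, x ^+ i.+1 != 1) -> (t <= a)%N -> gauss x a t = gbin x a t.
Proof.
move=> xn ta; have qE b : qpoch x x b = qff x b.
  by rewrite qpochE; apply: eq_bigr => i _; rewrite -exprS.
by rewrite /gauss !qE -(gbin_fact x ta) mulfK // mulf_neq0 ?qff_neq0.
Qed.

Section Shape.
Variables N n m r : nat.
Hypotheses (nN : (n <= N)%N) (rn : (r <= n)%N) (mN : (m <= N - r + 1)%N).
Local Notation M := ('C(N.+1, 2) - ('C(N - n + 1, 2) + m * r))%N.

Lemma nth_lamN i : (i < n)%N -> nth 0%N (lamN N n) i = (N - i)%N.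
Proof. by move=> i_n; rewrite /lamN (nth_map 0%N) ?size_iota // nth_iota. Qed.

Lemma nth_muMR i : nth 0%N (muMR m r) i = shift m r i.
Proof. by rewrite /muMR nth_nseq. Qed.

Lemma skew_valid_shape : skew_valid n N (lamN N n) (muMR m r).
Proof.
split=> i i_n; rewrite ?nth_muMR ?nth_lamN ?(ltnW i_n) /shift //; try lia.
- by case: ifP; case: ifP; lia.
- by case: ifP; lia.
Qed.

Lemma ncells_poly : 2 * (ncells n N (lamN N n) (muMR m r))%:Z =
  (N%:Z + 1) * N%:Z - (N%:Z - n%:Z + 1) * (N%:Z - n%:Z) - 2 * (m%:Z * r%:Z).
Proof.
have := sum_row_exp q_neq0 skew_valid_shape.
have -> : \sum_(i < n) (row_exp (lamN N n) i - row_exp (muMR m r) i) =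
    \sum_(i < n) (0 * (i%:Z * i%:Z) + -1 * i%:Z + N%:Z) - (\sum_(i < n) shift m r i)%N%:Z.
  rewrite (big_morph Posz PoszD (erefl (Posz 0))) -sumrB; apply: eq_bigr => i _.
  by rewrite /row_exp nth_muMR nth_lamN //; have := ltn_ord i; lia.
have -> : (\sum_(i < n) shift m r i = m * r)%N.
  by rewrite -big_mkcond -(big_ord_widen n (fun=> m)) // sum_nat_const card_ord mulnC.
have := sum_poly2 0 (-1) N n; rewrite PoszM.
by move: (\sum_(i < n) _) (ncells _ _ _ _) => S c hS ->; lia.
Qed.

Lemma ncells_shape : ncells n N (lamN N n) (muMR m r) = M.
Proof.
have := ncells_poly; move: (ncells _ _ _ _) => c hc.
have := bin2_double N.+1; have := bin2_double (N - n + 1); rewrite !addn1 /=.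
have : (N - n)%N%:Z = N%:Z - n%:Z by lia.
move=> nE h1 h2.
have {}h1 : 2 * 'C((N - n).+1, 2)%:Z = (N%:Z - n%:Z + 1) * (N%:Z - n%:Z) by lia.
have {}h2 : 2 * 'C(N.+1, 2)%:Z = (N%:Z + 1) * N%:Z by lia.
have mr0 := PoszM m r.
lia.
Qed.

(** No cell lies above row 0, so the extra weight in [maj_sum] is trivial for i = 0. *)
Lemma G_det : G N n m r = qff q M * \det (\matrix_(i < n, j < n) skew_entry q N m r i j).
Proof.
transitivity (maj_sum q n N 0 (lamN N n) (muMR m r)).
  rewrite /G /Gmaj /maj_sum; apply: eq_bigr => T _.
  by rewrite (negbTE (_ : ~~ [exists c, _])) ?mulr1 //; apply/existsPn => c; rewrite !andbF.
rewrite (maj_sum_aitken q_neq0 q_nroot skew_valid_shape) // ncells_shape; congr (_ * _).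
congr (\det _); apply/matrixP => i j; rewrite !mxE mul1r /row_exp nth_muMR nth_lamN //.
by rewrite /skew_entry; congr invqf; have := ltn_ord i; lia.
Qed.

End Shape.

Section PaperTerm.
Variables N n m r s e : nat.
Local Notation Q := (q ^+ 2).

Lemma paper_termE (l : s.-tuple 'I_(r + s)) : paper_term q N n m e l =
  q ^ (\sum_(1 <= i < s.+1) (Z N + Z n + Z e - 2 * (2 * Z i - 1)) * Z (ell l i))%R *
  (\prod_(1 <= i < s.+1) \prod_(i.+1 <= j < s.+1) (qint Q (ell l j - ell l i)) ^+ 2) *
  \prod_(1 <= i < s.+1)
    (gauss Q (r + s).-1 (ell l i) * qpoch (q ^ (2 - Z N - Z n - Z e)) Q (ell l i) *
     qpoch (q ^ (Z n + Z m - Z r - 2 * Z i + 1 + Z e)) Q (r + i - (ell l i + 1)) *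
     (qpoch (q ^ (Z N - Z m - Z r - 2 * Z i + 2)) Q (r + i - (ell l i + 1)) /
      qpoch (q ^ (Z N + Z m - Z r - 2 * Z i + 2)) Q (r + i - (ell l i + 1)))).
Proof.
have ellE i : ell l i.+1 = lv l i by [].
rewrite /paper_term; congr (_ * _ * _).
- rewrite big_add1 /= big_mkord -(prod_exprz q_neq0 s (fun i => (Z N + Z n + Z e - 2 * (2 * Z i.+1 - 1)) * Z (ell l i.+1))).
  by apply: eq_bigr => i _; rewrite ellE.
- rewrite big_add1 /= big_mkord; apply: eq_bigr => i _.
  rewrite big_add1 /= big_geq_mkord; apply: eq_bigr => j _.
  by rewrite !ellE.
rewrite big_add1 /= big_mkord; apply: eq_bigr => i _; rewrite ellE.
have lb : (lv l i <= (r + s).-1)%N by rewrite lv_tnth; have := ltn_ord (tnth l i); lia.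
rewrite (gaussE (sqr_nroot q_nroot)) // !qpochE addn1 addnS subSS.
by congr (_ * _ * qpo _ (q ^ _) _ * (qpo _ (q ^ _) _ / qpo _ (q ^ _) _)); rewrite /Z; lia.
Qed.

End PaperTerm.

Section Cases.
Variables N n m r : nat.
Hypotheses (nN : (n <= N)%N) (rn : (r <= n)%N) (mN : (m <= N - r + 1)%N).
Local Notation Q := (q ^+ 2).
Local Notation M := ('C(N.+1, 2) - ('C(N - n + 1, 2) + m * r))%N.

Lemma G_eval s e X : (N + e)%N = (n + s.*2)%N -> (e <= 1)%N -> (e <= s)%N -> 12 * X =
  6 * m%:Z * r%:Z * (r%:Z + m%:Z - 2 * n%:Z + 2 * e%:Z) +
  12 * r%:Z * s%:Z * (s%:Z - n%:Z + 1 - e%:Z - m%:Z) + 12 * 'C(n.+1, 3)%:Z +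
  12 * (N%:Z - n%:Z) * 'C(n, 2)%:Z + 12 * (N%:Z - n%:Z + e%:Z) * 'C(s, 2)%:Z ->
  G N n m r =
  (-1) ^+ ('C(s, 2) + r * s) *
  (1 + q) ^ (Z 'C(n, 2) - Z 'C(s, 2) - Z (m * r)) *
  (1 - q) ^ (- Z 'C(s, 2) - Z r * (Z N - Z n)) * q ^ X *
  (qfact q M / (qfact Q (r + s).-1 ^+ s * qfact Q (n + s).-1 ^+ s)) *
  ((\prod_(1 <= i < (n + s).+1) qfact Q (i - 1)) / \prod_(1 <= i < n.+1) qfact q (N + 2 * i - (n + 1))) *
  (\prod_(1 <= i < r.+1) ((qfact Q (s + i - 1) * qfact q (n + m + 2 * i - (r + 1)) *
      qpoch (q ^+ (n + m + 2 * i + e - r)) Q (s - e)) /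
    (qfact Q (m + i - 1) * qfact q (N + 2 * i - (m + r + 1))))) *
  \sum_(l : s.-tuple 'I_(r + s) | sorted ltn [seq val x | x <- l]) paper_term q N n m e l.
Proof.
move=> NE e1 es XE.
have ME : 2 * M%:Z = (N%:Z + 1) * N%:Z - (N%:Z - n%:Z + 1) * (N%:Z - n%:Z) - 2 * (m%:Z * r%:Z).
  by rewrite -(ncells_shape nN rn mN) ncells_poly.
have mN' : (0 < r)%N -> (m + r <= N.+1)%N by lia.
have kE : n = (r + (n - r))%N by lia.
rewrite (G_det nN rn mN) (det_qfac_eval q_neq0 q_nroot kE NE e1 es mN' ME XE).
congr (_ * _ * _ * _); first by rewrite !qfactE.
  congr (_ / _); rewrite big_add1 /= big_mkord; apply: eq_bigr => i _; rewrite qfactE; congr qfac; lia.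
rewrite big_add1 /= big_mkord; apply: eq_bigr => i _; rewrite !qfactE qpochE.
by congr (qfac _ _ * qfac _ _ * qpo _ (q ^+ _) _ / (qfac _ _ * qfac _ _)); lia.
Qed.

(** One of m, r and r + m is even. This makes the division by 2 in the exponent of q exact. *)
Lemma even_half_prod : {T : nat | (m * r * (r + m) = T.*2)%N}.
Proof.
exists (m * r * (r + m))./2; rewrite -[LHS]odd_double_half !oddM oddD.
by case: (odd m); case: (odd r).
Qed.

Lemma divz2 (a b : int) : a = 2 * b -> divz a 2 = b.
Proof. by move->; rewrite mulKz. Qed.

Lemma RHSaE : ~~ odd (N - n) -> G N n m r = RHSa N n m r.
Proof.
move=> ev; set s := (N - n)./2; have NE : (N + 0)%N = (n + s.*2)%N by lia.
have [T TE] := even_half_prod.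
have TZ : m%:Z * r%:Z * (r%:Z + m%:Z) = 2 * T%:Z by rewrite -PoszD -!PoszM TE -mul2n PoszM.
have d1 : divz (Z m * Z r * (Z r + Z m - 2 * Z n)) 2 = T%:Z - m%:Z * r%:Z * n%:Z.
  by apply: divz2; rewrite /Z mulrBr TZ; ring.
have Ns : N%:Z = n%:Z + 2 * s%:Z by lia.
have d2 : divz (Z r * (Z N - Z n)) 2 = r%:Z * s%:Z by apply: divz2; rewrite /Z Ns; ring.
have d3 : divz (Z N - 3 * Z n) 2 = s%:Z - n%:Z by apply: divz2; rewrite /Z Ns; ring.
rewrite /RHSa -/s d1 d2 d3.
set X := T%:Z - _ + _ + _ + _.
have XE : 12 * X = 6 * m%:Z * r%:Z * (r%:Z + m%:Z - 2 * n%:Z + 2 * 0%:Z) +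
  12 * r%:Z * s%:Z * (s%:Z - n%:Z + 1 - 0%:Z - m%:Z) + 12 * 'C(n.+1, 3)%:Z +
  12 * (N%:Z - n%:Z) * 'C(n, 2)%:Z + 12 * (N%:Z - n%:Z + 0%:Z) * 'C(s, 2)%:Z.
  have -> : 6 * m%:Z * r%:Z * (r%:Z + m%:Z - 2 * n%:Z + 2 * 0%:Z) =
    6 * (m%:Z * r%:Z * (r%:Z + m%:Z)) - 12 * (m%:Z * r%:Z * n%:Z) by ring.
  by rewrite TZ /X /Z; ring.
rewrite (G_eval NE _ _ XE) //.
have -> : (r * (N - n))./2 = (r * s)%N by rewrite (_ : N - n = s.*2)%N ?doubleMr ?doubleK //; lia.
rewrite subn1.
have -> : (N + n - 2)./2 = (n + s).-1 by lia.
have -> : (N + n)./2 = (n + s)%N by lia.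
congr (_ * _ * _).
  by apply: eq_bigr => i _; rewrite addn0 subn0.
apply: eq_bigr => l _; rewrite paper_termE.
congr (q ^ _ * _ * _); first by apply: eq_bigr => i _; rewrite addr0.
apply: eq_big_nat => i /andP[i0 is_]; rewrite subr0 addr0.
by rewrite (_ : s - 1 + r = (r + s).-1)%N //; lia.
Qed.

Lemma RHSbE : odd (N - n) -> G N n m r = RHSb N n m r.
Proof.
move=> ev; set t := (N - n + 1)./2; have NE : (N + 1)%N = (n + t.*2)%N by lia.
have t0 : (0 < t)%N by lia.
have [T TE] := even_half_prod.
have TZ : m%:Z * r%:Z * (r%:Z + m%:Z) = 2 * T%:Z by rewrite -PoszD -!PoszM TE -mul2n PoszM.
have d1 : divz (Z m * Z r * (Z r + Z m - 2 * Z n + 2)) 2 = T%:Z - m%:Z * r%:Z * n%:Z + m%:Z * r%:Z.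
  by apply: divz2; rewrite /Z mulrDr mulrBr TZ; ring.
have Ns : N%:Z = n%:Z + 2 * t%:Z - 1 by lia.
have d2 : divz (Z r * (Z N - Z n + 1)) 2 = r%:Z * t%:Z by apply: divz2; rewrite /Z Ns; ring.
have d3 : divz (Z N - 3 * Z n + 1) 2 = t%:Z - n%:Z by apply: divz2; rewrite /Z Ns; ring.
rewrite /RHSb -/t d1 d2 d3; have -> : (N - n - 1)./2 = t.-1 by lia.
set X := T%:Z - _ + _ + _ + _ + _ + _.
have XE : 12 * X = 6 * m%:Z * r%:Z * (r%:Z + m%:Z - 2 * n%:Z + 2 * 1%:Z) +
  12 * r%:Z * t%:Z * (t%:Z - n%:Z + 1 - 1%:Z - m%:Z) + 12 * 'C(n.+1, 3)%:Z +
  12 * (N%:Z - n%:Z) * 'C(n, 2)%:Z + 12 * (N%:Z - n%:Z + 1%:Z) * 'C(t, 2)%:Z.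
  have -> : 6 * m%:Z * r%:Z * (r%:Z + m%:Z - 2 * n%:Z + 2 * 1%:Z) =
    6 * (m%:Z * r%:Z * (r%:Z + m%:Z)) - 12 * (m%:Z * r%:Z * n%:Z) + 12 * (m%:Z * r%:Z) by ring.
  by rewrite TZ /X /Z; ring.
rewrite (G_eval NE _ _ XE) //.
have -> : (r * (N - n + 1))./2 = (r * t)%N by rewrite (_ : N - n + 1 = t.*2)%N ?doubleMr ?doubleK //; lia.
have -> : (r + t.-1)%N = (r + t).-1 by lia.
have -> : (N + n - 1)./2 = (n + t).-1 by lia.
have -> : (N + n + 1)./2 = (n + t)%N by lia.
have -> : (t.-1 + r)%N = (r + t).-1 by lia.
congr (_ * _ * _).
  by apply: eq_bigr => i _; rewrite (subn1 t).
(* The two sums range over tuples in types that differ only by this equation between bounds. *)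
have LE : (r + t = (r + t).-1 + 1)%N by lia.
rewrite -LE; apply: eq_bigr => l _; rewrite paper_termE; congr (q ^ _ * _ * _).
by apply: eq_bigr => i _; congr (_ * qpoch (q ^ _) _ _ * qpoch (q ^ _) _ _ * _); rewrite /Z; lia.
Qed.

End Cases.

Theorem theorem1 (N n m r : nat) :
  (n <= N)%N -> (r <= n)%N -> (m <= N - r + 1)%N ->
  (~~ odd (N - n) -> G N n m r = RHSa N n m r) /\
  (odd (N - n) -> G N n m r = RHSb N n m r).
Proof. by move=> nN rn mN; split; [exact: RHSaE | exact: RHSbE]. Qed.
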